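(* Let $\Omega\subset\mathbb{R}^n$ be a bounded open set, and let $\vec\delta=(\delta_1,\dots,\delta_n)$ with $\delta_i>0$, $\vec s=(s_1,\dots,s_n)$ with $s_i\in(0,1)$, and $\vec p=(p_1,\dots,p_n)$ with $p_i\in(1,\infty)$. Assume that $\overline{\vec s\vec p}<n$ and $p_{\max}<\vec p^{\,*}$, where $p_{\max}=\max_i p_i$. Then, for every $f\in L^{(\vec p^{\,*})'}(\Omega)$, there exists a unique weak solution $u\in W_0^{\vec s,\vec p,\vec\delta}(\Omega)$ of $$\begin{cases}(-\widetilde\Delta_{\vec p})^{\vec s}_{\vec\delta}\,u=f&\text{in }\Omega,\\ u=0&\text{in }\mathbb{R}^n\setminus\Omega.\end{cases}$$
   Context: For $i=1,\dots,n$, $[u]^i_{s,p,\delta}=\int_{\mathbb{R}^n}\int_{|h|\le\delta}\frac{|u(x+he_i)-u(x)|^{p}}{|h|^{1+sp}}\,dh\,dx$ with $e_i$ the $i$-th canonical vector and $h\in\mathbb{R}$. Let $W_i^{s,p,\delta}(\mathbb{R}^n)=\{u\in L^{p}(\mathbb{R}^n):[u]^i_{s,p,\delta}<\infty\}$, normed by $([u]^i_{s,p,\delta})^{1/p}+\|u\|_{p}$; let $W^{\vec s,\vec p,\vec\delta}(\mathbb{R}^n)=\bigcap_{i=1}^nW_i^{s_i,p_i,\delta_i}(\mathbb{R}^n)$ with the sum of these norms, and $W_0^{\vec s,\vec p,\vec\delta}(\Omega)=\{u\in W^{\vec s,\vec p,\vec\delta}(\mathbb{R}^n):u=0\text{ a.e.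 in }\mathbb{R}^n\setminus\Omega\}$. Exponents: $\overline{\vec s}=\Big(\frac1n\sum_{i=1}^n\frac1{s_i}\Big)^{-1}$, $\overline{\vec s\vec p}=\Big(\frac1n\sum_{i=1}^n\frac1{s_ip_i}\Big)^{-1}$, $\vec p^{\,*}=\dfrac{n\,\overline{\vec s\vec p}/\overline{\vec s}}{n-\overline{\vec s\vec p}}$, and $(\vec p^{\,*})'$ is the conjugate exponent of $\vec p^{\,*}$. Functional and operator: $J_{\vec\delta}(u)=\sum_{i=1}^nJ^i_{\delta_i}(u)$ with $J^i_{\delta_i}(u)=\delta_i^{-p_i(1-s_i)}[u]^i_{s_i,p_i,\delta_i}$, and $(-\widetilde\Delta_{\vec p})^{\vec s}_{\vec\delta}u:=(J_{\vec\delta})'(u)$ is its Fréchet derivative on $W_0^{\vec s,\vec p,\vec\delta}(\Omega)$, i.e. with $D_{i,h}u(x)=u(x+he_i)-u(x)$, $$\langle(-\widetilde\Delta_{\vec p})^{\vec s}_{\vec\delta}u,v\rangle=\sum_{i=1}^n\frac{p_i}{\delta_i^{p_i(1-s_i)}}\int_{\mathbb{R}^n}\int_{|h|\le\delta_i}\frac{|D_{i,h}u(x)|^{p_i-2}D_{i,h}u(x)\,D_{i,h}v(x)}{|h|^{1+s_ip_i}}\,dh\,dx .$$ A function $u\in W_0^{\vec s,\vec p,\vec\delta}(\Omega)$ is a weak solution if $\langle(-\widetilde\Delta_{\vec p})^{\vec s}_{\vec\delta}u,v\rangle=\int_\Omega fv\,dx$ for all $v\in W_0^{\vec s,\vec p,\vec\delta}(\Omega)$.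 *)

(* Defs.v *)
From HB Require Import structures.
From mathcomp Require Import all_boot all_order all_algebra.
From mathcomp Require Import all_classical all_reals all_analysis.
Import Order.TTheory GRing.Theory Num.Theory.
Import numFieldNormedType.Exports.

Set Implicit Arguments.
Unset Strict Implicit.
Unset Printing Implicit Defensive.

Local Open Scope classical_set_scope.
Local Open Scope ring_scope.

(* R^n is ['rV[R]_n], with the topology and norm of the library. Its
   sigma-algebra is the one generated by the n coordinate functions (as the
   library does for [n.-tuple R]); R being second countable, this is the Borel
   sigma-algebra. Lebesgue classes of functions up to a.e. equality all have
   Borel representatives, so nothing is lost by not completing. *)
Definition rV_display : measure_display. Proof. exact. Qed.

Section measurable_rV.
Context {R : realType}.
Variable n : nat.

Let coords : 'I_n -> 'rV[R]_n -> measurableTypeR R := fun i x => x ord0 i.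

Let rV_set0 : g_sigma_preimage coords set0.
Proof. exact: sigma_algebra0. Qed.

Let rV_setC A : g_sigma_preimage coords A -> g_sigma_preimage coords (~` A).
Proof. exact: sigma_algebraC. Qed.

Let rV_bigcup (F : _^nat) : (forall i, g_sigma_preimage coords (F i)) ->
  g_sigma_preimage coords (\bigcup_i (F i)).
Proof. exact: sigma_algebra_bigcup. Qed.

HB.instance Definition _ := @isMeasurable.Build rV_display
  'rV[R]_n (g_sigma_preimage coords) rV_set0 rV_setC rV_bigcup.

End measurable_rV.

Section rV_coordinates.
Context {R : realType}.

Lemma measurable_coord n (i : 'I_n) :
  measurable_fun [set: 'rV[R]_n] (fun x => x ord0 i : measurableTypeR R).
Proof.
move=> _ Y mY; rewrite setTI; apply: sub_sigma_algebra => /=.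
rewrite -bigcup_seq/=; exists i => /=; first by rewrite mem_index_enum.
by exists Y => //; rewrite setTI.
Qed.

Lemma measurable_fun_coordP d (T : measurableType d) n (f : T -> 'rV[R]_n) :
  (forall i, measurable_fun setT (fun x => f x ord0 i : measurableTypeR R)) ->
  measurable_fun setT f.
Proof.
move=> mf _ Y mY; rewrite setTI.
suff S : @measurable _ 'rV[R]_n `<=` [set Y | measurable (f @^-1` Y)].
  exact: S.
apply: smallest_sub.
  split=> [|A mA|F mF] /=.
  - by rewrite preimage_set0.
  - by rewrite setTD preimage_setC; exact: measurableC.
  - by rewrite preimage_bigcup; apply: bigcup_measurable => k _; exact: mF.
rewrite -bigcup_seq/=; apply: bigcup_sub => i _ _ [B mB <-] /=.
by rewrite setTI -[X in measurable X]setTI; exact: mf.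
Qed.

Definition rV_cons n (x : 'rV[R]_n * R) : 'rV[R]_n.+1 :=
  \row_(j < n.+1) oapp (x.1 ord0) x.2 (unlift ord0 j).

Lemma measurable_rV_cons n :
  measurable_fun [set: 'rV[R]_n * measurableTypeR R] (@rV_cons n).
Proof.
apply: measurable_fun_coordP => i; rewrite /rV_cons.
under eq_fun do rewrite mxE.
case: (unlift ord0 i) => [j|] /=; last exact: measurable_snd.
exact: (measurableT_comp (measurable_coord j) measurable_fst).
Qed.

End rV_coordinates.

Section lebesgue_measure_rV.
Context (R : realType).
Local Open Scope ereal_scope.

(* Image of m times the one-dimensional Lebesgue measure; x.2 becomes the first
   coordinate. *)
Definition lebesgue_rV_step n (m : {measure set 'rV[R]_n -> \bar R}) :
    set 'rV[R]_n.+1 -> \bar R :=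
  pushforward (m \x @lebesgue_measure R) (@rV_cons R n).

HB.instance Definition _ n (m : {measure set 'rV[R]_n -> \bar R}) :=
  Measure.copy (lebesgue_rV_step m)
    (measure_function_pushforward__canonical__measure_function_Measure
      (m \x @lebesgue_measure R)%E (@measurable_rV_cons R n)).

Fixpoint lebesgue_rV (n : nat) : {measure set 'rV[R]_n -> \bar R} :=
  match n with
  | 0 => \d_(0%R : 'rV[R]_0)
  | n'.+1 => lebesgue_rV_step (lebesgue_rV n')
  end.

Lemma lebesgue_rV_box n (A : 'I_n -> set (measurableTypeR R)) :
  (forall i, measurable (A i)) ->
  lebesgue_rV n [set x : 'rV[R]_n | forall i, A i (x ord0 i)] =
  \prod_(i < n) lebesgue_measure (A i).
Proof.
elim: n A => [|n IHn] A mA.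
  rewrite big_ord0 /= diracE mem_set// => -[].
  by [].
rewrite big_ord_recl /= /lebesgue_rV_step /pushforward.
rewrite [X in product_measure1 _ _ X](_ : _ =
  [set x : 'rV[R]_n | forall i, A (lift ord0 i) (x ord0 i)] `*` A ord0).
  rewrite product_measure1E//.
    by rewrite (IHn (fun i => A (lift ord0 i)))// muleC.
  rewrite (_ : [set x | _] =
      \bigcap_(i in [set: 'I_n]) ((fun x : 'rV[R]_n => x ord0 i) @^-1`
        (A (lift ord0 i)))); last first.
    by apply/seteqP; split=> [x Ax i _|x Ax i]; [exact: Ax|exact: (Ax i I)].
  apply: fin_bigcap_measurable => // i _.
  by rewrite -[X in measurable X]setTI; exact: measurable_coord.
apply/seteqP; split=> [[x t] /= H|[x t] /= [Hx Ht] i].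
  split=> [i|]; [move: (H (lift ord0 i))|move: (H ord0)];
    by rewrite /rV_cons mxE/= ?liftK ?unlift_none.
by rewrite /rV_cons mxE; case: unliftP => [j|] -> /=.
Qed.

End lebesgue_measure_rV.

Section anisotropic_fractional_Sobolev.
Context (R : realType) (n : nat).
Implicit Types (u v f : 'rV[R]_n -> R) (Omega : set 'rV[R]_n).
Implicit Types (s p delta : 'I_n -> R).

Local Notation mu := (lebesgue_rV R n).
Local Notation lambda := (@lebesgue_measure R).

Definition increment (i : 'I_n) (h : R) u : 'rV[R]_n -> R :=
  fun x => u (x + h *: delta_mx ord0 i) - u x.

Local Open Scope ereal_scope.

(* [u]^i_{s,p,delta} itself, which is the p-th power of a seminorm. *)
Definition seminorm (i : 'I_n) (s p delta : R) u : \bar R :=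
  \int[mu]_x \int[lambda]_(h in [set h : R | (`|h| <= delta)%R])
    ((`|increment i h u x| `^ p / `|h| `^ (1 + s * p))%:E).

Definition sobolev1 (i : 'I_n) (s p delta : R) : set ('rV[R]_n -> R) :=
  [set u | u \in Lfun mu p%:E /\ seminorm i s p delta u < +oo].

Definition sobolev s p delta : set ('rV[R]_n -> R) :=
  \bigcap_(i in [set: 'I_n]) sobolev1 i (s i) (p i) (delta i).

Definition sobolev0 Omega s p delta : set ('rV[R]_n -> R) :=
  [set u | sobolev s p delta u /\
           {ae mu, forall x, (~` Omega) x -> u x = 0%R}].

(* <J'(u), v> for J(u) = \sum_i delta_i^(- p_i (1 - s_i)) [u]^i_{s_i,p_i,delta_i}.
   If p_i < 2, the library's convention 0 `^ (p_i - 2) = 0 makes the integrand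
   vanish where the increment of u does, as intended. *)
Definition laplacian_pairing s p delta u v : \bar R :=
  \sum_(i < n) (p i / delta i `^ (p i * (1 - s i)))%:E *
    \int[mu]_x \int[lambda]_(h in [set h : R | (`|h| <= delta i)%R])
      ((`|increment i h u x| `^ (p i - 2) * increment i h u x
          * increment i h v x / `|h| `^ (1 + s i * p i))%:E).

Definition weak_solution Omega s p delta f u : Prop :=
  sobolev0 Omega s p delta u /\
  forall v, sobolev0 Omega s p delta v ->
    laplacian_pairing s p delta u v = \int[mu]_(x in Omega) (f x * v x)%:E.

(* L^q(Omega): only the values on [Omega] matter, [f] is extended by zero. *)
Definition Lfun_on Omega (q : \bar R) : set ('rV[R]_n -> R) :=
  [set f | patch (fun=> 0%R) Omega f \in Lfun mu q].

End anisotropic_fractional_Sobolev.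

Section exponents.
Context (R : realType) (n : nat).
Implicit Types s p : 'I_n -> R.
Local Open Scope ring_scope.

Definition harmonic_mean (a : 'I_n -> R) : R :=
  (n%:R^-1 * \sum_(i < n) (a i)^-1)^-1.

Definition sp_bar s p : R := harmonic_mean (fun i => s i * p i).

Definition critical_exponent s p : R :=
  (n%:R * sp_bar s p / harmonic_mean s) / (n%:R - sp_bar s p).

(* The default 0 is irrelevant for positive exponents and 0 < n. *)
Definition max_exponent p : R := \big[Num.max/0]_(i < n) p i.

End exponents.

(* Main.v *)
From HB Require Import structures.
From mathcomp Require Import all_boot all_order all_algebra.
From mathcomp Require Import all_classical all_reals all_analysis.
From mathcomp Require Import measurable_realfun ring lra.
Require Import Defs.
Import Order.TTheory GRing.Theory Num.Theory.
Import numFieldNormedType.Exports.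

Set Implicit Arguments.
Unset Strict Implicit.
Unset Printing Implicit Defensive.

Local Open Scope classical_set_scope.
Local Open Scope ring_scope.

(* The solutions are the minimizers of J(u) - int f u, where J is the sum of the
   weighted seminorms [u]^i raised to the powers p_i. Since |t|^p is uniformly
   convex on bounded sets, in the quantitative form
     |a - b|^p <= e (|a|^p + |b|^p) + C_e (|a|^p + |b|^p - 2 |(a + b)/2|^p),
   a minimizing sequence is Cauchy for J and two minimizers agree. J controls
   the L^{p_i} norms by a Poincare inequality (finitely many steps of size
   h ~ delta_i along e_i leave the bounded set Omega), which yields completeness.

   Continuity of the linear term needs the embedding into L^q, q the critical
   exponent. For nested level sets A' of height tau in A, comparing u on A' with
   its translates by a box of measure 2 |A|, where it vanishes at least half of
   the time, and moving along one coordinate at a time, bounds |A'| by the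
   directional seminorms; optimizing the sides of the box gives
   |A'| <= tau^-q (tau^q |A|)^(1/sg) times the norms, sg the sum of 1/(s_i p_i).
   Applied to the dyadic slices of |u|, whose norms add up to at most that of u
   because p_i >= 1, this is a recursion for 2^(kq) |{|u| >= 2^k}| with exponent
   1/sg < 1, which bounds the L^q norm of u on {|u| >= 1}. *)

(** * Power functions *)

(** The exponents p_i differ, so J is not a power of a norm and scales only between t^(p_min) and
    t^(p_max). Closeness, boundedness, completeness and continuity of the linear term are therefore
    all measured by values of J, and estimates have the form of a bound that depends on a bound for
    J. The convexity inequality with a free e treats p < 2 and p >= 2 alike. As it makes minimizing
    sequences Cauchy, neither reflexivity nor weak compactness enters: lower semicontinuity is
    Fatou's lemma along an almost everywhere convergent sequence. The derivative of J is never
    computed. The tangent inequality for |t|^p gives both directions between minimizers and weak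
    solutions, together with continuity of the pairing along segments. The assumption that the
    harmonic mean of the s_i p_i is below n says exactly that sg > 1, that is, that the recursion on
    level sets is sublinear. *)

Section power_inequalities.
Context {R : realType}.
Implicit Types a b c p q r x y : R.

(** Strict Bernoulli inequality. With y = ln x and x^p = x e^((p - 1) y), it is the sum of the
    strict bounds e^t > 1 + t at t = (p - 1) y and at t = - y, with weights x and (p - 1) x; the
    terms in y cancel. *)
Lemma powR_tangent1_lt p x : 1 < p -> 0 <= x -> x != 1 ->
  1 + p * (x - 1) < x `^ p.
Proof.
move=> p1 x0 x1; have p0 : 0 < p by rewrite (lt_trans _ p1).
have [->|xn0] := eqVneq x 0.
  by rewrite powR0 ?gt_eqF// sub0r mulrN1 subr_lt0.
have {}x0 : 0 < x by rewrite lt_def xn0.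
pose y := ln x.
have ex : expR y = x by rewrite lnK// posrE.
have yn0 : y != 0.
  by apply: contraNneq x1 => y0; rewrite -ex y0 expR0.
have h1 : 1 + (p - 1) * y < expR ((p - 1) * y).
  by apply: expR_gt1Dx; rewrite mulf_neq0// subr_eq0 gt_eqF.
have h2 : 1 - y < expR (- y) by apply: expR_gt1Dx; rewrite oppr_eq0.
have -> : x `^ p = x * expR ((p - 1) * y).
  rewrite /powR gt_eqF// -/y -[X in _ = X * _]ex -expRD; congr expR; ring.
have h3 : x * expR (- y) = 1 by rewrite -ex -expRD subrr expR0.
suff : 0 < x * (expR ((p - 1) * y) - (1 + (p - 1) * y)) +
           (p - 1) * (x * (expR (- y) - (1 - y))).
  rewrite mulrBr (mulrBr x (expR (- y))) h3; nra.
by apply: addr_gt0; rewrite !mulr_gt0// subr_gt0.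
Qed.

Lemma powR_tangent_lt p c y : 1 < p -> 0 < c -> 0 <= y -> y != c ->
  c `^ p + p * c `^ (p - 1) * (y - c) < y `^ p.
Proof.
move=> p1 c0 y0 yc.
have p0 : 0 < p by rewrite (lt_trans _ p1).
have yE : y = c * (y / c) by rewrite mulrC divfK// gt_eqF.
have yc0 : 0 <= y / c by rewrite divr_ge0// ltW.
have : 1 + p * (y / c - 1) < (y / c) `^ p.
  apply: powR_tangent1_lt => //.
  by apply: contraNneq yc => yc1; rewrite yE yc1 mulr1.
have -> : y `^ p = c `^ p * (y / c) `^ p by rewrite -powRM ?(ltW c0)// -yE.
move=> h.
have -> : c `^ p = c * c `^ (p - 1) by rewrite mulr_powRB1// ltW.
have : 0 < c * c `^ (p - 1) by rewrite mulr_gt0// powR_gt0.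
move: h; set z := _ `^ p; set w := c * _ => h w0.
rewrite (_ : p * c `^ (p - 1) * (y - c) = w * (p * (y / c - 1))).
  by rewrite -[X in X + _]mulr1 -mulrDr ltr_pM2l.
by rewrite /w; field; rewrite gt_eqF.
Qed.

Lemma mulr_powRB2 p x : 1 < p -> 0 <= x -> x `^ (p - 2) * x = x `^ (p - 1).
Proof.
move=> p1; rewrite le_eqVlt => /predU1P[<-|x0].
  by rewrite mulr0 powR0// subr_eq0 gt_eqF.
rewrite -{2}(powRr1 (ltW x0)) -powRD; last by rewrite (gt_eqF x0) implybT.
by congr powR; ring.
Qed.

(** Gradient inequality for the convex function |t|^p. Since a (c - a) <= |a| (|c| - |a|),
    nonnegative arguments suffice. *)
Lemma powR_norm_tangent p a c : 1 < p ->
  `|a| `^ p + p * (`|a| `^ (p - 2) * a) * (c - a) <= `|c| `^ p.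
Proof.
move=> p1; have p0 : 0 < p by rewrite (lt_trans _ p1).
have [->|an0] := eqVneq a 0.
  by rewrite mulr0 mulr0 mul0r addr0 normr0 powR0 ?gt_eqF// powR_ge0.
have a0 : 0 < `|a| by rewrite normr_gt0.

apply: (@le_trans _ _ (`|a| `^ p + p * `|a| `^ (p - 1) * (`|c| - `|a|))).
  rewrite lerD2l -(mulr_powRB2 p1)// -!mulrA ler_pM2l// ler_wpM2l ?powR_ge0//.
  rewrite mulrBr mulrBr -normrM lerB ?ler_norm//.
  by rewrite -normrM ger0_norm// -expr2 sqr_ge0.
have [->|ca] := eqVneq `|c| `|a|; first by rewrite subrr mulr0 addr0.
by apply: ltW; apply: powR_tangent_lt.
Qed.

(** The linear terms of the strict tangent inequalities at c = (1 + |x|) / 2, taken at the points 1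
    and |x|, cancel. For x = -1 both points coincide with c, and the value is computed directly. *)
Lemma powR_midpoint_lt p x : 1 < p -> -1 <= x -> x < 1 ->
  0 < 1 + `|x| `^ p - 2 * `|(1 + x) / 2| `^ p.
Proof.
move=> p1 x1 x2; have p0 : 0 < p by rewrite (lt_trans _ p1).
have nx1 : `|x| <= 1 by rewrite ler_norml x1 ltW.
set c := (1 + `|x|) / 2.
have cx : `|(1 + x) / 2| <= c.
  rewrite /c normrM (@ger0_norm _ (2^-1))// ler_pM2r// (le_trans (ler_normD _ _))//.
  by rewrite normr1.
have c0 : 0 < c by rewrite /c divr_gt0// ltr_pwDl.
have [nx|nx] := eqVneq `|x| 1.
  have xE : x = -1 by move: nx x2; case: ler0P => [_ <-|_ ->]; lra.
  rewrite nx powR1 xE subrr mul0r normr0 powR0 ?gt_eqF// mulr0 subr0; lra.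
have h1 : c `^ p + p * c `^ (p - 1) * (1 - c) < 1 `^ p.
  by apply: powR_tangent_lt => //; rewrite /c; move: nx => /eqP nx; apply/eqP; lra.
have h2 : c `^ p + p * c `^ (p - 1) * (`|x| - c) < `|x| `^ p.
  by apply: powR_tangent_lt => //; rewrite /c; move: nx => /eqP nx; apply/eqP; lra.
have h3 : `|(1 + x) / 2| `^ p <= c `^ p.
  by rewrite ge0_ler_powR ?nnegrE ?(ltW p0)// ltW.
move: h1 h2; rewrite powR1.
have : (1 - c) = - (`|x| - c) by rewrite /c; field.
move=> ->; nra.
Qed.

Lemma continuous_powR_pos r x : 0 < x -> {for x, continuous (@powR R ^~ r)}.
Proof.
move=> x0; apply/differentiable_continuous/derivable1_diffP.
by apply: derivable_powR; rewrite in_itv/= x0.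
Qed.

Lemma powR_norm_cvg0 r : 0 < r -> `|x| `^ r @[x --> (0 : R)] --> (0 : R).
Proof.
move=> r0; apply/cvgr0Pnorm_lt => e e0; near=> x.
rewrite ger0_norm ?powR_ge0//.
rewrite (_ : e = (e `^ r^-1) `^ r); last first.
  by rewrite -powRrM mulVf ?gt_eqF// powRr1// ltW.
apply: gt0_ltr_powR; rewrite ?nnegrE ?powR_ge0//.
near: x; apply: cvgr0_norm_lt; first exact: cvg_id.
exact: powR_gt0.
Unshelve. all: by end_near. Qed.

Lemma continuous_powR_norm r : 0 < r -> continuous (fun x : R => `|x| `^ r).
Proof.
move=> r0 x; have [->|x0] := eqVneq x 0.
  by rewrite /continuous_at normr0 powR0 ?gt_eqF//; exact: powR_norm_cvg0.
apply: (@continuous_comp _ _ _ (fun x : R => `|x|) (@powR R ^~ r)).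
  exact: norm_continuous.
by apply: continuous_powR_pos; rewrite normr_gt0.
Qed.

Lemma continuous_signed_powR p : 1 < p ->
  continuous (fun x : R => `|x| `^ (p - 2) * x).
Proof.
move=> p1 x; have [->|x0] := eqVneq x 0.
  rewrite /continuous_at mulr0; apply/cvgr0Pnorm_lt => e e0.
  have := @powR_norm_cvg0 (p - 1); rewrite subr_gt0 => /(_ p1).
  move=> /cvgr0Pnorm_lt/(_ _ e0); apply: filterS => y.
  apply: le_lt_trans; rewrite normrM ger0_norm ?powR_ge0//.
  by rewrite mulr_powRB2// ler_norm.
apply: (@continuousM _ _ (fun x : R => `|x| `^ (p - 2)) id); last exact: cvg_id.
apply: (@continuous_comp _ _ _ (fun x : R => `|x|) (@powR R ^~ (p - 2))).
  exact: norm_continuous.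
by apply: continuous_powR_pos; rewrite normr_gt0.
Qed.

Lemma powR_midpoint_ge0 p a b : 1 < p ->
  0 <= `|a| `^ p + `|b| `^ p - 2 * `|(a + b) / 2| `^ p.
Proof.
move=> p1; set c := (a + b) / 2.
have ha := powR_norm_tangent c a p1; have hb := powR_norm_tangent c b p1.
have : b - c = - (a - c) by rewrite /c; field.
by move=> bc; rewrite bc in hb; nra.
Qed.

(* By homogeneity it suffices to treat a = 1 and -1 <= b <= 1, where
   compactness applies to the b away from 1. *)
Lemma powR_uniform_convexity p e : 1 < p -> 0 < e -> exists2 C, 0 <= C &
  forall a b, `|a - b| `^ p <= e * (`|a| `^ p + `|b| `^ p) +
    C * (`|a| `^ p + `|b| `^ p - 2 * `|(a + b) / 2| `^ p).
Proof.
move=> p1 e0; have p0 : 0 < p by rewrite (lt_trans _ p1).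
pose g x := 1 + `|x| `^ p - 2 * `|(1 + x) / 2| `^ p.
have gc : continuous g.
  move=> x; apply: (@continuousB _ _ _ (fun x => 1 + `|x| `^ p)
    (fun x => 2 * `|(1 + x) / 2| `^ p)).
    by apply: continuousD; [exact: cst_continuous|exact: continuous_powR_norm].
  apply: continuousM; first exact: cst_continuous.
  apply: (@continuous_comp _ _ _ (fun x => (1 + x) / 2) (fun x => `|x| `^ p)).
    apply: continuousM; last exact: cst_continuous.
    by apply: continuousD; [exact: cst_continuous|exact: cvg_id].
  exact: continuous_powR_norm.
(* As eta^p = e, the term e alone bounds |1 - x|^p for x > 1 - eta. On [-1, 1 - eta] the function g
   has a positive minimum m, and |1 - x| <= 2 gives C = 2^p / m. *)
pose eta := e `^ p^-1.
have eta0 : 0 < eta by exact: powR_gt0.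
have etaE : eta `^ p = e by rewrite -powRrM mulVf ?gt_eqF// powRr1// ltW.
have norm1 : exists2 C, 0 <= C & forall x, -1 <= x <= 1 ->
    `|1 - x| `^ p <= e + C * g x.
  have [m m0 mg] : exists2 m, 0 < m & forall x, -1 <= x <= 1 - eta -> m <= g x.
    (* For eta > 2 the interval is empty and any m > 0 serves. *)
    have [h|h] := leP (-1) (1 - eta); last first.
      by exists 1 => // x /andP[/le_trans h1 /h1]; rewrite leNgt h.
    have [x xI xmin] := EVT_min h (continuous_subspaceT gc).
    exists (g x); last by move=> y yI; apply: xmin; rewrite in_itv.
    move: xI; rewrite in_itv/= => /andP[x1 x2].
    by apply: powR_midpoint_lt => //; rewrite (le_lt_trans x2)// gtrBl.
  exists (2 `^ p / m) => [|x /andP[x1 x2]]; first by rewrite divr_ge0// ?powR_ge0// ltW.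
  have [xe|xe] := leP x (1 - eta).
    apply: (@le_trans _ _ (2 `^ p)).
      by rewrite ge0_ler_powR ?nnegrE ?(ltW p0)// ger0_norm ?subr_ge0//; lra.
    apply: ler_wpDl; first exact: ltW.
    rewrite -mulrA ler_peMr ?powR_ge0// ler_pdivlMl// mulr1.
    by apply: mg; rewrite x1.
  apply: ler_wpDr.
    rewrite mulr_ge0// ?divr_ge0 ?powR_ge0// ?(ltW m0)//.
    by have := powR_midpoint_ge0 1 x p1; rewrite normr1 powR1.
  rewrite -[leRHS]etaE ge0_ler_powR ?nnegrE ?(ltW p0) ?(ltW eta0)//.
  by rewrite ger0_norm ?subr_ge0//; lra.
have [C C0 CP] := norm1; exists C => // a b.
wlog ab : a b / `|b| <= `|a|.
  move=> wl; have [/wl//|/ltW/wl] := leP `|b| `|a|.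
  by rewrite distrC (addrC (`|b| `^ p)) (addrC b).
have [a0|an0] := eqVneq a 0.
  move: ab; rewrite a0 normr0 normr_le0 => /eqP ->.
  by rewrite subr0 addr0 mul0r normr0 powR0 ?gt_eqF// !(addr0, mulr0, subr0).
have a0 : 0 < `|a| by rewrite normr_gt0.
have := CP (b / a); rewrite -ler_norml normrM normfV ler_pdivrMr// mul1r => /(_ ab).
rewrite -(@ler_pM2l _ (`|a| `^ p)) ?powR_gt0//.
have h x : `|a| `^ p * `|x| `^ p = `|a * x| `^ p by rewrite normrM powRM.
rewrite h (_ : a * (1 - b / a) = a - b); last by field.
move=> /le_trans; apply.
have -> : C * (`|a| `^ p + `|b| `^ p - 2 * `|(a + b) / 2| `^ p) =
    `|a| `^ p * (C * g (b / a)).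
  rewrite /g mulrCA; congr (_ * _).
  rewrite mulrBr mulrDr mulr1 h.
  rewrite [X in _ = _ - X]mulrCA h.
  have -> : a * (b / a) = b by field.
  by have -> : a * ((1 + b / a) / 2) = (a + b) / 2 by field.
rewrite [leLHS]mulrDr lerD2r mulrC ler_pM2l// lerDl; exact: powR_ge0.
Qed.

Lemma powR_normD_le p a b : 0 < p ->
  `|a + b| `^ p <= 2 `^ p * (`|a| `^ p + `|b| `^ p).
Proof.
move=> p0; wlog ab : a b / `|b| <= `|a|.
  move=> wl; have [/wl//|/ltW/wl] := leP `|b| `|a|.
  by rewrite addrC [X in 2 `^ p * X]addrC.
apply: (@le_trans _ _ ((2 * `|a|) `^ p)).
  rewrite ge0_ler_powR ?nnegrE ?(ltW p0)// ?mulr_ge0//.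
  by rewrite (le_trans (ler_normD _ _))// mulr_natl mulr2n lerD2l.
by rewrite powRM// ler_pM2l ?powR_gt0// lerDl powR_ge0.
Qed.

(** Young's inequality without its constants: the left side is at most max(|a|, |b|)^p. It bounds
    the integrand of the pairing by the two energy densities. *)
Lemma signed_powR_le p a b : 1 < p ->
  `| `|a| `^ (p - 2) * a * b | <= `|a| `^ p + `|b| `^ p.
Proof.
move=> p1; have p0 : 0 < p by rewrite (lt_trans _ p1).
have [->|an0] := eqVneq a 0; first by rewrite mulr0 mul0r normr0 addr_ge0 ?powR_ge0.
have a0 : 0 < `|a| by rewrite normr_gt0.
rewrite !normrM ger0_norm ?powR_ge0//.
rewrite mulr_powRB2//.
have pE x : `|x| `^ p = `|x| `^ (p - 1) * `|x| by rewrite mulrC mulr_powRB1.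
have [ab|ab] := leP `|b| `|a|.
  rewrite (@le_trans _ _ (`|a| `^ p)) ?lerDl ?powR_ge0//.
  by rewrite pE ler_wpM2l ?powR_ge0.
rewrite (@le_trans _ _ (`|b| `^ p)) ?lerDr ?powR_ge0//.
rewrite pE ler_wpM2r// ge0_ler_powR ?nnegrE// ?subr_ge0 ?(ltW p1)//; exact: ltW.
Qed.

End power_inequalities.

(** * Lebesgue measure on R^n *)

Section measure_preserving.
Context d1 d2 (T1 : measurableType d1) (T2 : measurableType d2) (R : realType).
Local Open Scope ereal_scope.

Lemma ge0_integral_measure_preserving (m1 : {measure set T1 -> \bar R})
    (m2 : {measure set T2 -> \bar R}) (phi : T1 -> T2) (f : T2 -> \bar R) :
  measurable_fun [set: T1] phi ->
  (forall A, measurable A -> m1 (phi @^-1` A) = m2 A) ->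
  measurable_fun [set: T2] f -> (forall x, 0 <= f x) ->
  \int[m1]_x f (phi x) = \int[m2]_x f x.
Proof.
move=> mphi m12 mf f0.
rewrite -(@eq_measure_integral _ _ _ setT m2 (pushforward m1 phi)).
  by rewrite (ge0_integral_pushforward mphi).
by move=> A mA _; rewrite /pushforward -m12.
Qed.

End measure_preserving.

Section integral_mrestr.
Context d1 (T1 : measurableType d1) (R : realType).
Local Open Scope ereal_scope.

(** Turns an integral over [D] into one over the whole space, the form in which
    [ge0_integral_measure_preserving] is applied to a box. *)
Lemma ge0_integral_mrestr (m : {measure set T1 -> \bar R}) (D : set T1)
    (mD : measurable D) (f : T1 -> \bar R) :
  measurable_fun [set: T1] f -> (forall x, 0 <= f x) ->
  \int[mrestr m mD]_x f x = \int[m]_(x in D) f x.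
Proof.
move=> mf f0.
transitivity (\int[mrestr m mD]_(x in D) f x).
  rewrite (@ge0_negligible_integral _ _ _ (mrestr m mD) setT (~` D))//.
  - by rewrite setTD setCK.
  - exact: measurableC.
  - by change (m (~` D `&` D) = 0); rewrite setICl measure0.
apply: eq_measure_integral => A mA AD.
by change (m (A `&` D) = m A); rewrite setIidl.
Qed.

End integral_mrestr.

Section lebesgue_rV_theory.
Context {R : realType}.
Local Notation lam := (@lebesgue_measure R).
Local Open Scope ereal_scope.

Lemma lebesgue_measure_translate (t : R) (A : set (measurableTypeR R)) :
  measurable A -> lam ((fun x : measurableTypeR R => (x + t)%R) @^-1` A) = lam A.
Proof.
have mf : measurable_fun setT ((fun x => (x + t)%R) : measurableTypeR R -> measurableTypeR R).
  exact: measurable_funD.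
move=> mA.
apply/esym/(@lebesgue_measure_unique _ (pushforward lam (fun x : measurableTypeR R => (x + t)%R : measurableTypeR R))) => //=.
move=> _ [[a b]] _ <-; rewrite /pushforward.
rewrite (_ : _ @^-1` _ = `](a - t)%R, (b - t)%R]%classic).
  by rewrite !lebesgue_measure_itv/= !lte_fin ltrD2r -!EFinD; case: ifPn => // _;
    congr EFin; ring.
by apply/seteqP; split => x /=; rewrite !in_itv/= ltrBlDr lerBrDr.
Qed.

Lemma measurable_rV_coordP n d (T : measurableType d) (f : T -> 'rV[R]_n) :
  measurable_fun setT f -> forall i,
  measurable_fun setT (fun x => f x ord0 i : measurableTypeR R).
Proof. by move=> mf i; exact: (measurableT_comp (measurable_coord i) mf). Qed.

Lemma measurable_rVD n d (T : measurableType d) (f g : T -> 'rV[R]_n) :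
  measurable_fun setT f -> measurable_fun setT g ->
  measurable_fun setT (fun x => (f x + g x)%R).
Proof.
move=> mf mg; apply: measurable_fun_coordP => i; under eq_fun do rewrite mxE.
by apply: measurable_funD; exact: measurable_rV_coordP.
Qed.

Lemma measurable_rV_scale n d (T : measurableType d) (f : T -> R)
    (v : 'rV[R]_n) :
  measurable_fun setT (f : T -> measurableTypeR R) ->
  measurable_fun setT (fun x => (f x *: v)%R).
Proof.
move=> mf; apply: measurable_fun_coordP => i; under eq_fun do rewrite mxE.
exact: measurable_funM.
Qed.

Lemma lebesgue_rV_sigma_finite n : sigma_finite setT (lebesgue_rV R n).
Proof.
exists (fun k => [set x : 'rV[R]_n | forall i, `[(- k%:R)%R, k%:R%R]%classic (x ord0 i)]).
  apply/esym/seteqP; split => // x _.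
  exists (Num.truncn (\sum_(i < n) `|x ord0 i|)).+1 => //= i.
  rewrite in_itv/= -ler_norml ltW// (le_lt_trans _ (truncnS_gt _))//.
  by rewrite (bigD1 i)//= lerDl sumr_ge0.
move=> k; split.
  rewrite (_ : [set x | _] =
      \bigcap_(i in [set: 'I_n]) ((fun x : 'rV[R]_n => x ord0 i) @^-1`
        `[(- k%:R)%R, k%:R%R]%classic)); last first.
    by apply/seteqP; split=> [x Ax i _|x Ax i]; [exact: Ax|exact: (Ax i I)].
  apply: fin_bigcap_measurable => // i _.
  by rewrite -[X in measurable X]setTI; exact: measurable_coord.
rewrite (@lebesgue_rV_box R n (fun=> `[(- k%:R)%R, k%:R%R]%classic))//.
rewrite lebesgue_measure_itv/= lte_fin; case: ifPn => _; last first.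
  by rewrite prodEFin ltry.
rewrite -EFinD prodEFin ltry//.
Qed.

(* [lebesgue_rV R n] under a name to which a sigma-finite structure can be
   attached. *)
Definition leb n : set 'rV[R]_n -> \bar R := lebesgue_rV R n.
Arguments leb : clear implicits.
HB.instance Definition _ n := Measure.copy (leb n) (lebesgue_rV R n).
HB.instance Definition _ n := Measure_isSigmaFinite.Build _ _ _ (leb n)
  (@lebesgue_rV_sigma_finite n).

(** Induction on the dimension: a section of the translated set is a translate of the section of [A]
    over the translated base point. Invariance on the line treats the section, the induction
    hypothesis the base point. *)
Lemma leb_translate n (y : 'rV[R]_n) (A : set 'rV[R]_n) :
  measurable A -> leb n ((fun x => (x + y)%R) @^-1` A) = leb n A.
Proof.
elim: n y A => [|n IHn] y A mA.
  by congr (leb _ _); apply/seteqP; split => x /=; rewrite (thinmx0 (x + y)%R) (thinmx0 x).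
pose y0 := y ord0 ord0; pose y' : 'rV[R]_n := (\row_j y ord0 (lift ord0 j))%R.
rewrite /leb /= /lebesgue_rV_step /pushforward.
pose B := @rV_cons R n @^-1` A.
have mB : measurable B.
  by rewrite /B -[X in measurable X]setTI; exact: measurable_rV_cons.
rewrite -/B; set B' := _ @^-1` _.
have B'E x : xsection B' x =
    (fun t : measurableTypeR R => (t + y0)%R) @^-1` (xsection B (x + y')%R).
  apply/seteqP; split => t /=; rewrite /xsection/= !inE /B' /B/=;
  rewrite (_ : rV_cons (x, t) + y = rV_cons (x + y', t + y0))%R//;
  apply/rowP => j; rewrite !mxE/=; case: unliftP => [k|] -> /=;
  by rewrite ?mxE.
rewrite /product_measure1/=.
pose F x := lam (xsection B x).
transitivity (\int[leb n]_x F (x + y')%R).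
  apply: eq_integral => x _; rewrite B'E lebesgue_measure_translate//.
  exact: measurable_xsection.
have mF : measurable_fun setT F by exact: measurable_fun_xsection.
apply: (@ge0_integral_measure_preserving _ _ _ _ _ (leb n) (leb n)
  (fun x => (x + y')%R) F) => //.
- by apply: measurable_rVD => //; exact: measurable_cst.
- by move=> C mC; exact: IHn.
Qed.

Lemma ge0_integral_translate n (y : 'rV[R]_n) (f : 'rV[R]_n -> \bar R) :
  measurable_fun [set: 'rV[R]_n] f -> (forall x, 0 <= f x) ->
  \int[leb n]_x f (x + y)%R = \int[leb n]_x f x.
Proof.
apply: ge0_integral_measure_preserving; last by move=> A; exact: leb_translate.
by apply: measurable_rVD => //; exact: measurable_cst.
Qed.

Definition box n (rho : 'I_n -> R) : set 'rV[R]_n :=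
  [set x | forall i, `[(- rho i)%R, rho i]%classic (x ord0 i)].

Lemma measurable_coord_box n (A : 'I_n -> set (measurableTypeR R)) :
  (forall i, measurable (A i)) ->
  measurable [set x : 'rV[R]_n | forall i, A i (x ord0 i)].
Proof.
move=> mA; rewrite (_ : [set x | _] =
    \bigcap_(i in [set: 'I_n]) ((fun x : 'rV[R]_n => x ord0 i) @^-1` A i)).
  apply: fin_bigcap_measurable => // i _.
  by rewrite -[X in measurable X]setTI; exact: measurable_coord.
by apply/seteqP; split=> [x Ax i _|x Ax i]; [exact: Ax|exact: (Ax i I)].
Qed.

Lemma measurable_box n (rho : 'I_n -> R) : measurable (box rho).
Proof. exact: (@measurable_coord_box n (fun i => `[(- rho i)%R, rho i]%classic)). Qed.

Lemma lebesgue_itv_sym (r : R) : (0 <= r)%R -> lam `[(- r)%R, r]%classic = (2 * r)%:E.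
Proof.
move=> r0; rewrite lebesgue_measure_itv/= lte_fin; case: ifPn => [_|].
  by rewrite -EFinD; congr EFin; ring.
by rewrite -leNgt => h; congr EFin; lra.
Qed.

Lemma leb_box n (rho : 'I_n -> R) : (forall i, 0 <= rho i)%R ->
  leb n (box rho) = (\prod_(i < n) (2 * rho i))%:E.
Proof.
move=> rho0.
rewrite /leb /box (@lebesgue_rV_box R n (fun i => `[(- rho i)%R, rho i]%classic))//.
by rewrite -prodEFin; apply: eq_bigr => i _; rewrite lebesgue_itv_sym.
Qed.

(** The i-th coordinate carries Lebesgue measure on the box to Lebesgue measure on the i-th side,
    scaled by the volume of the remaining sides. *)
Lemma integral_box_coord n (rho : 'I_n -> R) i (g : measurableTypeR R -> \bar R) :
  (forall i, 0 < rho i)%R -> measurable_fun [set: measurableTypeR R] g ->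
  (forall t, 0 <= g t) ->
  \int[leb n]_(x in box rho) g (x ord0 i) =
  ((\prod_(j < n) (2 * rho j)) / (2 * rho i))%:E *
    \int[lam]_(t in `[(- rho i)%R, rho i]%classic) g t.
Proof.
move=> rho0 mg g0.
pose I := `[(- rho i)%R, rho i]%classic : set (measurableTypeR R).
have mI : measurable I by exact: measurable_itv.
have C0 : (0 <= (\prod_(j < n) (2 * rho j)) / (2 * rho i))%R.
  by rewrite divr_ge0 ?prodr_ge0// => *; rewrite mulr_ge0// ltW.
pose C := NngNum C0.
rewrite -(ge0_integral_mrestr (leb n) (measurable_box rho))//; last first.
  exact: (measurableT_comp mg (measurable_coord i)).
rewrite -(ge0_integral_mrestr lam mI)//.
rewrite -(@ge0_integral_mscale _ _ _ (mrestr lam mI) setT measurableT C g)//.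
apply: (@ge0_integral_measure_preserving _ _ _ _ R (mrestr (leb n) (measurable_box rho))
  (mscale C (mrestr lam mI)) (fun x => x ord0 i) g) => //.
  exact: measurable_coord.
move=> A mA.
rewrite /mscale/= /mrestr/=.
pose B j : set (measurableTypeR R) := if j == i then A `&` I else `[(- rho j)%R, rho j]%classic.
have mB j : measurable (B j).
  by rewrite /B; case: ifPn => _; [exact: measurableI|exact: measurable_itv].
rewrite (_ : _ `&` _ = [set x : 'rV[R]_n | forall j, B j (x ord0 j)]).
  rewrite /leb lebesgue_rV_box// (bigD1 i)//= /B eqxx.
  change (lam (A `&` I) * \prod_(j < n | j != i)
     lam (if j == i then A `&` I else `[(- rho j)%R, rho j]%classic) =
     (\prod_(j < n) (2 * rho j) / (2 * rho i))%:E * lam (A `&` I)).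
  rewrite [in RHS](bigD1 i)//= mulrAC divff ?mul1r; last first.
    by rewrite mulf_neq0// gt_eqF.
  rewrite muleC; congr (_ * _).
  rewrite -prodEFin; apply: eq_bigr => j /negbTE ->.
  by rewrite lebesgue_itv_sym// ltW.
apply/seteqP; split=> [x [Ax Bx] j|x Bx].
  by rewrite /B; case: eqP => [->|_]; [split => //; exact: Bx|exact: Bx].
split; first by have := Bx i; rewrite /B eqxx => -[].
by move=> j; have := Bx j; rewrite /B; case: eqP => [-> []|].
Qed.

End lebesgue_rV_theory.
Arguments leb : clear implicits.

(** * Increments and level sets *)

Section increments.
Context {R : realType}.
Variable n : nat.
Implicit Types (u v w : 'rV[R]_n -> R) (i : 'I_n) (s p delta : R).
Local Notation lam := (@lebesgue_measure R).
Local Notation mu := (leb R n).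

Lemma measurable_shift i :
  measurable_fun [set: 'rV[R]_n * measurableTypeR R]
    (fun z => z.1 + z.2 *: (delta_mx ord0 i : 'rV[R]_n)).
Proof.
apply: measurable_rVD; first exact: measurable_fst.
by apply: measurable_rV_scale; exact: measurable_snd.
Qed.

Lemma measurable_increment i u : measurable_fun [set: 'rV[R]_n] u ->
  measurable_fun [set: 'rV[R]_n * measurableTypeR R]
    (fun z => increment i z.2 u z.1).
Proof.
move=> um; apply: measurable_funB.
  exact: (measurableT_comp um (measurable_shift i)).
exact: (measurableT_comp um measurable_fst).
Qed.

Lemma measurable_powR_norm d (T : measurableType d) (D : set T) (f : T -> R) p :
  measurable_fun D f -> measurable_fun D (fun x => `|f x| `^ p).
Proof.
move=> mf.
by apply: (measurableT_comp (measurable_powR p)); exact: (measurableT_comp (@normr_measurable _ _)).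
Qed.

(** The truncation is part of the kernel, so that h ranges over the whole line and Tonelli's theorem
    applies on a product space. *)
Definition increment_kernel s p delta (h : R) : R :=
  \1_[set h : R | `|h| <= delta] h * (`|h| `^ (1 + s * p))^-1.

Lemma increment_kernel_ge0 s p delta h : 0 <= increment_kernel s p delta h.
Proof. by rewrite mulr_ge0// invr_ge0 powR_ge0. Qed.

Lemma increment_kernelE s p delta h : `|h| <= delta ->
  increment_kernel s p delta h = (`|h| `^ (1 + s * p))^-1.
Proof. by move=> hd; rewrite /increment_kernel indicE mem_set// mul1r. Qed.

Lemma set_norm_le_itv delta :
  [set h : R | `|h| <= delta] = `[(- delta)%R, delta]%classic.
Proof. by apply/seteqP; split => h /=; rewrite in_itv/= ler_norml. Qed.

Lemma measurable_norm_le delta :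
  measurable ([set h : R | `|h| <= delta] : set (measurableTypeR R)).
Proof. by rewrite set_norm_le_itv; exact: measurable_itv. Qed.

Lemma measurable_increment_kernel s p delta :
  measurable_fun [set: measurableTypeR R] (increment_kernel s p delta).
Proof.
apply: measurable_funM.
  by apply: measurable_indic; exact: measurable_norm_le.
under eq_fun do rewrite -powRN.
by apply: measurable_powR_norm; exact: measurable_id.
Qed.

Local Open Scope ereal_scope.

Lemma integral_kernel s p delta (f : R -> R) :
  \int[lam]_(h in [set h : R | (`|h| <= delta)%R])
    ((f h / `|h| `^ (1 + s * p))%:E) =
  \int[lam]_h (f h * increment_kernel s p delta h)%:E.
Proof.
rewrite integral_mkcond; apply: eq_integral => h _.
rewrite patchE /increment_kernel indicE; case: ifPn => _; first by rewrite mul1r.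
by rewrite mul0r mulr0.
Qed.

Lemma measurable_powR_increment i p u : measurable_fun [set: 'rV[R]_n] u ->
  measurable_fun [set: 'rV[R]_n * measurableTypeR R]
    (fun z => (`|increment i z.2 u z.1| `^ p)%:E).
Proof.
move=> um; apply/measurable_EFinP/measurable_powR_norm.
exact: measurable_increment.
Qed.

Lemma measurable_seminorm_integrand i s p delta u :
  measurable_fun [set: 'rV[R]_n] u ->
  measurable_fun [set: 'rV[R]_n * measurableTypeR R]
    (fun z => (`|increment i z.2 u z.1| `^ p * increment_kernel s p delta z.2)%:E).
Proof.
move=> um; apply/measurable_EFinP/measurable_funM.
  by apply: measurable_powR_norm; exact: measurable_increment.
exact: (measurableT_comp (measurable_increment_kernel s p delta) measurable_snd).
Qed.

Lemma seminormE i s p delta u : measurable_fun [set: 'rV[R]_n] u ->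
  seminorm i s p delta u =
  \int[mu \x lam]_z
    (`|increment i z.2 u z.1| `^ p * increment_kernel s p delta z.2)%:E.
Proof.
move=> um; rewrite (fubini_tonelli1 _ (measurable_seminorm_integrand _ _ _ _ um))/=.
  by apply: eq_integral => x _; rewrite integral_kernel.
by move=> z; rewrite lee_fin mulr_ge0 ?powR_ge0 ?increment_kernel_ge0.
Qed.

Lemma seminorm_tonelli i s p delta u : measurable_fun [set: 'rV[R]_n] u ->
  seminorm i s p delta u =
  \int[lam]_h ((increment_kernel s p delta h)%:E *
    \int[mu]_x (`|increment i h u x| `^ p)%:E).
Proof.
move=> um; rewrite (seminormE _ _ _ _ um).
rewrite (fubini_tonelli2 _ (measurable_seminorm_integrand _ _ _ _ um))/=; last first.
  by move=> z; rewrite lee_fin mulr_ge0 ?powR_ge0 ?increment_kernel_ge0.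
apply: eq_integral => h _; rewrite /fubini_G/=.
rewrite -ge0_integralZl//=.
- by apply: eq_integral => x _; rewrite -EFinM mulrC.
- exact: (measurableT_comp (measurable_powR_increment i p um) (pair2_measurable h)).
- by rewrite lee_fin increment_kernel_ge0.
Qed.

Lemma measurable_increment_slice i h u : measurable_fun [set: 'rV[R]_n] u ->
  measurable_fun [set: 'rV[R]_n] (increment i h u).
Proof.
move=> um.
exact: (measurableT_comp (measurable_increment i um) (pair2_measurable h)).
Qed.

(** Uniform in h by translation invariance. It serves for |h| > delta, beyond the truncation of the
    seminorm. *)
Lemma integral_increment_le i p h w : (0 < p)%R ->
  measurable_fun [set: 'rV[R]_n] w ->
  \int[mu]_x (`|increment i h w x| `^ p)%:E <=
  (2 `^ (p + 1))%:E * \int[mu]_x (`|w x| `^ p)%:E.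
Proof.
move=> p0 mw.
have mwp : measurable_fun [set: 'rV[R]_n] (fun x => (`|w x| `^ p)%:E).
  by apply/measurable_EFinP; exact: measurable_powR_norm.
have wp0 x : 0 <= (`|w x| `^ p)%:E by rewrite lee_fin powR_ge0.
pose y : 'rV[R]_n := (h *: delta_mx ord0 i)%R.
have mwy : measurable_fun [set: 'rV[R]_n] (fun x => (`|w (x + y)%R| `^ p)%:E).
  apply: (measurableT_comp mwp); apply: measurable_rVD => //; exact: measurable_cst.
apply: (@le_trans _ _ (\int[mu]_x ((2 `^ p)%:E *
    ((`|w (x + y)%R| `^ p)%:E + (`|w x| `^ p)%:E)))).
  apply: ge0_le_integral => //.
  - by apply/measurable_EFinP/measurable_powR_norm; exact: measurable_increment_slice.
  - by apply: measurable_funeM; exact: emeasurable_funD.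
  - move=> x _; rewrite -EFinD -EFinM lee_fin /increment -/y.
    by rewrite -(normrN (w x)) powR_normD_le.
rewrite ge0_integralZl//; last 2 first.
- exact: emeasurable_funD.
- by move=> x _; rewrite adde_ge0.
rewrite ge0_integralD//.
rewrite (ge0_integral_translate y mwp wp0).
set W := \int[mu]_x _.
have W0 : 0 <= W by exact: integral_ge0.
rewrite powRD ?powRr1 ?pnatr_eq0 ?implybT// EFinM -muleA.
by rewrite lee_wpmul2l ?lee_fin ?powR_ge0// mule_natl mule2n.
Qed.

Lemma measurable_integral_increment i p u : measurable_fun [set: 'rV[R]_n] u ->
  measurable_fun [set: measurableTypeR R]
    (fun h : measurableTypeR R => \int[mu]_x (`|increment i h u x| `^ p)%:E).
Proof.
move=> um.
apply: (@measurable_fun_fubini_tonelli_G _ _ _ _ _ (leb R n)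
  (fun z : 'rV[R]_n * measurableTypeR R => (`|increment i z.2 u z.1| `^ p)%:E)).
  exact: measurable_powR_increment.
by move=> z; rewrite lee_fin powR_ge0.
Qed.

(* Adding the L^p term makes up for the truncation of the seminorm at delta. *)
Lemma integral_increment_average i s p delta rho w :
  (0 < s)%R -> (0 < p)%R -> (0 < delta)%R -> (0 < rho)%R ->
  measurable_fun [set: 'rV[R]_n] w ->
  ((2 * rho)^-1)%:E * \int[lam]_(h in `[(- rho)%R, rho]%classic)
      \int[mu]_x (`|increment i h w x| `^ p)%:E <=
  (rho `^ (s * p))%:E * (seminorm i s p delta w +
    (delta `^ (- (s * p)) * 2 `^ (p + 1))%:E * \int[mu]_x (`|w x| `^ p)%:E).
Proof.
move=> s0 p0 d0 r0 wm.
have sp0 : (0 < s * p)%R by exact: mulr_gt0.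
pose G h := \int[mu]_x (`|increment i h w x| `^ p)%:E.
have G0 h : 0 <= G h by apply: integral_ge0 => x _; rewrite lee_fin powR_ge0.
have mG : measurable_fun [set: measurableTypeR R] G.
  exact: measurable_integral_increment.
have G00 : G 0%R = 0.
  apply: integral0_eq => x _; rewrite /increment scale0r addr0 subrr normr0.
  by rewrite powR0// gt_eqF.
set W := \int[mu]_x (`|w x| `^ p)%:E.
have W0 : 0 <= W by apply: integral_ge0 => x _; rewrite lee_fin powR_ge0.
have GW h : G h <= (2 `^ (p + 1))%:E * W by exact: integral_increment_le.
have SG : seminorm i s p delta w =
    \int[lam]_h ((increment_kernel s p delta h)%:E * G h).
  exact: seminorm_tonelli.
have S0 : 0 <= seminorm i s p delta w.
  by apply: integral_ge0 => x _; apply: integral_ge0 => h _;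
     rewrite lee_fin divr_ge0 ?powR_ge0.
rewrite -/(G _); under eq_integral do rewrite -/(G _).
clearbody G W.
set c := (delta `^ _ * _)%R.
have c0 : (0 <= c)%R by rewrite mulr_ge0 ?powR_ge0.
pose I := `[(- rho)%R, rho]%classic : set (measurableTypeR R).
have mI : measurable I by exact: measurable_itv.
pose k := increment_kernel s p delta.
have mk : measurable_fun [set: measurableTypeR R] (fun h => (k h)%:E * G h).
  apply: emeasurable_funM => //.
  by apply/measurable_EFinP; exact: measurable_increment_kernel.
have k0 h : (0 <= k h)%R by exact: increment_kernel_ge0.
have kE h : (`|h| <= delta)%R -> k h = (`|h| `^ (1 + s * p))^-1%R.
  exact: increment_kernelE.
rewrite -/k in SG.
clearbody k.
have kG0 h : 0 <= (k h)%:E * G h by rewrite mule_ge0// lee_fin.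
(* If |h| <= delta, the kernel is |h|^-(1 + s p) >= rho^-(1 + s p) for h != 0. Otherwise delta <
   rho, and the uniform bound by the L^p integral may be multiplied by (rho / delta)^(s p) >= 1. *)
have key h : I h -> G h <=
    (rho `^ (1 + s * p))%:E * ((k h)%:E * G h) + (rho `^ (s * p) * c)%:E * W.
  rewrite /I/= in_itv/= -ler_norml => hr.
  have [hd|hd] := leP `|h|%R delta.
    apply: (@le_trans _ _ ((rho `^ (1 + s * p))%:E * ((k h)%:E * G h))); last first.
      by rewrite leeDl// mule_ge0// lee_fin mulr_ge0// powR_ge0.
    (* At h = 0 the kernel takes the value 0^-1 = 0 and has no lower bound, but G vanishes too. *)
    have [->|h0] := eqVneq h 0%R; first by rewrite G00 !mule0.
    rewrite muleA -EFinM -[leLHS]mul1e lee_wpmul2r// lee_fin.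
    rewrite kE// ler_pdivlMr ?powR_gt0 ?normr_gt0// mul1r.
    by rewrite ge0_ler_powR ?nnegrE ?(ltW r0)// ltW// addr_gt0.
  apply: (@le_trans _ _ ((rho `^ (s * p) * c)%:E * W)); last first.
    by rewrite leeDr// mule_ge0// lee_fin powR_ge0.
  apply: (le_trans (GW h)).
  rewrite lee_wpmul2r// lee_fin /c mulrA ler_peMl ?powR_ge0//.
  rewrite powRN ler_pdivlMr ?powR_gt0// mul1r.
  rewrite ge0_ler_powR ?nnegrE ?(ltW r0) ?(ltW d0) ?(ltW sp0)//.
  by rewrite (le_trans (ltW hd)).
have IG : \int[lam]_(h in I) G h <= (rho `^ (1 + s * p))%:E * seminorm i s p delta w
    + (rho `^ (s * p) * c * (2 * rho))%:E * W.
  apply: (@le_trans _ _ (\int[lam]_(h in I) ((rho `^ (1 + s * p))%:E *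
      ((k h)%:E * G h) + (rho `^ (s * p) * c)%:E * W))).
    apply: ge0_le_integral => //.
    - exact: measurable_funTS.
    - apply: measurable_funTS; apply: emeasurable_funD => //.
      exact: measurable_funeM.
  rewrite ge0_integralD//; last 3 first.
  - by move=> h _; rewrite mule_ge0// lee_fin powR_ge0.
  - by apply: measurable_funTS; exact: measurable_funeM.
  - by move=> h _; rewrite mule_ge0// lee_fin mulr_ge0 ?powR_ge0.
  apply: leeD.
    rewrite ge0_integralZl//; last 2 first.
    - exact: measurable_funTS.
    - by rewrite lee_fin powR_ge0.
    rewrite lee_wpmul2l ?lee_fin ?powR_ge0// SG.
    exact: ge0_subset_integral.
  rewrite integral_cst//.
  rewrite [X in _ * X <= _](_ : _ = (2 * rho)%:E); last exact: lebesgue_itv_sym (ltW r0).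
  by rewrite muleAC -EFinM.
apply: (@le_trans _ _ (((2 * rho)^-1)%:E *
  ((rho `^ (1 + s * p))%:E * seminorm i s p delta w
    + (rho `^ (s * p) * c * (2 * rho))%:E * W))).
  by rewrite lee_wpmul2l// lee_fin invr_ge0 mulr_ge0// ltW.
move: S0 => {IG SG}; set S := seminorm _ _ _ _ _ => S0; clearbody S.
rewrite !ge0_muleDr//; last 3 first.
- by rewrite mule_ge0// lee_fin.
- by rewrite mule_ge0// lee_fin powR_ge0.
- by rewrite mule_ge0// lee_fin mulr_ge0 ?mulr_ge0 ?powR_ge0// ltW.
rewrite !muleA -!EFinM; apply: leeD.
  rewrite lee_wpmul2r// lee_fin powRD; last by rewrite (gt_eqF r0) implybT.
  rewrite powRr1 ?(ltW r0)// mulrA ler_piMl ?powR_ge0//.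
  by rewrite invfM -mulrA mulVf ?gt_eqF// mulr1 invf_le1// ler1n.
rewrite (_ : ((2 * rho)^-1 * _)%R = (rho `^ (s * p) * c)%R)//.
by field; rewrite gt_eqF.
Qed.

(** The vertices of the path from 0 to h that runs parallel to the axes, one coordinate at a
    time. *)
Definition row_prefix (k : nat) (h : 'rV[R]_n) : 'rV[R]_n :=
  (\row_(j < n) if (j < k)%N then h ord0 j else 0)%R.

Lemma row_prefix0 h : row_prefix 0 h = 0%R.
Proof. by apply/rowP => j; rewrite !mxE. Qed.

Lemma row_prefix_full h : row_prefix n h = h.
Proof. by apply/rowP => j; rewrite !mxE ltn_ord. Qed.

Lemma row_prefixS (i : 'I_n) h :
  row_prefix i.+1 h = (row_prefix i h + h ord0 i *: delta_mx ord0 i)%R.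
Proof.
apply/rowP => j; rewrite !mxE eqxx/= ltnS leq_eqVlt.
have [->|ji] := eqVneq j i; first by rewrite eqxx ltnn/= mulr1 add0r.
by rewrite (_ : (j == i :> nat) = false) ?mulr0 ?addr0//; apply/negbTE.
Qed.

Lemma increment_telescope w x h :
  (w (x + h) - w x = \sum_(i < n) increment i (h ord0 i) w (x + row_prefix i h))%R.
Proof.
transitivity (\sum_(i < n) (w (x + row_prefix i.+1 h) - w (x + row_prefix i h)))%R.
  rewrite -(big_mkord xpredT (fun k => w (x + row_prefix k.+1 h) - w (x + row_prefix k h)))%R.
  by rewrite telescope_sumr// row_prefix_full row_prefix0 addr0.
by apply: eq_bigr => i _; rewrite /increment row_prefixS addrA.
Qed.

(** If x lies in A' and x + h outside A, then w falls by at least tau along the path, hence changes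
    by at least tau / n in one of the n steps; the term of that step is at least 1. *)
Lemma level_gap_le (A A' : set 'rV[R]_n) w (tau : R) (p : 'I_n -> R) x h :
  (0 < n)%N -> (0 < tau)%R -> (forall i, 0 < p i)%R ->
  (forall x, ~ A x -> w x = 0)%R -> (forall x, A' x -> tau <= w x)%R ->
  (\1_A' x * \1_(~` A) (x + h) <= \sum_(i < n) (n%:R / tau) `^ p i *
    `|increment i (h ord0 i) w (x + row_prefix i h)| `^ p i)%R.
Proof.
move=> n0 t0 p0 wA wA'; rewrite !indicE.
have S0 : (0 <= \sum_(i < n) (n%:R / tau) `^ p i *
    `|increment i (h ord0 i) w (x + row_prefix i h)| `^ p i)%R.
  by apply: sumr_ge0 => i _; rewrite mulr_ge0 ?powR_ge0.
have [xA'|] := boolP (x \in A'); last by rewrite mul0r.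
have [xA|] := boolP (_ \in _); last by rewrite mulr0.
rewrite mul1r.
have h1 : (tau <= \sum_(i < n) `|increment i (h ord0 i) w (x + row_prefix i h)|)%R.
  apply: le_trans (ler_norm_sum _ _ _).
  rewrite -increment_telescope wA ?sub0r ?normrN; last by move: xA; rewrite inE.
  by rewrite (le_trans _ (ler_norm _))// wA'//; move: xA'; rewrite inE.
have [i hi] : exists i, (tau / n%:R <= `|increment i (h ord0 i) w (x + row_prefix i h)|)%R.
  apply/not_existsP => H; move: h1; apply/negP; rewrite -ltNge.
  rewrite (_ : tau = \sum_(i < n) tau / n%:R)%R; last first.
    by rewrite sumr_const card_ord -[RHS]mulr_natr divfK// pnatr_eq0 -lt0n.
  apply: ltr_sum => [|i _]; last by rewrite ltNge; apply/negP; exact: H.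
  by apply/hasP; exists (Ordinal n0) => //; rewrite mem_index_enum.
rewrite (bigD1 i)//= ler_wpDr//.
  by apply: sumr_ge0 => j _; rewrite mulr_ge0 ?powR_ge0.
rewrite -powRM ?divr_ge0 ?(ltW t0)//.
apply: (@le_trans _ _ (1 `^ p i)%R); first by rewrite powR1.
have h2 : (1 <= n%:R / tau * `|increment i (h ord0 i) w (x + row_prefix i h)|)%R.
  by rewrite mulrAC ler_pdivlMr// mul1r mulrC -ler_pdivrMr ?ltr0n.
rewrite ge0_ler_powR ?nnegrE ?(ltW (p0 i))//.
exact: le_trans h2.
Qed.

(* Compare A' with its translates by the vectors of a box of twice the measure
   of A: for at least half of these h, a given point x of A' satisfies
   x + h \notin A. *)
Lemma level_set_le (A A' : set 'rV[R]_n) w (tau a : R) (rho p : 'I_n -> R) :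
  (0 < n)%N -> (0 < tau)%R -> (forall i, 0 < p i)%R -> (forall i, 0 < rho i)%R ->
  measurable A -> measurable A' -> measurable_fun [set: 'rV[R]_n] w ->
  (forall x, ~ A x -> w x = 0)%R -> (forall x, A' x -> tau <= w x)%R ->
  mu A <= a%:E -> (2 * a <= \prod_(i < n) (2 * rho i))%R ->
  mu A' <= \sum_(i < n) (2 * (n%:R / tau) `^ p i)%:E *
    (((2 * rho i)^-1)%:E * \int[lam]_(t in `[(- rho i)%R, rho i]%classic)
      \int[mu]_x (`|increment i t w x| `^ p i)%:E).
Proof.
move=> n0 t0 p0 r0 mA mA' wm wA wA' Aa aV.
set V := (\prod_(i < n) (2 * rho i))%R in aV.
have V0 : (0 < V)%R by apply: prodr_gt0 => i _; rewrite mulr_gt0.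
pose Q := box rho.
have mQ : measurable Q by exact: measurable_box.
have muQ : mu Q = V%:E by rewrite leb_box// => i; rewrite ltW.
pose G i t := \int[mu]_x (`|increment i t w x| `^ p i)%:E.
have mG i : measurable_fun [set: measurableTypeR R] (G i).
  exact: measurable_integral_increment.
have G0 i t : 0 <= G i t by apply: integral_ge0 => x _; rewrite lee_fin powR_ge0.
pose c i := ((n%:R / tau) `^ p i)%R.
have c0 i : (0 <= c i)%R by exact: powR_ge0.
have mcoordG i : measurable_fun [set: 'rV[R]_n] (fun h => (c i)%:E * G i (h ord0 i)).
  by apply: measurable_funeM; exact: (measurableT_comp (mG i) (measurable_coord i)).
pose Phi (z : 'rV[R]_n * 'rV[R]_n) : \bar R :=
  (\1_A' z.1 * \1_(~` A) (z.1 + z.2) * \1_Q z.2)%:E.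
have Phi0 z : 0 <= Phi z by rewrite lee_fin !mulr_ge0.
have mPhi : measurable_fun [set: 'rV[R]_n * 'rV[R]_n] Phi.
  apply/measurable_EFinP; apply: measurable_funM; first apply: measurable_funM.
  - exact: (measurableT_comp (@measurable_indic _ _ R setT _ mA') measurable_fst).
  - apply: (measurableT_comp (@measurable_indic _ _ R setT _ (measurableC mA))).
    by apply: measurable_rVD; [exact: measurable_fst|exact: measurable_snd].
  - exact: (measurableT_comp (@measurable_indic _ _ R setT _ mQ) measurable_snd).
have lower : (V / 2)%:E * mu A' <= \int[mu]_x \int[mu]_h Phi (x, h).
  rewrite -(setIT A') -integral_indic// -ge0_integralZl//; last 2 first.
  - by apply/measurable_EFinP; exact: measurable_indic.
  - by rewrite lee_fin divr_ge0// ltW.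
  apply: ge0_le_integral => //.
  - by move=> x _; rewrite mule_ge0// lee_fin divr_ge0// ltW.
  - by apply: measurable_funeM; apply/measurable_EFinP; exact: measurable_indic.
  - exact: (measurable_fun_fubini_tonelli_F _ mPhi Phi0).
  move=> x _; rewrite indicE; have [xA'|xA'] := boolP (x \in A'); last first.
    by rewrite mule0; exact: integral_ge0.
  rewrite mule1.
  have mT : measurable_fun [set: 'rV[R]_n] (fun h : 'rV[R]_n => h + x)%R.
    by apply: measurable_rVD => //; exact: measurable_cst.
  pose B := (fun h : 'rV[R]_n => h + x)%R @^-1` A.
  have mB : measurable B by rewrite /B -[X in measurable X]setTI; exact: mT.
  rewrite (_ : \int[mu]_h Phi (x, h) = mu (Q `\` B)); last first.
    rewrite -[in RHS](setIT (Q `\` B)) -integral_indic//; last exact: measurableD.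
    apply: eq_integral => h _; rewrite /Phi/=; congr EFin.
    rewrite !indicE xA' mul1r in_setD in_setC mulrC -natrM mulnb.
    by rewrite (_ : (h \in B) = (x + h \in A)%R)//; apply/idP/idP;
      rewrite !inE /B/= addrC.
  have : mu Q <= mu (Q `\` B) + mu B.
    rewrite (le_trans _ (measureU2 _ _ _))//; last exact: measurableD.
    apply: le_measure; rewrite ?inE//.
      by apply: measurableU => //; exact: measurableD.
    by move=> h Qh; have [Bh|Bh] := pselect (B h); [right|left].
  rewrite muQ leb_translate// => h1.
  have : V%:E <= mu (Q `\` B) + a%:E by rewrite (le_trans h1)// leeD2l.
  rewrite -leeBlDr// -EFinB; apply: le_trans; rewrite lee_fin; lra.
(* For fixed h, [level_gap_le] is integrated in x; translation invariance removes the vertices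
   [row_prefix i h], and what remains depends on one coordinate of h at a time. *)
have upper : \int[mu]_h \int[mu]_x Phi (x, h) <=
    \int[mu]_(h in Q) (\sum_(i < n) (c i)%:E * G i (h ord0 i)).
  rewrite [leRHS]integral_mkcond; apply: ge0_le_integral => //.
  - by move=> h _; exact: integral_ge0.
  - exact: (measurable_fun_fubini_tonelli_G _ mPhi Phi0).
  - apply/(measurable_restrictT _ mQ); apply: measurable_funTS.
    exact: emeasurable_sum.
  move=> h _; rewrite patchE; case: ifPn => hQ; last first.
    by rewrite integral0_eq// => x _; rewrite /Phi/= !indicE (negbTE hQ) mulr0.
  pose g i x := (c i * `|increment i (h ord0 i) w (x + row_prefix i h)| `^ p i)%R.
  have mg i : measurable_fun [set: 'rV[R]_n] (EFin \o g i).
    apply/measurable_EFinP; apply: measurable_funM => //; apply: measurable_powR_norm.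
    apply: (measurableT_comp (measurable_increment_slice i (h ord0 i) wm)).
    by apply: measurable_rVD => //; exact: measurable_cst.
  apply: (@le_trans _ _ (\int[mu]_x (\sum_(i < n) (g i x)%:E))).
    apply: ge0_le_integral => //.
    - exact: (measurableT_comp mPhi (pair2_measurable h)).
    - exact: emeasurable_sum.
    - move=> x _; rewrite /Phi/= [\1_Q h]indicE hQ mulr1 sumEFin lee_fin.
      exact: level_gap_le.
  rewrite ge0_integral_sum//; last first.
    by move=> i x _; rewrite lee_fin mulr_ge0 ?powR_ge0.
  apply: lee_sum => i _.
  rewrite /g; under eq_integral do rewrite EFinM.
  have mi : measurable_fun [set: 'rV[R]_n]
      (fun x => (`|increment i (h ord0 i) w x| `^ p i)%:E).
    by apply/measurable_EFinP/measurable_powR_norm; exact: measurable_increment_slice.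
  have i0 x : 0 <= (`|increment i (h ord0 i) w x| `^ p i)%:E by rewrite lee_fin powR_ge0.
  rewrite ge0_integralZl//; last 2 first.
  - apply: (measurableT_comp mi); apply: measurable_rVD => //; exact: measurable_cst.
  - by rewrite lee_fin.
  by rewrite (ge0_integral_translate (row_prefix i h) mi i0).
have : (V / 2)%:E * mu A' <= \sum_(i < n) (c i)%:E * ((V / (2 * rho i))%:E *
    \int[lam]_(t in `[(- rho i)%R, rho i]%classic) G i t).
  apply: (le_trans lower); rewrite (fubini_tonelli _ mPhi Phi0).
  apply: (le_trans upper); rewrite ge0_integral_sum//; last 2 first.
  - by move=> i; exact: measurable_funTS.
  - by move=> i h _; rewrite mule_ge0// lee_fin.
  apply: lee_sum => i _; rewrite ge0_integralZl//; last 2 first.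
  - by apply: measurable_funTS; exact: (measurableT_comp (mG i) (measurable_coord i)).
  - by rewrite lee_fin.
  by rewrite integral_box_coord.
have V20 : 0 <= (2 / V)%:E by rewrite lee_fin divr_ge0// ltW.
move=> /(lee_wpmul2l V20); rewrite muleA -EFinM (_ : 2 / V * (V / 2) = 1)%R; last first.
  by field; rewrite gt_eqF.
rewrite mul1e => /le_trans; apply; rewrite ge0_sume_distrr; last first.
  move=> i _; rewrite mule_ge0 ?lee_fin// mule_ge0//; last exact: integral_ge0.
  by rewrite lee_fin divr_ge0 ?mulr_ge0// ltW.
apply: lee_sum => i _; rewrite !muleA -!EFinM le_eqVlt; apply/orP; left; apply/eqP.
congr (_%:E * _); rewrite /c; field.
by rewrite !gt_eqF//.
Qed.

End increments.

(** * The critical embedding *)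

Section truncation.
Context {R : realType}.
Implicit Types a b t p : R.

(** Nondecreasing and 1-Lipschitz in t, and so are sums of consecutive slices, which telescope. *)
Definition dyadic_slice (k : nat) t : R :=
  Num.min t (2 ^+ k.+1) - Num.min t (2 ^+ k).

Lemma min_sub_bounds t1 t2 a b : t1 <= t2 -> a <= b ->
  0 <= (Num.min b t2 - Num.min b t1) - (Num.min a t2 - Num.min a t1) <= b - a.
Proof.
move=> t12 ab; have [at1|/ltW ta] := leP a t1; last first.
  rewrite (min_r (le_trans ta ab)).
  by have [bt|bt] := leP b t2; have [at2|at2] := leP a t2; apply/andP; split; lra.
rewrite (min_l (le_trans at1 t12)) subrr subr0.
by have [bt|bt] := leP b t2; have [bt1|bt1] := leP b t1; apply/andP; split; lra.
Qed.

Lemma sum_dyadic_slice K t :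
  \sum_(k < K) dyadic_slice k t = Num.min t (2 ^+ K) - Num.min t 1.
Proof.
rewrite -(big_mkord xpredT (fun k => dyadic_slice k t)) telescope_sumr//.
Qed.

Lemma exprn_2_le (k l : nat) : (k <= l)%N -> (2 ^+ k : R) <= 2 ^+ l.
Proof. by move=> kl; rewrite ler_eXn2l// ltr1n. Qed.

(** For b <= a the slice differences d_k satisfy 0 <= d_k <= a - b and have sum at most a - b, while
    d_k^p <= d_k (a - b)^(p - 1). *)
Lemma sum_powR_dyadic_slice K p a b : 1 <= p ->
  \sum_(k < K) `|dyadic_slice k a - dyadic_slice k b| `^ p <= `|a - b| `^ p.
Proof.
move=> p1; wlog ab : a b / b <= a.
  move=> wl; have [/wl//|/ltW/wl] := leP b a.
  by rewrite distrC; under eq_bigr do rewrite distrC.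
have d0 : 0 <= a - b by rewrite subr_ge0.
have T k : 0 <= dyadic_slice k a - dyadic_slice k b <= a - b.
  by apply: min_sub_bounds => //; exact: exprn_2_le.
rewrite (ger0_norm d0).
apply: (@le_trans _ _ (\sum_(k < K)
    (dyadic_slice k a - dyadic_slice k b) * (a - b) `^ (p - 1))).
  apply: ler_sum => k _; have /andP[T0 T1] := T k.
  rewrite ger0_norm// -(mulr_powRB1 T0) ?(lt_le_trans _ p1)// ler_wpM2l//.
  by rewrite ge0_ler_powR ?nnegrE// subr_ge0.
rewrite -mulr_suml -[leRHS](mulr_powRB1 d0) ?(lt_le_trans _ p1)//.
rewrite ler_wpM2r ?powR_ge0//.
rewrite sumrB !sum_dyadic_slice.
have [] := andP (@min_sub_bounds 1 (2 ^+ K) b a _ ab) => //.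
by rewrite -(expr0 2) exprn_2_le.
Qed.

Lemma dyadic_slice0 k : dyadic_slice k (0 : R) = 0.
Proof. by rewrite /dyadic_slice !min_l ?subrr// exprn_ge0. Qed.

Lemma dyadic_slice_low k t : t < 2 ^+ k -> dyadic_slice k t = 0.
Proof.
move=> tk; rewrite /dyadic_slice !min_l ?subrr// ?ltW//.
by rewrite (lt_le_trans tk)// exprn_2_le.
Qed.

Lemma dyadic_slice_high k t : 2 ^+ k.+1 <= t -> dyadic_slice k t = 2 ^+ k.
Proof.
move=> tk; rewrite /dyadic_slice !min_r//.
  by rewrite exprS; ring.
by rewrite (le_trans _ tk)// exprn_2_le.
Qed.

Lemma measurable_dyadic_slice d (T : measurableType d) k (f : T -> R) :
  measurable_fun [set: T] f -> measurable_fun [set: T] (fun x => dyadic_slice k (f x)).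
Proof.
move=> mf; apply: measurable_funB; apply: measurable_minr => //; exact: measurable_cst.
Qed.

End truncation.

(* With B the partial sum of the b_k, bounding each b_k^r by B^r gives
   B <= b0 + C m B^r, which bounds B because r < 1. *)
Lemma sublinear_recursion_bound (R : realType) (r c C b0 m : R) :
  0 < r -> r < 1 -> 0 <= C -> 0 <= m -> 0 <= b0 ->
  forall b mm : nat -> R, (forall k, 0 <= b k) -> (forall k, 0 <= mm k) ->
  b 0%N <= b0 -> (forall K, \sum_(k < K) mm k <= m) ->
  (forall k, b k.+1 <= C * b k `^ r * mm k) ->
  forall K, \sum_(k < K) b k <= 2 * b0 + (2 * C * m) `^ (1 - r)^-1.
Proof.
move=> r0 r1 C0 m0 b00 b mm bge0 mm0 bb0 mmm step K.
set B := \sum_(k < K) b k.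
have B0 : 0 <= B by exact: sumr_ge0.
have le1 : B <= b0 + C * m * B `^ r.
  case: K @B B0 => [|K] B B0.
    by rewrite /B big_ord0 addr_ge0// mulr_ge0 ?powR_ge0// mulr_ge0.
  rewrite {1}/B big_ord_recl lerD//.
  apply: (@le_trans _ _ (\sum_(k < K) C * B `^ r * mm k)).
    apply: ler_sum => k _; rewrite /= /bump/= add1n.
    apply: (le_trans (step k)); rewrite ler_wpM2r// ler_wpM2l//.
    rewrite ge0_ler_powR ?nnegrE ?(ltW r0)//.
    rewrite /B (bigD1 (widen_ord (leqnSn K) k))//= lerDl.
    exact: sumr_ge0.
  rewrite -mulr_sumr -mulrA -mulrA ler_wpM2l// mulrC ler_wpM2r ?powR_ge0//.
set X := (2 * C * m) `^ _.
have X0 : 0 <= X by exact: powR_ge0.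
(* Otherwise b0 < B / 2 is absorbed on the left, and dividing by B^r leaves B^(1 - r) <= 2 C m. *)
have [Bb|Bb] := leP B (2 * b0); first by rewrite (le_trans Bb)// lerDl.
have Bpos : 0 < B by rewrite (le_lt_trans _ Bb)// mulr_ge0.
have h : B <= 2 * C * m * B `^ r by lra.
apply: (@le_trans _ _ X); last by rewrite lerDr mulr_ge0.
have r10 : 0 < 1 - r by rewrite subr_gt0.
rewrite /X (_ : B = (B `^ (1 - r)) `^ (1 - r)^-1); last first.
  by rewrite -powRrM mulfV ?gt_eqF// powRr1// ltW.
rewrite ge0_ler_powR ?nnegrE ?powR_ge0 ?mulr_ge0// ?invr_ge0 ?(ltW r10)//.
rewrite powRB; last by rewrite (gt_eqF Bpos) implybT.
by rewrite powRr1 ?(ltW Bpos)// ler_pdivrMr// powR_gt0.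
Qed.

Section sobolev_embedding.
Context {R : realType}.
Variables (n : nat) (s p delta : 'I_n -> R) (q : R).
Hypothesis n0 : (0 < n)%N.
Hypothesis s0 : forall i, 0 < s i.
Hypothesis p1 : forall i, 1 < p i.
Hypothesis d0 : forall i, 0 < delta i.
Let sg := \sum_(i < n) (s i * p i)^-1.
Hypothesis sg1 : 1 < sg.
Hypothesis q0 : 0 < q.
Hypothesis qE : \sum_(i < n) (s i)^-1 = q * (sg - 1).
Local Notation lam := (@lebesgue_measure R).
Local Notation mu := (leb R n).
Implicit Types (u w : 'rV[R]_n -> R).

Let p0 i : 0 < p i. Proof. by rewrite (lt_trans _ (p1 i)). Qed.

(** What remains of the bound in [level_set_le], combined with [integral_increment_average], once
    the powers of tau and rho are taken out. It is a sum of p_i-th powers rather than a norm; such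
    powers can be summed over slices. *)
Definition full_norm w : \bar R :=
  (\sum_(i < n) (2 * n%:R `^ p i)%:E * (seminorm i (s i) (p i) (delta i) w +
    (delta i `^ (- (s i * p i)) * 2 `^ (p i + 1))%:E *
      \int[mu]_x (`|w x| `^ p i)%:E))%E.

Lemma seminorm_ge0 (i : 'I_n) s' p' d' w : (0 <= seminorm i s' p' d' w)%E.
Proof.
by apply: integral_ge0 => x _; apply: integral_ge0 => h _; rewrite lee_fin divr_ge0 ?powR_ge0.
Qed.

Lemma full_norm_ge0 w : (0 <= full_norm w)%E.
Proof.
apply: sume_ge0 => i _; rewrite mule_ge0 ?lee_fin ?mulr_ge0 ?powR_ge0//.
rewrite adde_ge0 ?seminorm_ge0// mule_ge0//.
  by rewrite lee_fin mulr_ge0 ?powR_ge0.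
by apply: integral_ge0 => x _; rewrite lee_fin powR_ge0.
Qed.

(* The half-sides rho_i of the box are chosen so that all the terms of
   level_set_le are of the same order. *)
Lemma level_set_step (A A' : set 'rV[R]_n) w (tau a : R) :
  0 < tau -> 0 <= a -> measurable A -> measurable A' ->
  measurable_fun [set: 'rV[R]_n] w ->
  (forall x, ~ A x -> w x = 0) -> (forall x, A' x -> tau <= w x) ->
  mu A = a%:E ->
  (mu A' <= (tau `^ (- q) * (tau `^ q * a) `^ sg^-1)%:E * full_norm w)%E.
Proof.
move=> t0 a0 mA mA' wm wA wA' Aa.
have A'A : A' `<=` A.
  move=> x /wA' tw; apply: contrapT => /wA wx0; move: tw; rewrite wx0 leNgt.
  by rewrite t0.
have c0 : 0 <= tau `^ (- q) * (tau `^ q * a) `^ sg^-1 by rewrite mulr_ge0 ?powR_ge0.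
(* For a = 0 no sides can be chosen, but A' is then a null set as a subset of A. *)
move: a0; rewrite le_eqVlt => /predU1P[a0|a0].
  rewrite (@le_trans _ _ (mu A))//; first by apply: le_measure; rewrite ?inE.
  rewrite Aa -a0; apply: mule_ge0; last exact: full_norm_ge0.
  by rewrite lee_fin mulr_ge0 ?powR_ge0.
set b := tau `^ q * a.
have b0 : 0 < b by rewrite mulr_gt0// powR_gt0.
have sg0 : 0 < sg by rewrite (lt_trans _ sg1).
have sp0 i : 0 < s i * p i by rewrite mulr_gt0.
pose rho i := (tau `^ (p i - q) * b `^ sg^-1) `^ (s i * p i)^-1.
have rho0 i : 0 < rho i by rewrite powR_gt0// mulr_gt0// powR_gt0.
(* With tau^(- p_i) rho_i^(s_i p_i) = tau^(- q) b^(1/sg) for every i, the product of the rho_i is a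
   times a power of tau, whose exponent vanishes exactly by [qE]. This is where the critical
   exponent comes from. *)
have prodrho : \prod_(i < n) rho i = a.
  transitivity (expR (\sum_(i < n) ((p i - q) * ln tau + sg^-1 * ln b) * (s i * p i)^-1)).
    rewrite expR_sum; apply: eq_bigr => i _; rewrite /rho /powR.
    rewrite gt_eqF; last by rewrite mulr_gt0//; rewrite -/(powR _ _) powR_gt0.
    rewrite (gt_eqF t0) (gt_eqF b0) lnM ?posrE ?expR_gt0// !expRK.
    by congr expR; rewrite mulrC.
  have -> : \sum_(i < n) ((p i - q) * ln tau + sg^-1 * ln b) * (s i * p i)^-1 =
      ln tau * (\sum_(i < n) (s i)^-1) + (sg^-1 * ln b - q * ln tau) * sg.
    rewrite /sg !mulr_sumr -big_split/=; apply: eq_bigr => i _.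
    by field; rewrite !gt_eqF.
  rewrite qE mulrBl mulrAC mulVf ?gt_eqF// mul1r.
  rewrite /b lnM ?posrE ?powR_gt0// ln_powR.
  have -> : ln tau * (q * (sg - 1)) + (q * ln tau + ln a - q * ln tau * sg) = ln a.
    by ring.
  by rewrite lnK.
have := @level_set_le R n A A' w tau a rho p n0 t0 p0 rho0 mA mA' wm wA wA'.
rewrite Aa lexx => /(_ isT).
have -> : \prod_(i < n) (2 * rho i) = 2 ^+ n * a.
  by rewrite big_split/= prodrho prodr_const card_ord.
have h2 : 2 * a <= 2 ^+ n * a.
  by rewrite ler_wpM2r// ?(ltW a0)// -{1}(expr1 2) exprn_2_le.
move=> /(_ h2) /le_trans; apply.
rewrite /full_norm ge0_sume_distrr; last first.
  move=> i _; rewrite mule_ge0 ?lee_fin ?mulr_ge0 ?powR_ge0//.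
  rewrite adde_ge0 ?seminorm_ge0// mule_ge0//.
    by rewrite lee_fin mulr_ge0 ?powR_ge0.
  by apply: integral_ge0 => x _; rewrite lee_fin powR_ge0.
apply: lee_sum => i _.
have := @integral_increment_average R n i (s i) (p i) (delta i) (rho i) w
  (s0 i) (p0 i) (d0 i) (rho0 i) wm.
set L := (_ * _)%E; set M := (_ + _)%E => LM.
have c1 : (0 <= (2 * (n%:R / tau) `^ p i)%:E)%E by rewrite lee_fin mulr_ge0 ?powR_ge0.
apply: (le_trans (lee_wpmul2l c1 LM)).
rewrite !muleA -!EFinM.
rewrite (_ : (2 * (n%:R / tau) `^ p i * rho i `^ (s i * p i))%R =
   (tau `^ (- q) * b `^ sg^-1 * (2 * n%:R `^ p i))%R)//.
rewrite /rho -powRrM mulVf ?gt_eqF// powRr1 ?mulr_ge0 ?powR_ge0//.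
rewrite powRM ?invr_ge0 ?(ltW t0)// powRB; last by rewrite (gt_eqF t0) implybT.
rewrite powRN -(powR_inv1 (ltW t0)) -powRrM mulN1r powRN.
by field; rewrite !gt_eqF ?powR_gt0.
Qed.

Lemma measurable_ge_set (f : 'rV[R]_n -> R) c : measurable_fun [set: 'rV[R]_n] f ->
  measurable [set x | c <= f x].
Proof.
move=> mf; rewrite (_ : [set x | _] = f @^-1` `[c, +oo[%classic).
  by rewrite -[X in measurable X]setTI; apply: mf => //; exact: measurable_itv.
by apply/seteqP; split => x /=; rewrite in_itv/= andbT.
Qed.

Lemma sum_powR_increment_slice K i h u x :
  \sum_(k < K) `|increment i h (fun x => dyadic_slice k `|u x|) x| `^ p i <=
  `|increment i h u x| `^ p i.
Proof.
apply: (le_trans (sum_powR_dyadic_slice K _ _ (ltW (p1 i)))).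
by rewrite ge0_ler_powR ?nnegrE ?(ltW (p0 i))// ler_dist_dist.
Qed.

Lemma sum_powR_slice K i u x :
  \sum_(k < K) `|dyadic_slice k `|u x| | `^ p i <= `|u x| `^ p i.
Proof.
have := sum_powR_dyadic_slice K `|u x| 0 (ltW (p1 i)).
by under eq_bigr do rewrite dyadic_slice0 subr0; rewrite subr0 normr_id.
Qed.

Local Open Scope ereal_scope.

Lemma measurable_slice k u : measurable_fun [set: 'rV[R]_n] u ->
  measurable_fun [set: 'rV[R]_n] (fun x => dyadic_slice k `|u x|%R).
Proof.
move=> um; apply: measurable_dyadic_slice.
exact: (measurableT_comp (@normr_measurable _ _) um).
Qed.

Lemma sum_seminorm_slice K i u : measurable_fun [set: 'rV[R]_n] u ->
  \sum_(k < K) seminorm i (s i) (p i) (delta i) (fun x => dyadic_slice k `|u x|%R) <=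
  seminorm i (s i) (p i) (delta i) u.
Proof.
move=> um.
under eq_bigr do rewrite (seminormE _ _ _ _ (measurable_slice _ um)).
rewrite -ge0_integral_sum//; last 2 first.
- by move=> k; apply: measurable_seminorm_integrand; exact: measurable_slice.
- by move=> k z _; rewrite lee_fin mulr_ge0 ?powR_ge0 ?increment_kernel_ge0.
rewrite seminormE//; apply: ge0_le_integral => //.
- by move=> z _; apply: sume_ge0 => k _; rewrite lee_fin mulr_ge0 ?powR_ge0 ?increment_kernel_ge0.
- apply: emeasurable_sum => k; apply: measurable_seminorm_integrand; exact: measurable_slice.
- exact: measurable_seminorm_integrand.
- move=> z _; rewrite sumEFin lee_fin -mulr_suml ler_wpM2r ?increment_kernel_ge0//.
  exact: sum_powR_increment_slice.
Qed.

Lemma sum_integral_slice K i u : measurable_fun [set: 'rV[R]_n] u ->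
  \sum_(k < K) \int[mu]_x (`|dyadic_slice k `|u x| | `^ p i)%:E <=
  \int[mu]_x (`|u x| `^ p i)%:E.
Proof.
move=> um.
have mk k : measurable_fun [set: 'rV[R]_n] (fun x => (`|dyadic_slice k `|u x| | `^ p i)%:E).
  by apply/measurable_EFinP/measurable_powR_norm; exact: measurable_slice.
rewrite -ge0_integral_sum//.
apply: ge0_le_integral => //.
- by move=> z _; apply: sume_ge0 => k _; rewrite lee_fin powR_ge0.
- exact: emeasurable_sum.
- by apply/measurable_EFinP; exact: measurable_powR_norm.
- by move=> z _; rewrite sumEFin lee_fin sum_powR_slice.
Qed.

Lemma sum_full_norm_slice K u : measurable_fun [set: 'rV[R]_n] u ->
  \sum_(k < K) full_norm (fun x => dyadic_slice k `|u x|%R) <= full_norm u.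
Proof.
move=> um; rewrite exchange_big/=; apply: lee_sum => i _.
have W0 w : 0 <= \int[mu]_x (`|w x| `^ p i)%:E.
  by apply: integral_ge0 => x _; rewrite lee_fin powR_ge0.
have c0 : 0 <= (delta i `^ (- (s i * p i)) * 2 `^ (p i + 1))%:E.
  by rewrite lee_fin mulr_ge0 ?powR_ge0.
rewrite -ge0_sume_distrr; last first.
  by move=> k _; rewrite adde_ge0 ?seminorm_ge0// mule_ge0.
rewrite lee_wpmul2l ?lee_fin ?mulr_ge0 ?powR_ge0// big_split/=.
apply: leeD; first exact: sum_seminorm_slice.
by rewrite -ge0_sume_distrr// lee_wpmul2l// sum_integral_slice.
Qed.

Lemma exists_dyadic_level (t : R) : (1 <= t)%R ->
  exists k, (2 ^+ k <= t)%R /\ (t < 2 ^+ k.+1)%R.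
Proof.
move=> t1.
have ex : exists k, (t < 2 ^+ k)%R.
  exists (Num.truncn t).+1; rewrite (lt_le_trans (truncnS_gt _))//.
  by rewrite -natrX ler_nat ltnW// ltn_expl.
have := ex_minnP ex; case=> -[|k] tk kmin.
  by move: tk; rewrite expr0 ltNge t1.
exists k; split => //; rewrite leNgt; apply/negP => /kmin; by rewrite ltnn.
Qed.

(** The k-th slice of |u| vanishes off [A k] and equals 2^k on [A k.+1], so [level_set_step] with
    tau = 2^k gives the recursion for b_k = 2^(k q) |A k|; the factor 2^q comes from the shift of k
    in b. The constant depends on u only through [m] and [a0]. *)
Lemma sobolev_bound (m a0 : R) : (0 <= m)%R -> (0 <= a0)%R -> exists C : R,
  forall u, measurable_fun [set: 'rV[R]_n] u -> full_norm u <= m%:E ->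
    mu [set x | (1 <= `|u x|)%R] <= a0%:E ->
    \int[mu]_(x in [set x | (1 <= `|u x|)%R]) (`|u x| `^ q)%:E <= C%:E.
Proof.
move=> m0 a00.
exists (2 `^ q * (2 * a0 + (2 * 2 `^ q * m) `^ (1 - sg^-1)^-1))%R => u um um0 ua0.
have sg0 : (0 < sg)%R by rewrite (lt_trans _ sg1).
pose A k := [set x | (2 ^+ k <= `|u x|)%R].
have mnu : measurable_fun [set: 'rV[R]_n] (fun x => `|u x|%R).
  exact: (measurableT_comp (@normr_measurable _ _) um).
have mA k : measurable (A k) by exact: measurable_ge_set.
have A0 : A 0%N = [set x | (1 <= `|u x|)%R] by [].
have muA k : mu (A k) <= a0%:E.
  apply: le_trans ua0; rewrite -A0; apply: le_measure; rewrite ?inE//.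
  by move=> x; rewrite /A/=; apply: le_trans; exact: exprn_2_le.
have fA k : mu (A k) \is a fin_num.
  by rewrite ge0_fin_numE// (le_lt_trans (muA k))// ltry.
pose a k := fine (mu (A k)).
have aE k : mu (A k) = (a k)%:E by rewrite fineK.
have a_ge0 k : (0 <= a k)%R by exact: fine_ge0.
pose w k x := dyadic_slice k `|u x|%R.
have wm k : measurable_fun [set: 'rV[R]_n] (w k) by exact: measurable_slice.
have wsum K : \sum_(k < K) full_norm (w k) <= m%:E.
  by rewrite (le_trans _ um0)// sum_full_norm_slice.
have wfin k : full_norm (w k) \is a fin_num.
  rewrite (ge0_fin_numE (full_norm_ge0 _)); apply: le_lt_trans (ltry m).
  apply: le_trans (wsum k.+1); rewrite big_ord_recr/=; apply: leeDr.
  by apply: sume_ge0 => j _; exact: full_norm_ge0.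
pose mm k := fine (full_norm (w k)).
have mmE k : full_norm (w k) = (mm k)%:E by rewrite fineK.
pose b k := ((2 ^+ k) `^ q * a k)%R.
have := @sublinear_recursion_bound R sg^-1 1 (2 `^ q) a0 m _ _ _ m0 a00 b mm.
rewrite invr_gt0 invf_lt1// => /(_ sg0 sg1 (powR_ge0 _ _)) bound.
have {}bound : forall K, (\sum_(k < K) b k <=
    2 * a0 + (2 * 2 `^ q * m) `^ (1 - sg^-1)^-1)%R.
  apply: bound.
  - by move=> k; rewrite mulr_ge0 ?powR_ge0.
  - by move=> k; apply: fine_ge0; exact: full_norm_ge0.
  - by rewrite /b expr0 powR1 mul1r -lee_fin -aE.
  - move=> K; rewrite -lee_fin -sumEFin; under eq_bigr do rewrite -mmE.
    exact: wsum.
  - move=> k.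
    have t0 : (0 < (2 : R) ^+ k)%R by rewrite exprn_gt0.
    have := @level_set_step (A k) (A k.+1) (w k) (2 ^+ k) (a k) t0 (a_ge0 k)
      (mA k) (mA k.+1) (wm k).
    rewrite mmE (aE k.+1) -EFinM lee_fin => h.
    have {h} : (a k.+1 <= (2 ^+ k) `^ (- q) * ((2 ^+ k) `^ q * a k) `^ sg^-1 * mm k)%R.
      apply: h => //.
      + by move=> x /negP; rewrite -ltNge => /dyadic_slice_low.
      + by move=> x /dyadic_slice_high; rewrite /w => ->.
    rewrite -/(b k) => h.
    have t1 : (0 < (2 ^+ k.+1 : R) `^ q)%R by rewrite powR_gt0// exprn_gt0.
    rewrite {1}/b; apply: (le_trans (ler_wpM2l (ltW t1) h)).
    rewrite exprS powRM ?(ltW t0)// powRN le_eqVlt; apply/orP; left; apply/eqP.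
    by field; rewrite gt_eqF// powR_gt0.
(* Where 2^k <= |u| < 2^(k+1), the k-th term alone dominates |u|^q; its integral is 2^q b_k. *)
pose g k x : \bar R := (((2 ^+ k.+1) `^ q)%:E * (\1_(A k) x)%:E).
have g0 k x : 0 <= g k x by rewrite mule_ge0 ?lee_fin ?powR_ge0.
have mg k : measurable_fun [set: 'rV[R]_n] (g k).
  apply: measurable_funeM; apply/measurable_EFinP.
  exact: (@measurable_indic _ _ R setT _ (mA k)).
apply: (@le_trans _ _ (\int[mu]_x \sum_(k <oo) g k x)).
  rewrite integral_mkcond; apply: ge0_le_integral => //.
  - by move=> x _; apply: erestrict_ge0 => y _; rewrite lee_fin powR_ge0.
  - apply/(measurable_restrictT _ _).1; first exact: (mA 0%N).
    by apply: measurable_funTS; apply/measurable_EFinP; exact: measurable_powR_norm.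
  - exact: ge0_emeasurable_sum.
  move=> x _; rewrite patchE; case: ifPn => [|_]; last exact: nneseries_ge0.
  rewrite inE/= => /exists_dyadic_level [k [k1 k2]].
  apply: (@le_trans _ _ (g k x)).
    rewrite /g indicE mem_set// mule1 lee_fin ge0_ler_powR ?nnegrE ?(ltW q0)//.
    exact: ltW.
  apply: le_trans (nneseries_lim_ge k.+1 _) => //.
  by rewrite big_nat_recr//= leeDr//; exact: sume_ge0.
rewrite integral_nneseries//.
apply: lime_le.
  by apply: is_cvg_nneseries => k _ _; exact: integral_ge0.
apply: nearW => K; rewrite big_mkord.
apply: (@le_trans _ _ (\sum_(k < K) (2 `^ q * b k)%:E)).
  apply: lee_sum => k _; rewrite /g ge0_integralZl//; last first.
    by apply/measurable_EFinP; exact: (@measurable_indic _ _ R setT _ (mA k)).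
  rewrite [X in _ * X](_ : _ = mu (A k)); last by rewrite integral_indic// setIT.
  rewrite aE -EFinM lee_fin /b exprS.
  by rewrite powRM ?exprn_ge0// mulrA.
by rewrite sumEFin lee_fin -mulr_sumr ler_wpM2l ?powR_ge0.
Qed.

End sobolev_embedding.

(** * Minimization of uniformly convex functionals *)

Section abstract_minimization.
Context {R : realType} {V : lmodType R}.
Variables (W : set V) (J L : V -> R).
Implicit Types u v w : V.

Hypothesis W0 : W 0.
Hypothesis WD : forall u v, W u -> W v -> W (u + v).
Hypothesis WZ : forall (t : R) u, W u -> W (t *: u).
Hypothesis J_ge0 : forall u, W u -> 0 <= J u.

(** Substitutes for homogeneity: [pm] governs contractions and [pM] dilations of the argument of
    J. *)
Variables pm pM : R.
Hypothesis pm1 : 1 < pm.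
Hypothesis Jcontract : forall t u, W u -> 0 < t -> t <= 1 -> J (t *: u) <= t `^ pm * J u.
Hypothesis Jexpand : forall t u, W u -> 1 <= t -> J (t *: u) <= t `^ pM * J u.
Hypothesis Jconvex : forall e, 0 < e -> exists2 C, 0 <= C & forall u v, W u -> W v ->
  J (u - v) <= e * (J u + J v) + C * (J u + J v - 2 * J (2^-1 *: (u + v))).
Hypothesis LD : forall u v, W u -> W v -> L (u + v) = L u + L v.
Hypothesis LZ : forall (t : R) u, W u -> L (t *: u) = t * L u.
Hypothesis Lbounded : exists C, forall u, W u -> J u <= 1 -> `|L u| <= C.

Variable eps : nat -> R.
Hypothesis eps0 : forall k, 0 < eps k.
Hypothesis eps_cvg0 : forall d, 0 < d -> exists K, forall k, (K <= k)%N -> eps k <= d.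
(** Completeness is asked only for the prescribed rate [eps], since the limit will be obtained
    almost everywhere from geometric decay. The last clause is lower semicontinuity of J along the
    sequence. *)
Hypothesis Jcomplete : forall un : nat -> V, (forall k, W (un k)) ->
  (forall k l, (k <= l)%N -> J (un k - un l) <= eps k) ->
  exists u, [/\ W u, forall k, J (un k - u) <= eps k &
    forall c K, (forall l, (K <= l)%N -> J (un l) <= c) -> J u <= c].

Let E u := J u - L u.

Let WB u v : W u -> W v -> W (u - v).
Proof. by move=> Wu Wv; apply: WD => //; rewrite -scaleN1r; exact: WZ. Qed.

Let LB u v : W u -> W v -> L (u - v) = L u - L v.
Proof.
move=> Wu Wv; rewrite -scaleN1r LD//; last exact: WZ.
by rewrite LZ// mulN1r.
Qed.

(** If J u > 1, scaling u by t = 1 / J u brings J to at most 1, because t^pm <= t. *)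
Let L_linear_growth : exists2 C, 0 < C & forall u, W u -> `|L u| <= C * (1 + J u).
Proof.
have [C CP] := Lbounded; exists (`|C| + 1); first by rewrite ltr_wpDl.
have CP' u : W u -> J u <= 1 -> `|L u| <= `|C| + 1.
  by move=> Wu /(CP u Wu) /le_trans; apply; rewrite ler_wpDr// ler_norm.
move=> u Wu; have Ju0 := J_ge0 Wu.
have C1 : 0 <= `|C| + 1 by rewrite addr_ge0.
have [J1|J1] := leP (J u) 1.
  by rewrite (le_trans (CP' _ Wu J1))// ler_peMr// lerDl.
have Ju : 0 < J u by rewrite (lt_trans _ J1).
have t0 : 0 < (J u)^-1 by rewrite invr_gt0.
have t1 : (J u)^-1 <= 1 by rewrite invf_le1// ltW.
have h : J ((J u)^-1 *: u) <= 1.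
  apply: (le_trans (Jcontract Wu t0 t1)).
  rewrite -(@mulVf _ (J u)) ?gt_eqF// ler_pM2r// ge1r_powR ?t0// ltW//.
have := CP' _ (WZ _ Wu) h; rewrite LZ// normrM gtr0_norm// ler_pdivrMl// => /le_trans.
by apply; rewrite mulrC ler_wpM2l// lerDr.
Qed.

(** Coercivity of J - L. Linear growth applied to t u gives |L u| <= C / t + C t^(pm - 1) J u, and
    pm > 1 allows a t that makes the last factor at most 1/2. *)
Let L_half : exists C, forall u, W u -> `|L u| <= C + J u / 2.
Proof.
have [C C0 CP] := L_linear_growth.
have pm10 : 0 < pm - 1 by rewrite subr_gt0.
pose t := (2 * (C + 1))^-1 `^ (pm - 1)^-1.
have C1 : 0 < 2 * (C + 1) by rewrite mulr_gt0// addr_gt0.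
have t0 : 0 < t by rewrite powR_gt0// invr_gt0.
have t1 : t <= 1.
  apply: (@le_trans _ _ (1 `^ (pm - 1)^-1)); last by rewrite powR1.
  rewrite ge0_ler_powR ?nnegrE ?invr_ge0 ?(ltW pm10) ?(ltW C1)//.
  rewrite invf_le1//; lra.
have tpm : C * t `^ pm <= t / 2.
  rewrite -(mulr_powRB1 (ltW t0)) ?(lt_trans _ pm1)// mulrCA ler_pM2l//.
  rewrite /t -powRrM mulVf ?gt_eqF// powRr1 ?invr_ge0 ?(ltW C1)//.
  rewrite ler_pdivrMr//; lra.
exists (C / t) => u Wu.
have := CP _ (WZ t Wu); rewrite LZ// normrM gtr0_norm// mulrC -ler_pdivlMr// => /le_trans.
apply; rewrite ler_pdivrMr// mulrDr mulr1 mulrDl divfK ?gt_eqF// lerD2l.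
apply: (@le_trans _ _ (C * (t `^ pm * J u))).
  by rewrite ler_pM2l// Jcontract.
by rewrite mulrA -[leRHS]mulrA (mulrC 2^-1) (mulrC (J u)) ler_wpM2r ?J_ge0.
Qed.

(** Continuity of L at 0 with respect to J: for d = T^(- pM) the dilate T u still has J at most 1,
    so |L u| <= 2 C / T. *)
Let L_small e : 0 < e -> exists2 d, 0 < d & forall u, W u -> J u <= d -> `|L u| <= e.
Proof.
move=> e0; have [C C0 CP] := L_linear_growth.
pose T := 1 + 2 * C / e.
have T1 : 1 <= T by rewrite /T lerDl divr_ge0 ?mulr_ge0// ltW.
have T0 : 0 < T by rewrite (lt_le_trans _ T1).
exists (T `^ pM)^-1; first by rewrite invr_gt0 powR_gt0.
move=> u Wu Ju; have := CP _ (WZ T Wu); rewrite LZ// normrM gtr0_norm//.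
have h : J (T *: u) <= 1.
  by rewrite (le_trans (Jexpand Wu T1))// mulrC -ler_pdivlMr ?powR_gt0// mul1r.
move=> /le_trans/(_ (_ : _ <= C * 2)) h2.
have {h2} : T * `|L u| <= C * 2 by apply: h2; rewrite ler_pM2l//; lra.
rewrite mulrC -ler_pdivlMr// => /le_trans; apply.
rewrite ler_pdivrMr//.
have -> : e * T = e + C * 2 by rewrite /T; field; rewrite gt_eqF.
by rewrite lerDr ltW.
Qed.

Let m := inf [set E u | u in W].

Let E_has_inf : has_inf [set E u | u in W].
Proof.
have [C CP] := L_half; split; first by exists (E 0); exists 0.
exists (- C) => _ [u Wu <-]; have := CP _ Wu.
rewrite ler_norml /E => /andP[_ h]; have := J_ge0 Wu; lra.
Qed.

Let m_le u : W u -> m <= E u.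
Proof. by move=> Wu; apply: ge_inf; [case: E_has_inf|exists u]. Qed.

(** J - L is at least m at the midpoint and L drops out by linearity, so the convexity defect is at
    most 2 eta. Coercivity bounds J by B on almost minimizers, so that each of the two terms of
    [Jconvex] contributes at most e / 2. *)
Let near_minimizers_close e : 0 < e ->
  exists2 eta, 0 < eta & forall u v, W u -> W v ->
    E u <= m + eta -> E v <= m + eta -> J (u - v) <= e.
Proof.
move=> e0; have [C0 C0P] := L_half.
pose B := 2 * (`|m| + 1 + `|C0|) + 1.
have B0 : 0 < B by rewrite /B ltr_wpDl// mulr_ge0// !addr_ge0.
have e'0 : 0 < e / (4 * B) by rewrite divr_gt0// mulr_gt0.
have [C C0' CP] := Jconvex e'0.
pose eta := Num.min 1 (e / (4 * (C + 1))).
have C1 : 0 < 4 * (C + 1) by rewrite mulr_gt0// ltr_wpDl.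
exists eta; first by rewrite lt_min ltr01 divr_gt0.
have JB u : W u -> E u <= m + eta -> J u <= B.
  move=> Wu; have := C0P _ Wu; rewrite ler_norml /E => /andP[_ h1] h2.
  have h3 : eta <= 1 by rewrite ge_min lexx.
  have := ler_norm m; have := ler_norm C0; rewrite /B; lra.
move=> u v Wu Wv Eu Ev; have Ju := JB _ Wu Eu; have Jv := JB _ Wv Ev.
apply: (le_trans (CP _ _ Wu Wv)).
have Wuv : W (2^-1 *: (u + v)) by apply: WZ; exact: WD.
have h : J u + J v - 2 * J (2^-1 *: (u + v)) <= 2 * eta.
  have := m_le Wuv; rewrite /E LZ ?LD//; last exact: WD.
  move: Eu Ev; rewrite /E; lra.
have etaC : C * (2 * eta) <= e / 2.
  have h3 : eta <= e / (4 * (C + 1)) by rewrite ge_min lexx orbT.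
  have h4 : eta * (4 * (C + 1)) <= e by rewrite -ler_pdivlMr.
  have : 0 <= eta by rewrite le_min ler01 divr_ge0// ltW.
  nra.
have : C * (J u + J v - 2 * J (2^-1 *: (u + v))) <= C * (2 * eta) by rewrite ler_wpM2l.
have : e / (4 * B) * (J u + J v) <= e / (4 * B) * (2 * B).
  by rewrite ler_pM2l//; lra.
have -> : e / (4 * B) * (2 * B) = e / 2 by field; rewrite gt_eqF.
lra.
Qed.

Lemma exists_minimizer : exists2 u, W u & forall v, W v -> J u - L u <= J v - L v.
Proof.
have near_close k : exists eta, 0 < eta /\ forall u v, W u -> W v ->
    E u <= m + eta -> E v <= m + eta -> J (u - v) <= eps k.
  by have [eta ? ?] := near_minimizers_close (eps0 k); exists eta.
pose eta k := sval (cid (near_close k)).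
have eta0 k : 0 < eta k by have [] := svalP (cid (near_close k)).
have etaP k u v : W u -> W v -> E u <= m + eta k -> E v <= m + eta k -> J (u - v) <= eps k.
  by have [_] := svalP (cid (near_close k)); exact.
(* A nonincreasing null sequence below [eta]: for k <= l both un k and un l are then minimizers up
   to eta k. *)
pose zeta := fix zeta k := if k is k'.+1 then
  Num.min (zeta k') (Num.min (eta k) k.+1%:R^-1) else eta 0%N.
have zeta0 k : 0 < zeta k.
  elim: k => [|k IH]; first exact: eta0.
  by rewrite /= lt_min IH/= lt_min eta0/= invr_gt0.
have zeta_eta k : zeta k <= eta k by case: k => [|k]//=; rewrite !ge_min lexx !orbT.
have zeta_decr k l : (k <= l)%N -> zeta l <= zeta k.
  elim: l => [|l IH]; first by rewrite leqn0 => /eqP ->.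
  rewrite leq_eqVlt => /predU1P[->//|]; rewrite ltnS => /IH h /=.
  by rewrite ge_min h.
have zeta_inv k : zeta k.+1 <= k.+2%:R^-1 by rewrite /= !ge_min lexx !orbT.
have ex k : exists u, W u /\ E u <= m + zeta k.
  by have [_ [u Wu <-] h] := inf_adherent (zeta0 k) E_has_inf; exists u; split; rewrite ?ltW.
pose un k := sval (cid (ex k)).
have Wun k : W (un k) by have [] := svalP (cid (ex k)).
have Eun k : E (un k) <= m + zeta k by have [] := svalP (cid (ex k)).
have [u [Wu uP uJ]] := Jcomplete Wun (fun k l kl => etaP k (un k) (un l) (Wun k) (Wun l)
   (le_trans (Eun k) (lerD (lexx m) (zeta_eta k)))
   (le_trans (Eun l) (lerD (lexx m) (le_trans (zeta_decr _ _ kl) (zeta_eta k))))).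
exists u => // v Wv; rewrite -!/(E _).
apply: (@le_trans _ _ m); last exact: m_le.
apply/ler_addgt0Pr => th th0.
(* One half pays for L (un l) - L u by [L_small], the other for zeta l with l large. *)
have th2 : 0 < th / 2 by rewrite divr_gt0.
have [d d0 dP] := L_small th2.
have [K KP] := eps_cvg0 d0.
pose N := Num.truncn (th / 2)^-1.
have Nth : N.+1%:R^-1 <= th / 2.
  by rewrite invf_ple ?posrE// ltW// truncnS_gt.
suff : J u <= m + th / 2 + L u + th / 2 by rewrite /E; lra.
apply: (uJ _ (maxn K N.+1)) => l; rewrite geq_max => /andP[Kl Nl].
have := dP _ (WB (Wun l) Wu) (le_trans (uP l) (KP l Kl)).
rewrite LB// ler_norml => /andP[_ h1].
have zl : zeta l <= th / 2.
  apply: (le_trans (zeta_decr _ _ Nl)); apply: (le_trans (zeta_inv N)).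
  by apply: le_trans Nth; rewrite lef_pV2 ?posrE// ler_nat.
have := Eun l; rewrite /E; lra.
Qed.

(** The convexity defect of two minimizers is at most 0, which leaves an arbitrarily small multiple
    of J u + J v. The conclusion concerns J and not u = v, because solutions are determined only
    almost everywhere. *)
Lemma minimizer_unique u v : W u -> W v ->
  (forall w, W w -> J u - L u <= J w - L w) ->
  (forall w, W w -> J v - L v <= J w - L w) -> J (u - v) <= 0.
Proof.
move=> Wu Wv umin vmin; apply/ler_addgt0Pl => e e0; rewrite addr0.
have B0 : 0 < J u + J v + 1 by rewrite ltr_wpDl// addr_ge0// J_ge0.
have [C C0 CP] := Jconvex (divr_gt0 e0 B0).
apply: (le_trans (CP _ _ Wu Wv)).
have Wuv : W (2^-1 *: (u + v)) by apply: WZ; exact: WD.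
have h : J u + J v - 2 * J (2^-1 *: (u + v)) <= 0.
  have := umin _ Wuv; have := vmin _ Wuv; rewrite LZ ?LD//; last exact: WD.
  lra.
have : C * (J u + J v - 2 * J (2^-1 *: (u + v))) <= 0 by rewrite mulr_ge0_le0.
suff : e / (J u + J v + 1) * (J u + J v) <= e by lra.
by rewrite mulrAC ler_pdivrMr// ler_pM2l//; lra.
Qed.

End abstract_minimization.

(** * Fatou's lemma and membership in L^p *)

Section measure_lemmas.
Context d (T : measurableType d) (R : realType).
Variable m : {measure set T -> \bar R}.
Local Open Scope ereal_scope.

(** Fatou's lemma for the tail from [K] on; the lower limit agrees almost everywhere with g. *)
Lemma fatou_le (f : nat -> T -> R) (g : T -> R) (c : \bar R) (K : nat) :
  (forall k, measurable_fun [set: T] (f k)) -> measurable_fun [set: T] g ->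
  (forall k x, (0 <= f k x)%R) -> (forall x, (0 <= g x)%R) ->
  {ae m, forall x, f k x @[k --> \oo] --> g x} ->
  (forall k, (K <= k)%N -> \int[m]_x (f k x)%:E <= c) ->
  \int[m]_x (g x)%:E <= c.
Proof.
move=> mf mg f0 g0 fg fc.
have mF k : measurable_fun [set: T] (EFin \o f (k + K)%N).
  exact/measurable_EFinP.
have F0 k x : [set: T] x -> 0 <= (EFin \o f (k + K)%N) x by rewrite lee_fin.
apply: (@le_trans _ _ (\int[m]_x limn_einf (fun k => (f (k + K)%N x)%:E))).
  rewrite le_eqVlt; apply/orP; left; apply/eqP.
  apply: ge0_ae_eq_integral => //.
  - exact/measurable_EFinP.
  - rewrite /limn_einf; apply: measurableT_comp => //.
    apply: measurable_fun_limn_esup => k.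
    exact: (measurableT_comp (@oppe_measurable _ _) (mF k)).
  - by move=> x _; rewrite lee_fin.
  - move=> x _; rewrite limn_einf_lim; apply: lime_ge; first exact: is_cvg_einfs.
    by apply: nearW => k; apply: le_ereal_inf_tmp => _ [l /= _ <-]; rewrite lee_fin.
  - apply: filterS fg => x fgx _.
    have fgK : (f (k + K)%N x)%:E @[k --> \oo] --> (g x)%:E.
      apply: cvg_EFin; first exact: nearW.
      by rewrite (_ : _ \o _ = (fun k => f (k + K)%N x))// (cvg_shiftn K (f ^~ x)).
    by have [-> _] := cvg_limn_einf_sup fgK.
apply: (le_trans (@fatou _ _ _ m setT measurableT (fun k => EFin \o f (k + K)%N) mF F0)).
rewrite limn_einf_lim; apply: lime_le; first exact: is_cvg_einfs.
apply: nearW => k; apply: (@le_trans _ _ (\int[m]_x (f (k + K)%N x)%:E)).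
  by apply: ereal_inf_lbound; exists k => /=.
by apply: fc; exact: leq_addl.
Qed.

Lemma Lfun_powRP (u : T -> R) (p : R) : (0 < p)%R ->
  u \in Lfun m p%:E <->
  measurable_fun [set: T] u /\ \int[m]_x (`|u x| `^ p)%:E < +oo.
Proof.
move=> p0; have pE : \int[m]_x (`|u x| `^ p)%:E = \int[m]_x (`|(EFin \o u) x| `^ p).
  by apply: eq_integral => x _; rewrite -poweR_EFin.
rewrite pE -poweR_Lnorm ?gt_eqF//.
split.
  rewrite inE => /andP[]; rewrite inE/= => mu; rewrite inE/= => fu.
  by split => //; rewrite poweR_lty.
move=> [mu fu]; rewrite inE; apply/andP; split; rewrite inE//=.
rewrite /finite_norm -(@poweRe1 _ (Lnorm _ _ _)) ?Lnorm_ge0//.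
by rewrite -(@mulfV _ p) ?gt_eqF// poweRrM poweR_lty.
Qed.

End measure_lemmas.

(** Some summand is at least the average in absolute value. *)
Lemma powR_norm_sum_le (R : realType) N (p : R) (F : 'I_N -> R) : 0 < p ->
  `|\sum_(j < N) F j| `^ p <= N%:R `^ p * \sum_(j < N) `|F j| `^ p.
Proof.
move=> p0; case: N F => [|N] F.
  by rewrite !big_ord0 normr0 powR0 ?gt_eqF// mulr0.
have [j hj] : exists j, `|\sum_(j < N.+1) F j| / N.+1%:R <= `|F j|.
  apply/not_existsP => H; have := ler_norm_sum (index_enum 'I_N.+1) F xpredT.
  apply/negP; rewrite -ltNge.
  set S := `|_| in H *.
  rewrite (_ : S = \sum_(j < N.+1) S / N.+1%:R); last first.
    by rewrite sumr_const card_ord -[RHS]mulr_natr divfK// pnatr_eq0.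
  apply: ltr_sum => [|i _]; last by rewrite ltNge; apply/negP; exact: H.
  by apply/hasP; exists ord0 => //; rewrite mem_index_enum.
apply: (@le_trans _ _ ((N.+1%:R * `|F j|) `^ p)).
  by rewrite ge0_ler_powR ?nnegrE ?(ltW p0) ?mulr_ge0// mulrC -ler_pdivrMr.
rewrite powRM// ler_wpM2l ?powR_ge0// (bigD1 j)//= lerDl.
by apply: sumr_ge0 => k _; exact: powR_ge0.
Qed.

(** * Null sets under translation and the Poincare inequality *)

Section translation_ae.
Context {R : realType}.
Variable n : nat.
Local Notation lam := (@lebesgue_measure R).
Local Notation mu := (leb R n).
Implicit Types (P : 'rV[R]_n -> Prop) (i : 'I_n).
Local Open Scope ereal_scope.

Lemma ae_translate P (y : 'rV[R]_n) :
  {ae mu, forall x, P x} -> {ae mu, forall x, P (x + y)%R}.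
Proof.
move=> [N [mN N0 PN]]; exists ((fun x => x + y)%R @^-1` N); split.
- rewrite -[X in measurable X]setTI; have : measurable_fun [set: 'rV[R]_n] (fun x : 'rV[R]_n => x + y)%R.
    by apply: measurable_rVD => //; exact: measurable_cst.
  exact.
- by rewrite leb_translate.
- by move=> x /= Px; apply: PN.
Qed.

Lemma ae_product_fst P :
  {ae mu, forall x, P x} -> {ae (mu \x lam), forall z, P z.1}.
Proof.
move=> [N [mN N0 PN]]; exists (N `*` setT); split.
- exact: measurableX.
- by rewrite product_measure1E// [X in X * _]N0 mul0e.
- by move=> z /= Pz; split => //; apply: PN.
Qed.

(** For each h the slice of the exceptional set is a translate of a null set; Tonelli's theorem
    concludes. *)
Lemma ae_product_shift P i : {ae mu, forall x, P x} ->
  {ae (mu \x lam), forall z, P (z.1 + z.2 *: delta_mx ord0 i)%R}.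
Proof.
move=> [N [mN N0 PN]].
pose B := (fun z : 'rV[R]_n * measurableTypeR R => z.1 + z.2 *: (delta_mx ord0 i : 'rV[R]_n))%R @^-1` N.
have mB : measurable B by rewrite -[X in measurable X]setTI; exact: measurable_shift.
exists B; split => //; last by move=> z /= Pz; apply: PN.
transitivity ((mu \x lam) (B `&` setT)); first by rewrite setIT.
rewrite -(@integral_indic _ _ _ (mu \x lam))//.
rewrite (fubini_tonelli2 (EFin \o \1_B))//; last 2 first.
- by apply/measurable_EFinP; exact: measurable_indic.
- by move=> z; rewrite lee_fin.
apply: integral0_eq => h _; rewrite /fubini_G/=.
pose y : 'rV[R]_n := (h *: delta_mx ord0 i)%R.
transitivity (\int[mu]_x (\1_((fun x => x + y)%R @^-1` N) x)%:E).
  by apply: eq_integral.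
have mN' : measurable ((fun x => x + y)%R @^-1` N).
  have : measurable_fun [set: 'rV[R]_n] (fun x : 'rV[R]_n => x + y)%R.
    by apply: measurable_rVD => //; exact: measurable_cst.
  by rewrite -[X in _ -> measurable X]setTI; exact.
rewrite integral_indic// setIT.
exact: (eq_trans (leb_translate y mN) N0).
Qed.

(** Provides a property valid almost everywhere at both end points of an increment, for almost every
    (x, h). *)
Lemma ae_product_all P : {ae mu, forall x, P x} ->
  {ae (mu \x lam), forall z, P z.1 /\ forall i, P (z.1 + z.2 *: delta_mx ord0 i)%R}.
Proof.
move=> aP.
have aS : {ae (mu \x lam), forall z : 'rV[R]_n * measurableTypeR R,
    forall i, P (z.1 + z.2 *: delta_mx ord0 i)%R}.
  apply: (@filter_forall _ _ (fun i (z : 'rV[R]_n * measurableTypeR R) =>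
    P (z.1 + z.2 *: delta_mx ord0 i)%R) (almost_everywhere (mu \x lam))) => i.
  exact: ae_product_shift.
by apply: filterS2 (ae_product_fst aP) aS.
Qed.

Lemma increment_iterate i h (u : 'rV[R]_n -> R) x N :
  (u (x + N%:R *: (h *: delta_mx ord0 i)) - u x =
   \sum_(j < N) increment i h u (x + j%:R *: (h *: delta_mx ord0 i)))%R.
Proof.
pose F j := u (x + j%:R *: (h *: delta_mx ord0 i))%R.
rewrite -[X in (_ - u X)%R](addr0 x) -[X in (_ - u (_ + X))%R](scale0r (h *: delta_mx ord0 i)).
rewrite -/(F N) -/(F 0%N) -(telescope_sumr _ (leq0n N)) big_mkord.
by apply: eq_bigr => j _; rewrite /F /increment -addrA -natr1 scalerDl scale1r.
Qed.

Lemma norm_coord_le (x : 'rV[R]_n) i : (`|x ord0 i| <= `|x|)%R.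
Proof.
rewrite /Num.norm/= mx_normrE.
exact: (@le_bigmax _ _ _ 0%R (fun ij => `|x ij.1 ij.2|%R) (ord0, i)).
Qed.

(* |x| <= M on Omega and h >= d / 2, so that after N > 4 M / d steps of size h
   in the direction e_i one leaves Omega. *)
Lemma powR_le_sum_increment i (p h : R) (Omega : set 'rV[R]_n) M N u :
  (0 < p)%R -> (forall x, Omega x -> `|x ord0 i| <= M)%R -> (2 * M < N%:R * h)%R ->
  {ae mu, forall x, (~` Omega) x -> u x = 0%R} ->
  {ae mu, forall x, (`|u x| `^ p <= N%:R `^ p *
    \sum_(j < N) `|increment i h u (x + j%:R *: (h *: delta_mx ord0 i))| `^ p)%R}.
Proof.
move=> p0 OM MN u0.
have S0 (F : 'I_N -> R) : (0 <= \sum_(j < N) `|F j| `^ p)%R.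
  by apply: sumr_ge0 => j _; exact: powR_ge0.
have := ae_translate (N%:R *: (h *: delta_mx ord0 i)) u0.
move: u0; apply: filterS2 => x ux uxN.
have [Ox|/ux ->] := pselect (Omega x); last first.
  by rewrite normr0 powR0 ?gt_eqF// mulr_ge0 ?powR_ge0.
have uN : u (x + N%:R *: (h *: delta_mx ord0 i))%R = 0%R.
  apply: uxN => /OM; rewrite !mxE !eqxx !mulr1 => h1.
  have := OM _ Ox; move: h1; rewrite !ler_norml => /andP[_ h1] /andP[h2 _].
  by move: MN; rewrite ltNge => /negP; apply; lra.
have := increment_iterate i h u x N; rewrite uN sub0r => uE.
by rewrite -normrN uE powR_norm_sum_le.
Qed.

(** The same number N of steps leaves Omega for every h in [d / 2, d], and there the kernel is at
    least d^-(1 + s p). Integrating the bound for one h over this interval produces the seminorm. *)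
Lemma poincare i (s p d M : R) (Omega : set 'rV[R]_n) :
  (0 < s)%R -> (0 < p)%R -> (0 < d)%R -> (forall x, Omega x -> `|x ord0 i| <= M)%R ->
  exists2 C : R, (0 <= C)%R & forall u : 'rV[R]_n -> R, measurable_fun [set: 'rV[R]_n] u ->
    {ae mu, forall x, (~` Omega) x -> u x = 0%R} ->
    \int[mu]_x (`|u x| `^ p)%:E <= C%:E * seminorm i s p d u.
Proof.
move=> s0 p0 d0 OM.
pose N := (Num.truncn (2 * `|M| / (d / 2))).+1.
have d20 : (0 < d / 2)%R by rewrite divr_gt0.
have NM h : (d / 2 <= h)%R -> (2 * M < N%:R * h)%R.
  move=> dh; have := truncnS_gt (2 * `|M| / (d / 2)); rewrite -/N ltr_pdivrMr// => h1.
  apply: (@le_lt_trans _ _ (2 * `|M|)%R).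
    by rewrite ler_wpM2l// ler_norm.
  by rewrite (lt_le_trans h1)// ler_wpM2l.
pose I := `[(d / 2)%R, d]%classic : set (measurableTypeR R).
have mI : measurable I by exact: measurable_itv.
have lamI : lam I = (d / 2)%:E.
  rewrite /I lebesgue_measure_itv/= lte_fin ifT; last by lra.
  by rewrite -EFinD; congr EFin; lra.
pose k0 := (d `^ (1 + s * p))^-1%R.
have k00 : (0 < k0)%R by rewrite invr_gt0 powR_gt0.
pose NN := (N%:R `^ p * N%:R)%R : R.
have NN0 : (0 <= NN)%R by rewrite mulr_ge0 ?powR_ge0.
exists ((d / 2 * k0)^-1 * NN)%R.
  by rewrite mulr_ge0// invr_ge0 mulr_ge0 ?ltW.
move=> u um u0.
set A := \int[mu]_x _.
pose G h := \int[mu]_x (`|increment i h u x| `^ p)%:E.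
have mG : measurable_fun [set: measurableTypeR R] G by exact: measurable_integral_increment.
have G0 h : 0 <= G h by apply: integral_ge0 => x _; rewrite lee_fin powR_ge0.
have A0 : 0 <= A by apply: integral_ge0 => x _; rewrite lee_fin powR_ge0.
have AG h : (d / 2 <= h)%R -> A <= NN%:E * G h.
  move=> dh.
  have mh : measurable_fun [set: 'rV[R]_n] (fun x => (`|increment i h u x| `^ p)%:E).
    by apply/measurable_EFinP/measurable_powR_norm; exact: measurable_increment_slice.
  have h0 x : 0 <= (`|increment i h u x| `^ p)%:E by rewrite lee_fin powR_ge0.
  pose y (j : nat) : 'rV[R]_n := (j%:R *: (h *: delta_mx ord0 i))%R.
  have mhj (j : nat) : measurable_fun [set: 'rV[R]_n]
      (fun x => (`|increment i h u (x + y j)| `^ p)%:E).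
    by apply: (measurableT_comp mh); apply: measurable_rVD => //; exact: measurable_cst.
  apply: (@le_trans _ _ (\int[mu]_x ((N%:R `^ p)%:E *
      \sum_(j < N) (`|increment i h u (x + y j)| `^ p)%:E))).
    apply: ae_ge0_le_integral => //.
    - by apply/measurable_EFinP; exact: measurable_powR_norm.
    - by move=> x _; rewrite mule_ge0 ?lee_fin ?powR_ge0// sume_ge0.
    - by apply: measurable_funeM; exact: emeasurable_sum.
    - apply: filterS (powR_le_sum_increment p0 OM (NM h dh) u0) => x hx _.
      by rewrite sumEFin -EFinM lee_fin.
  rewrite ge0_integralZl//; last 2 first.
  - exact: emeasurable_sum.
  - by move=> x _; rewrite sume_ge0.
  rewrite ge0_integral_sum//.
  under eq_bigr do rewrite (ge0_integral_translate (y _) mh h0).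
  rewrite sumr_const card_ord -[X in _ * X]mule_natl muleA -EFinM.
  by rewrite le_eqVlt; apply/orP; left.
have SG : seminorm i s p d u = \int[lam]_h ((increment_kernel s p d h)%:E * G h).
  exact: seminorm_tonelli.
clearbody G A.
have key : (d / 2 * k0)%:E * A <= NN%:E * seminorm i s p d u.
  rewrite SG.
  have mkG : measurable_fun [set: measurableTypeR R]
      (fun h => (increment_kernel s p d h)%:E * G h).
    by apply: emeasurable_funM => //; apply/measurable_EFinP; exact: measurable_increment_kernel.
  have kG0 h : 0 <= (increment_kernel s p d h)%:E * G h.
    by rewrite mule_ge0// lee_fin increment_kernel_ge0.
  rewrite -ge0_integralZl//.
  apply: (@le_trans _ _ (\int[lam]_(h in I) (k0%:E * A))).
    by rewrite integral_cst// [X in _ <= _ * X]lamI muleAC -EFinM mulrC.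
  apply: (@le_trans _ _ (\int[lam]_(h in I) (NN%:E * ((increment_kernel s p d h)%:E * G h)))).
    apply: ge0_le_integral => //.
    - by move=> h _; rewrite mule_ge0// lee_fin ltW.
    - by apply: measurable_funTS; exact: measurable_funeM.
    - move=> h; rewrite /I/= in_itv/= => /andP[h1 h2].
      have h0 : (0 < h)%R by rewrite (lt_le_trans d20).
      rewrite muleCA; apply: lee_pmul => //.
      + by rewrite lee_fin ltW.
      + rewrite lee_fin increment_kernelE ?gtr0_norm// /k0 lef_pV2 ?posrE ?powR_gt0//.
        by rewrite ge0_ler_powR ?nnegrE ?(ltW h0) ?(ltW d0)// addr_ge0// mulr_ge0 ?ltW.
      + exact: AG.
  apply: ge0_subset_integral => //.
  - exact: measurable_funeM.
  - by move=> h _; rewrite mule_ge0 ?lee_fin.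
have dk0 : (0 < d / 2 * k0)%R by rewrite mulr_gt0.
rewrite [leLHS](_ : A = ((d / 2 * k0)^-1)%:E * ((d / 2 * k0)%:E * A)); last first.
  by rewrite muleA -EFinM mulVf ?gt_eqF// mul1e.
rewrite [leRHS](_ : _ = ((d / 2 * k0)^-1)%:E * (NN%:E * seminorm i s p d u)).
  by rewrite lee_wpmul2l// lee_fin invr_ge0 ltW.
by rewrite EFinM muleA.
Qed.

End translation_ae.

(** * The energy *)

Section energy.
Context {R : realType}.
Variables (n : nat) (s p delta : 'I_n -> R).
Hypothesis s0 : forall i, 0 < s i.
Hypothesis p1 : forall i, 1 < p i.
Hypothesis d0 : forall i, 0 < delta i.
Local Notation lam := (@lebesgue_measure R).
Local Notation mu := (leb R n).
Local Notation nu := (leb R n \x @lebesgue_measure R)%E.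
Local Notation rV := 'rV[R]_n.
Implicit Types (u v w : 'rV[R]_n -> R) (z : 'rV[R]_n * measurableTypeR R).

Let p0 i : 0 < p i. Proof. by rewrite (lt_trans _ (p1 i)). Qed.

Definition energy_weight i : R := (delta i `^ (p i * (1 - s i)))^-1.

Let wt i (h : R) := energy_weight i * increment_kernel (s i) (p i) (delta i) h.

Lemma energy_weight_gt0 i : 0 < energy_weight i.
Proof. by rewrite invr_gt0 powR_gt0. Qed.

Let wt_ge0 i h : 0 <= wt i h.
Proof. by rewrite mulr_ge0 ?increment_kernel_ge0// ltW// energy_weight_gt0. Qed.

(** All directions are put under one integral over (x, h), so that pointwise inequalities for
    powers, Fatou's lemma and dominated convergence apply on a single measure space. *)
Definition energy_density u z : R :=
  \sum_(i < n) wt i z.2 * `|increment i z.2 u z.1| `^ p i.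

Definition energy u : \bar R := (\int[nu]_z (energy_density u z)%:E)%E.
Arguments energy u%_ring_scope.

(** The derivative of [energy_density] at u in the direction v, pointwise in (x, h). *)
Definition pairing_density u v z : R :=
  \sum_(i < n) wt i z.2 * (p i * (`|increment i z.2 u z.1| `^ (p i - 2) *
    increment i z.2 u z.1) * increment i z.2 v z.1).

Lemma incrementD i h u v x :
  increment i h (u + v) x = increment i h u x + increment i h v x.
Proof. rewrite /increment /= !fctE; ring. Qed.

Lemma incrementZ i h (t : R) u x : increment i h (t *: u) x = t * increment i h u x.
Proof. by rewrite /increment /= mulrBr. Qed.

Lemma incrementB i h u v x :
  increment i h (u - v) x = increment i h u x - increment i h v x.
Proof. rewrite /increment /= !fctE; ring. Qed.

Lemma energy_density_ge0 u z : 0 <= energy_density u z.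
Proof. by apply: sumr_ge0 => i _; rewrite mulr_ge0 ?powR_ge0. Qed.

Lemma measurable_wt i : measurable_fun [set: rV * measurableTypeR R]
  (fun z : rV * measurableTypeR R => wt i z.2).
Proof.
apply: measurable_funM => //.
exact: (measurableT_comp (measurable_increment_kernel _ _ _) measurable_snd).
Qed.

Lemma measurable_energy_density u : measurable_fun [set: rV] u ->
  measurable_fun [set: rV * measurableTypeR R] (energy_density u).
Proof.
move=> um; apply: measurable_sum => i; apply: measurable_funM; first exact: measurable_wt.
by apply: measurable_powR_norm; exact: measurable_increment.
Qed.

Lemma measurable_pairing_density u v :
  measurable_fun [set: rV] u -> measurable_fun [set: rV] v ->
  measurable_fun [set: rV * measurableTypeR R] (pairing_density u v).
Proof.
move=> um vm; apply: measurable_sum => i; apply: measurable_funM; first exact: measurable_wt.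
apply: measurable_funM; last exact: measurable_increment.
apply: measurable_funM => //; apply: measurable_funM.
  by apply: measurable_powR_norm; exact: measurable_increment.
exact: measurable_increment.
Qed.

Lemma energy_ge0 u : (0 <= energy u)%E.
Proof. by apply: integral_ge0 => z _; rewrite lee_fin energy_density_ge0. Qed.

Lemma energyE u : measurable_fun [set: rV] u ->
  energy u = (\sum_(i < n) (energy_weight i)%:E * seminorm i (s i) (p i) (delta i) u)%E.
Proof.
move=> um; rewrite /energy.
under eq_integral do rewrite -sumEFin.
rewrite ge0_integral_sum//; last 2 first.
- move=> i; apply/measurable_EFinP; apply: measurable_funM; first exact: measurable_wt.
  by apply: measurable_powR_norm; exact: measurable_increment.
- by move=> i z _; rewrite lee_fin mulr_ge0 ?powR_ge0.
apply: eq_bigr => i _; rewrite (seminormE _ _ _ _ um) -ge0_integralZl//.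
- by apply: eq_integral => z _; rewrite -EFinM /wt; congr EFin; ring.
- exact: measurable_seminorm_integrand.
- by move=> z _; rewrite lee_fin mulr_ge0 ?powR_ge0 ?increment_kernel_ge0.
- by rewrite lee_fin ltW// energy_weight_gt0.
Qed.

Lemma seminorm_le_energy i u : measurable_fun [set: rV] u ->
  (seminorm i (s i) (p i) (delta i) u <= ((energy_weight i)^-1)%:E * energy u)%E.
Proof.
move=> um; rewrite (energyE um) (bigD1 i)//=.
have w0 := energy_weight_gt0.
have S0 j : (0 <= (energy_weight j)%:E * seminorm j (s j) (p j) (delta j) u)%E.
  rewrite mule_ge0 ?lee_fin ?(ltW (w0 _))//.
  by apply: integral_ge0 => x _; apply: integral_ge0 => h _; rewrite lee_fin divr_ge0 ?powR_ge0.
rewrite ge0_muleDr//; last exact: sume_ge0.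
rewrite muleA -EFinM mulVf ?gt_eqF// mul1e leeDl// mule_ge0 ?sume_ge0//.
by rewrite lee_fin invr_ge0 ltW.
Qed.

Lemma le_energy_scale (t c : R) u : 0 <= c -> (forall i, `|t| `^ p i <= c) ->
  measurable_fun [set: rV] u -> (energy (t *: u) <= c%:E * energy u)%E.
Proof.
move=> c0 tc um; rewrite /energy.
have mt : measurable_fun [set: rV] (t *: u) by exact: measurable_funM.
rewrite -ge0_integralZl//; last 2 first.
- by apply/measurable_EFinP; exact: measurable_energy_density.
- by move=> z _; rewrite lee_fin energy_density_ge0.
apply: ge0_le_integral => //.
- by move=> z _; rewrite lee_fin energy_density_ge0.
- by apply/measurable_EFinP; exact: measurable_energy_density.
- by apply: measurable_funeM; apply/measurable_EFinP; exact: measurable_energy_density.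
- move=> z _; rewrite -EFinM lee_fin /energy_density mulr_sumr; apply: ler_sum => i _.
  rewrite incrementZ normrM powRM// mulrCA [leRHS]mulrCA (mulrCA (wt i z.2)).
  by rewrite ler_wpM2r ?tc// mulr_ge0 ?powR_ge0.
Qed.

(** The midpoint term stands on the left to avoid a subtraction of possibly infinite energies. *)
Lemma energy_uniform_convexity e : 0 < e -> exists2 C, 0 <= C &
  forall u v, measurable_fun [set: rV] u -> measurable_fun [set: rV] v ->
  (energy (u - v) + (2 * C)%:E * energy (2^-1 *: (u + v)) <=
   (e + C)%:E * (energy u + energy v))%E.
Proof.
move=> e0.
have [C C0 CP] : exists2 C, 0 <= C & forall i a b, `|a - b| `^ p i <=
    e * (`|a| `^ p i + `|b| `^ p i) +
    C * (`|a| `^ p i + `|b| `^ p i - 2 * `|(a + b) / 2| `^ p i).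
  (* The midpoint defect is nonnegative, so constants may be enlarged, and their sum serves all
     directions. *)
  pose Ci i := s2val (cid2 (powR_uniform_convexity (p1 i) e0)).
  have Ci0 i : 0 <= Ci i by exact: (s2valP (cid2 (powR_uniform_convexity (p1 i) e0))).
  exists (\sum_(i < n) Ci i) => [|i a b]; first exact: sumr_ge0.
  apply: (le_trans (s2valP' (cid2 (powR_uniform_convexity (p1 i) e0)) a b)).
  rewrite lerD2l ler_wpM2r ?powR_midpoint_ge0//.
  by rewrite -/(Ci i) (bigD1 i)//= lerDl; exact: sumr_ge0.
exists C => // u v um vm.
have md w : measurable_fun [set: rV] w ->
    measurable_fun [set: rV * measurableTypeR R] (fun z => (energy_density w z)%:E).
  by move=> wm; apply/measurable_EFinP; exact: measurable_energy_density.
have d_ge0 w z : (0 <= (energy_density w z)%:E)%E by rewrite lee_fin energy_density_ge0.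
have m1 : measurable_fun [set: rV] (u - v) by exact: measurable_funB.
have m2 : measurable_fun [set: rV] (2^-1 *: (u + v)).
  by apply: measurable_funM => //; exact: measurable_funD.
have C2 : (0 <= (2 * C)%:E)%E by rewrite lee_fin mulr_ge0.
rewrite /energy -ge0_integralZl//; last exact: md.
rewrite -!ge0_integralD//; [|exact: md|exact: md|exact: md| |]; last 2 first.
- by move=> z _; rewrite mule_ge0.
- by apply: measurable_funeM; exact: md.
rewrite -ge0_integralZl//; last 3 first.
- by apply: emeasurable_funD; exact: md.
- by move=> z _; rewrite adde_ge0.
- by rewrite lee_fin addr_ge0// ltW.
apply: ge0_le_integral => //.
- by move=> z _; rewrite adde_ge0// mule_ge0.
- by apply: emeasurable_funD; [exact: md|apply: measurable_funeM; exact: md].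
- by apply: measurable_funeM; apply: emeasurable_funD; exact: md.
move=> z _ /=; rewrite lee_fin /energy_density.
rewrite mulr_sumr -!big_split/= mulr_sumr; apply: ler_sum => i _.
rewrite incrementZ incrementB incrementD.
set a := increment i z.2 u z.1; set b := increment i z.2 v z.1.
have := ler_wpM2l (wt_ge0 i z.2) (CP i a b).
rewrite (mulrC 2^-1); nra.
Qed.

Lemma energyD_le : exists2 K, 0 <= K & forall u v,
  measurable_fun [set: rV] u -> measurable_fun [set: rV] v ->
  (energy (u + v) <= K%:E * (energy u + energy v))%E.
Proof.
exists (\sum_(i < n) 2 `^ p i) => [|u v um vm]; first by apply: sumr_ge0 => i _; exact: powR_ge0.
have K0 : (0 <= (\sum_(i < n) (2 : R) `^ p i)%:E)%E.
  by rewrite lee_fin; apply: sumr_ge0 => i _; exact: powR_ge0.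
have md w : measurable_fun [set: rV] w ->
    measurable_fun [set: rV * measurableTypeR R] (fun z => (energy_density w z)%:E).
  by move=> wm; apply/measurable_EFinP; exact: measurable_energy_density.
have d_ge0 w z : (0 <= (energy_density w z)%:E)%E by rewrite lee_fin energy_density_ge0.
rewrite /energy -ge0_integralD//; [|exact: md|exact: md].
rewrite -ge0_integralZl//; last 2 first.
- by apply: emeasurable_funD; exact: md.
- by move=> z _; rewrite adde_ge0.
apply: ge0_le_integral => //.
- by apply: md; exact: measurable_funD.
- by apply: measurable_funeM; apply: emeasurable_funD; exact: md.
move=> z _ /=; rewrite lee_fin /energy_density -big_split/= mulr_sumr.
apply: ler_sum => i _; rewrite incrementD -mulrDr mulrCA ler_wpM2l//.
apply: (le_trans (powR_normD_le _ _ (p0 i))); rewrite ler_wpM2r ?addr_ge0 ?powR_ge0//.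
by rewrite (bigD1 i)//= lerDl; apply: sumr_ge0 => j _; exact: powR_ge0.
Qed.

Lemma energy_density_tangent u v z :
  energy_density u z + pairing_density u (v - u) z <= energy_density v z.
Proof.
rewrite /energy_density /pairing_density -big_split/=; apply: ler_sum => i _.
rewrite incrementB -mulrDr ler_wpM2l//; exact: powR_norm_tangent.
Qed.

Lemma pairing_density_le : exists2 K, 0 <= K & forall u v z,
  `|pairing_density u v z| <= K * (energy_density u z + energy_density v z).
Proof.
exists (\sum_(i < n) p i) => [|u v z]; first by apply: sumr_ge0 => i _; exact: ltW.
rewrite /energy_density /pairing_density -big_split/= mulr_sumr.
apply: (le_trans (ler_norm_sum _ _ _)); apply: ler_sum => i _.
rewrite normrM (ger0_norm (wt_ge0 _ _)) -mulrDr [leRHS]mulrCA ler_wpM2l//.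
rewrite -mulrA normrM (gtr0_norm (p0 i)) ler_pM ?(ltW (p0 i))//.
  by rewrite (bigD1 i)//= lerDl; apply: sumr_ge0 => j _; exact: ltW.
exact: signed_powR_le.
Qed.

Local Open Scope ereal_scope.

Definition pairing u v : \bar R := \int[nu]_z (pairing_density u v z)%:E.

Lemma integrable_energy_density u : measurable_fun [set: rV] u -> energy u < +oo ->
  nu.-integrable setT (EFin \o energy_density u).
Proof.
move=> um uoo; apply/integrableP; split.
  by apply/measurable_EFinP; exact: measurable_energy_density.
under eq_integral do rewrite gee0_abs ?lee_fin ?energy_density_ge0//.
exact: uoo.
Qed.

Lemma integrable_pairing_density u v :
  measurable_fun [set: rV] u -> measurable_fun [set: rV] v ->
  energy u < +oo -> energy v < +oo ->
  nu.-integrable setT (EFin \o pairing_density u v).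
Proof.
move=> um vm uoo voo; have [K K0 KP] := pairing_density_le.
have iuv : nu.-integrable setT
    (fun z => K%:E * ((EFin \o energy_density u) z + (EFin \o energy_density v) z)).
  by apply: integrableZl => //; apply: integrableD => //; exact: integrable_energy_density.
apply: le_integrable iuv => //.
  by apply/measurable_EFinP; exact: measurable_pairing_density.
by move=> z _ /=; rewrite lee_fin (le_trans (KP _ _ _))// ler_norm.
Qed.

Lemma energyD_lty u v : measurable_fun [set: rV] u -> measurable_fun [set: rV] v ->
  energy u < +oo -> energy v < +oo -> energy (u + v) < +oo.
Proof.
move=> um vm uoo voo; have [K K0 KP] := energyD_le.
apply: (le_lt_trans (KP u v um vm)).
have := energy_ge0 u; have := energy_ge0 v; move: uoo voo.
move: (energy u) (energy v) => [a| |] [b| |]//= _ _ _ _.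
by rewrite -EFinD -EFinM ltry.
Qed.

Lemma energyZ_lty t u : measurable_fun [set: rV] u ->
  energy u < +oo -> energy (t *: u) < +oo.
Proof.
move=> um uoo.
have c0 : (0 <= \sum_(i < n) `|t| `^ p i)%R by apply: sumr_ge0 => i _; exact: powR_ge0.
apply: le_lt_trans (@le_energy_scale t _ u c0 _ um) _.
  move=> i; rewrite (bigD1 i)//= lerDl; apply: sumr_ge0 => j _; exact: powR_ge0.
have := energy_ge0 u; move: uoo; move: (energy u) => [a| |]//= _ _.
by rewrite -EFinM ltry.
Qed.

Lemma energyB_lty u v : measurable_fun [set: rV] u -> measurable_fun [set: rV] v ->
  energy u < +oo -> energy v < +oo -> energy (u - v) < +oo.
Proof.
move=> um vm uoo voo; rewrite -scaleN1r.
have vm' : measurable_fun [set: rV] ((-1) *: v)%R by exact: measurable_funM.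
exact: (energyD_lty um vm' uoo (energyZ_lty (-1) vm voo)).
Qed.

Lemma energy_tangent u v :
  measurable_fun [set: rV] u -> measurable_fun [set: rV] v ->
  energy u < +oo -> energy v < +oo ->
  energy u + pairing u (v - u)%R <= energy v.
Proof.
move=> um vm uoo voo.
have dm : measurable_fun [set: rV] (v - u)%R by exact: measurable_funB.
have doo : energy (v - u) < +oo by exact: energyB_lty.
rewrite -[X in X + _]/(\int[nu]_z (EFin \o energy_density u) z).
rewrite -[X in _ + X]/(\int[nu]_z (EFin \o pairing_density u (v - u)%R) z).
rewrite -integralD//; [|exact: integrable_energy_density|exact: integrable_pairing_density].
apply: le_integral => //.
- apply: integrableD => //; [exact: integrable_energy_density|exact: integrable_pairing_density].
- exact: integrable_energy_density.
- by move=> z _; rewrite /= -EFinD lee_fin energy_density_tangent.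
Qed.

(** The integrand changes sign, so Fubini's theorem needs integrability: each direction is dominated
    by the sum of the energy densities of u and v, up to the weight. *)
Lemma laplacian_pairingE u v :
  measurable_fun [set: rV] u -> measurable_fun [set: rV] v ->
  energy u < +oo -> energy v < +oo ->
  laplacian_pairing s p delta u v = pairing u v.
Proof.
move=> um vm uoo voo.
pose g i (z : rV * measurableTypeR R) : R :=
  (increment_kernel (s i) (p i) (delta i) z.2 *
  ((`|increment i z.2 u z.1| `^ (p i - 2) * increment i z.2 u z.1) *
    increment i z.2 v z.1))%R.
have k0 i h : (0 <= increment_kernel (s i) (p i) (delta i) h)%R by exact: increment_kernel_ge0.
have mg i : measurable_fun [set: rV * measurableTypeR R] (g i).
  apply: measurable_funM.
    exact: (measurableT_comp (measurable_increment_kernel _ _ _) measurable_snd).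
  apply: measurable_funM; last exact: measurable_increment.
  apply: measurable_funM; last exact: measurable_increment.
  by apply: measurable_powR_norm; exact: measurable_increment.
have w0 := energy_weight_gt0.
have ig i : nu.-integrable setT (EFin \o g i).
  have iuv : nu.-integrable setT
      (fun z => ((energy_weight i)^-1)%:E *
        ((EFin \o energy_density u) z + (EFin \o energy_density v) z)).
    by apply: integrableZl => //; apply: integrableD => //; exact: integrable_energy_density.
  apply: le_integrable iuv => //; first exact/measurable_EFinP.
  move=> z _ /=; rewrite lee_fin; apply: le_trans (ler_norm _).
  rewrite ler_pdivlMl// normrM (ger0_norm (k0 _ _)) mulrA -/(wt i z.2).
  apply: (@le_trans _ _ (wt i z.2 * (`|increment i z.2 u z.1| `^ p i +
      `|increment i z.2 v z.1| `^ p i))%R).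
    by rewrite ler_wpM2l// signed_powR_le.
  rewrite mulrDr lerD// /energy_density (bigD1 i)//= lerDl;
    by apply: sumr_ge0 => j _; rewrite mulr_ge0 ?powR_ge0.
rewrite /laplacian_pairing /pairing.
transitivity (\int[nu]_z \sum_(i < n) ((p i * energy_weight i)%:E * (EFin \o g i) z)).
  rewrite integral_sum//; last by move=> i; apply: integrableZl => //.
  apply: eq_bigr => i _; rewrite integralZl//; congr (_ * _).
  rewrite -(integral12_prod_meas1 (ig i)); apply: eq_integral => x _.
  by rewrite integral_kernel; apply: eq_integral => h _; rewrite /g/= mulrC.
apply: eq_integral => z _; rewrite /pairing_density -sumEFin; apply: eq_bigr => i _.
by rewrite -EFinM /g /wt; congr EFin; ring.
Qed.

(** Dominated convergence: for steps at most 1 the energy density at u + t v is at most K2 times the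
    sum of those of u and v. With the tangent inequality this replaces differentiation of the
    energy. *)
Lemma pairing_cvg u v :
  measurable_fun [set: rV] u -> measurable_fun [set: rV] v ->
  energy u < +oo -> energy v < +oo ->
  pairing (u + (m.+1%:R^-1 : R) *: v)%R v @[m --> \oo] --> pairing u v.
Proof.
move=> um vm uoo voo.
have [K K0 KP] := pairing_density_le.
pose K2 := (\sum_(i < n) (2 : R) `^ p i)%R.
have K20 : (0 <= K2)%R by apply: sumr_ge0 => i _; exact: powR_ge0.
pose G z := (K * (K2 * (energy_density u z + energy_density v z) + energy_density v z))%R.
have vmt t : measurable_fun [set: rV] (t *: v)%R by exact: measurable_funM.
have umt t : measurable_fun [set: rV] (u + t *: v)%R by exact: measurable_funD.
have [] := @dominated_convergence _ _ _ nu setT measurableT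
  (fun m => EFin \o pairing_density (u + (m.+1%:R^-1 : R) *: v)%R v)
  (EFin \o pairing_density u v) (EFin \o G).
- by move=> m; apply/measurable_EFinP; exact: measurable_pairing_density.
- by apply/measurable_EFinP; exact: measurable_pairing_density.
- apply: aeW => z _; apply: cvg_EFin; first exact: nearW.
  rewrite /comp/= /pairing_density.
  apply: cvg_big => [|i _]; [exact: add_continuous|]; apply: cvgMl_tmp; apply: cvgMr_tmp; apply: cvgMl_tmp.
  set a := increment i z.2 u z.1; set b := increment i z.2 v z.1.
  under eq_fun do rewrite incrementD incrementZ -/a -/b.
  have : (a + m.+1%:R^-1 * b)%R @[m --> \oo] --> a.
    rewrite -[X in _ --> X]addr0 -[X in _ --> (_ + X)%R](mul0r b).
    apply: cvgD; first exact: cvg_cst.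
    by apply: cvgMl; exact: cvg_harmonic.
  move=> abcv.
  pose F (x : R) : R := (`|x| `^ (p i - 2) * x)%R.
  have Fc : {for a, continuous F} by exact: (continuous_signed_powR (p1 i)).
  have := continuous_cvg _ Fc abcv.
  exact.
- have iu := integrable_energy_density um uoo.
  have iv := integrable_energy_density vm voo.
  have := integrableZl measurableT K (integrableD measurableT
    (integrableZl measurableT K2 (integrableD measurableT iu iv)) iv).
  by apply: eq_integrable.
- apply: aeW => z m _; rewrite /= lee_fin (le_trans (KP _ _ _))// ler_wpM2l// lerD2r.
  rewrite /energy_density -big_split/= mulr_sumr; apply: ler_sum => i _.
  rewrite incrementD incrementZ -mulrDr [leRHS]mulrCA ler_wpM2l//.
  apply: (le_trans (powR_normD_le _ _ (p0 i))).
  apply: ler_pM; rewrite ?addr_ge0 ?powR_ge0//.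
    by rewrite /K2 (bigD1 i)//= lerDl; apply: sumr_ge0 => j _; exact: powR_ge0.
  rewrite lerD2l ge0_ler_powR ?nnegrE ?(ltW (p0 i))// normrM.
  by rewrite ler_piMl// ger0_norm// invf_le1// ler1n.
by [].
Qed.

End energy.

(** * Almost everywhere convergence from geometric decay *)

Section almost_everywhere_convergence.
Context d (T : measurableType d) (R : realType).
Variable m : {measure set T -> \bar R}.

Lemma cvgn_of_geometric_increments (a : nat -> R) (M : R) :
  (forall k, `|a k.+1 - a k| <= M * 2^-1 ^+ k) -> cvgn a.
Proof.
move=> aM.
have h : cvgn (series (telescope a)).
  apply: normed_cvg; apply: (series_le_cvg _ _ (aM)) => [k|k|] /=.
  - exact: normr_ge0.
  - exact: (le_trans (normr_ge0 _) (aM k)).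
  - by apply: is_cvg_geometric_series; rewrite ger0_norm ?invr_ge0// invf_lt1// ltr1n.
have -> : a = (fun k => a 0%N + series (telescope a) k).
  by apply/funext => k; exact: eq_sum_telescope.
by apply: is_cvgD => //; exact: is_cvg_cst.
Qed.

(** The rate 4^-k leaves room for a factor 2^k: the integrals of (2^k |u_(k+1) - u_k|)^p are still
    summable. So these powers are bounded in k at almost every point, and the differences decay like
    2^-k. *)
Lemma ae_cvg_of_geometric_increments (u : nat -> T -> R) (p C : R) :
  1 <= p -> 0 <= C -> (forall k, measurable_fun [set: T] (u k)) ->
  (forall k, (\int[m]_x (`|u k.+1 x - u k x| `^ p)%:E <= (C * (4^-1 ^+ k) `^ p)%:E)%E) ->
  exists2 v : T -> R, measurable_fun [set: T] v &
    {ae m, forall x, u k x @[k --> \oo] --> v x}.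
Proof.
move=> p1 C0 um uC; have p0 : 0 < p by rewrite (lt_le_trans _ p1).
pose h k x := ((2 ^+ k) `^ p * `|u k.+1 x - u k x| `^ p)%:E.
have h0 k x : (0 <= h k x)%E by rewrite lee_fin mulr_ge0 ?powR_ge0.
have mdu k : measurable_fun [set: T] (fun x => `|u k.+1 x - u k x| `^ p).
  by apply: measurable_powR_norm; exact: measurable_funB.
have mh k : measurable_fun [set: T] (h k).
  by apply/measurable_EFinP; apply: measurable_funM.
have hC k : (\int[m]_x h k x <= (2 * C / (2 ^ k.+1)%:R)%:E)%E.
  rewrite /h; under eq_integral do rewrite EFinM.
  rewrite ge0_integralZl//; last exact/measurable_EFinP.
  apply: (le_trans (lee_wpmul2l _ (uC k))); first by rewrite lee_fin powR_ge0.
  rewrite -EFinM lee_fin mulrCA -powRM ?exprn_ge0 ?invr_ge0//.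
  rewrite -exprMn (_ : 2 * 4^-1 = 2^-1 :> R); last by field.
  rewrite expnS natrM natrX mulrC -mulf_div mulfV// mul1r mulrC ler_wpM2l//.
  rewrite -exprVn ge1r_powR// exprn_gt0 ?invr_gt0//=.
  by rewrite exprn_ile1 ?invr_ge0// invf_le1// ler1n.
have sum_oo : (\int[m]_x (\sum_(k <oo) h k x) < +oo)%E.
  rewrite integral_nneseries//.
  have C20 : 0 <= 2 * C by rewrite mulr_ge0.
  apply: (le_lt_trans (lee_nneseries _ _)) (le_lt_trans (epsilon_trick0 xpredT C20) (ltry _)).
  - by move=> k _ _; exact: integral_ge0.
  - by move=> k _; exact: hC.
have msum : measurable_fun [set: T] (fun x => \sum_(k <oo) h k x)%E.
  exact: ge0_emeasurable_sum.
have isum : m.-integrable setT (fun x => \sum_(k <oo) h k x)%E.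
  apply/integrableP; split => //.
  by under eq_integral do rewrite gee0_abs ?nneseries_ge0//.
(* The upper limit is defined everywhere and measurable, and equals the limit wherever that
   exists. *)
exists (fun x => fine (limn_esup (fun k => (u k x)%:E))).
  apply: measurableT_comp => //; apply: measurable_fun_limn_esup => k.
  exact/measurable_EFinP.
have := integrable_ae measurableT isum; apply: filterS => x /(_ I).
move=> fx; have Sx : cvgn (u ^~ x).
  pose M := fine (\sum_(k <oo) h k x)%E.
  have hM k : (2 ^+ k * `|u k.+1 x - u k x|) `^ p <= M.
    rewrite -lee_fin /M fineK// powRM ?exprn_ge0//.
    apply: (@le_trans _ _ (\sum_(0 <= i < k.+1) h i x)%E).
      by rewrite big_nat_recr//= leeDr// sume_ge0.
    by apply: nneseries_lim_ge => i _ _; exact: h0.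
  have M0 : 0 <= M by rewrite (le_trans _ (hM 0%N))// powR_ge0.
  apply: (@cvgn_of_geometric_increments _ (M `^ p^-1)) => k.
  rewrite exprVn ler_pdivlMr ?exprn_gt0// mulrC.
  have t0 : 0 <= 2 ^+ k * `|u k.+1 x - u k x| by rewrite mulr_ge0 ?exprn_ge0.
  rewrite -[leLHS](powRr1 t0) -[X in _ `^ X](@mulfV _ p) ?gt_eqF// powRrM.
  by rewrite ge0_ler_powR ?nnegrE ?powR_ge0 ?invr_ge0 ?(ltW p0).
have cE : (fun k => (u k x)%:E) @ \oo --> (limn (u ^~ x))%:E.
  by apply: cvg_EFin; [exact: nearW|exact: Sx].
by rewrite (cvg_limn_einf_sup cE).2/=.
Qed.

End almost_everywhere_convergence.

(** * Functions of finite energy: completeness and lower semicontinuity *)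

Section finite_energy_space.
Context {R : realType}.
Variables (n : nat) (s p delta : 'I_n -> R) (Omega : set 'rV[R]_n) (M : R).
Hypothesis n0 : (0 < n)%N.
Hypothesis s0 : forall i, 0 < s i.
Hypothesis p1 : forall i, 1 < p i.
Hypothesis d0 : forall i, 0 < delta i.
Hypothesis OM : forall x, Omega x -> `|x| <= M.
Local Notation mu := (leb R n).
Local Notation nu := (leb R n \x @lebesgue_measure R)%E.
Local Notation rV := 'rV[R]_n.
Local Notation energy := (energy s p delta).
Implicit Types (u v w : 'rV[R]_n -> R).

Let p0 i : 0 < p i. Proof. by rewrite (lt_trans _ (p1 i)). Qed.

Local Open Scope ereal_scope.

Definition finite_energy : set (rV -> R) :=
  [set u | [/\ measurable_fun [set: rV] u, energy u < +oo &
    {ae mu, forall x, (~` Omega) x -> u x = 0%R}]].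

Lemma energy_poincare i : exists2 C : R, (0 <= C)%R & forall u, finite_energy u ->
  \int[mu]_x (`|u x| `^ p i)%:E <= C%:E * energy u.
Proof.
have OMi x : Omega x -> (`|x ord0 i| <= M)%R.
  by move=> /OM; apply: le_trans; exact: norm_coord_le.
have [C C0 CP] := poincare (s0 i) (p0 i) (d0 i) OMi.
have w0 := energy_weight_gt0 s p d0 i.
exists (C * (energy_weight s p delta i)^-1)%R; first by rewrite mulr_ge0// invr_ge0 ltW.
move=> u [um uoo uO]; apply: (le_trans (CP u um uO)).
by rewrite EFinM -muleA lee_wpmul2l ?lee_fin//; exact: seminorm_le_energy.
Qed.

(** From right to left, L^(p_i) integrability comes from the Poincare inequality. From left to
    right, measurability is read off one direction, which exists as n > 0. *)
Lemma sobolev0P u : sobolev0 Omega s p delta u <-> finite_energy u.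
Proof.
split=> [[us uO]|uW].
  have um : measurable_fun [set: rV] u.
    have [uL _] := us (Ordinal n0) I.
    by have [] := iffLR (Lfun_powRP (lebesgue_rV R n) u (p0 (Ordinal n0))) uL.
  split => //; rewrite energyE//; apply: lte_sum_pinfty => i _.
  by have [_ ?] := us i I; rewrite lte_mul_pinfty// lee_fin ltW// energy_weight_gt0.
have [um uoo uO] := uW; split => // i _; split; last first.
  apply: (le_lt_trans (seminorm_le_energy s p d0 i um)).
  by rewrite lte_mul_pinfty// lee_fin invr_ge0 ltW// energy_weight_gt0.
apply/(Lfun_powRP (lebesgue_rV R n) _ (p0 i)); split => //.
have [C C0 CP] := energy_poincare i; apply: (le_lt_trans (CP _ uW)).
by rewrite lte_mul_pinfty// lee_fin.
Qed.

Lemma finite_energy0 : finite_energy 0%R.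
Proof.
split; [exact: measurable_cst| |exact: aeW].
suff -> : energy 0%R = 0 by exact: ltry.
apply: integral0_eq => z _; congr EFin; rewrite /energy_density big1// => i _.
by rewrite /increment subrr normr0 powR0 ?gt_eqF// mulr0.
Qed.

Lemma finite_energyD u v : finite_energy u -> finite_energy v -> finite_energy (u + v)%R.
Proof.
move=> [um uoo uO] [vm voo vO]; split; first exact: measurable_funD.
  exact: (energyD_lty p1 d0 um vm uoo voo).
move: uO vO; apply: filterS2 => x u0 v0 Ox.
by rewrite /= !fctE u0// v0// addr0.
Qed.

Lemma finite_energyZ t u : finite_energy u -> finite_energy (t *: u)%R.
Proof.
move=> [um uoo uO]; split; first exact: measurable_funM.
  exact: (energyZ_lty d0 t um uoo).
by move: uO; apply: filterS => x u0 Ox; rewrite fctE u0// scaler0.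
Qed.

Lemma finite_energyB u v : finite_energy u -> finite_energy v -> finite_energy (u - v)%R.
Proof.
move=> uW vW; rewrite -scaleN1r.
exact: finite_energyD uW (finite_energyZ (-1) vW).
Qed.

(** Convergence at almost every x gives convergence of the increments at almost every (x, h) by
    [ae_product_all]; then Fatou's lemma on the product. *)
Lemma energy_fatou (w : nat -> rV -> R) v (c : \bar R) K :
  (forall k, measurable_fun [set: rV] (w k)) -> measurable_fun [set: rV] v ->
  {ae mu, forall x, w k x @[k --> \oo] --> v x} ->
  (forall k, (K <= k)%N -> energy (w k) <= c) -> energy v <= c.
Proof.
move=> wm vm wv wc.
apply: (@fatou_le _ _ _ nu (fun k => energy_density s p delta (w k)) _ c K).
- by move=> k; exact: measurable_energy_density.
- exact: measurable_energy_density.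
- by move=> k z; exact: energy_density_ge0.
- by move=> z; exact: energy_density_ge0.
- apply: (@filterS _ _ (ae_filter_ringOfSetsType nu) _ _ _ (ae_product_all wv)) => z [wz wzi].
  apply: cvg_big => [|i _]; [exact: add_continuous|]; apply: cvgMl_tmp.
  have zi : increment i z.2 (w k) z.1 @[k --> \oo] --> increment i z.2 v z.1.
    by apply: cvgB; [exact: wzi|exact: wz].
  pose F (x : R) : R := (`|x| `^ p i)%R.
  have Fc : {for increment i z.2 v z.1, continuous F} by exact: (continuous_powR_norm (p0 i)).
  have := continuous_cvg _ Fc zi.
  exact.
- exact: wc.
Qed.

Let i0 := Ordinal n0.

(** The Poincare inequality in the direction [i0] turns the rate into the one that
    [ae_cvg_of_geometric_increments] asks for. The estimate for un k - u is Fatou's lemma in l for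
    un k - un l. *)
Lemma finite_energy_complete (un : nat -> rV -> R) :
  (forall k, finite_energy (un k)) ->
  (forall k l, (k <= l)%N -> energy (un k - un l)%R <= ((4^-1 ^+ k) `^ p i0)%:E) ->
  exists u, [/\ finite_energy u,
    forall k, energy (un k - u)%R <= ((4^-1 ^+ k) `^ p i0)%:E &
    forall c K, (forall l, (K <= l)%N -> energy (un l) <= c) -> energy u <= c].
Proof.
move=> unW une.
have unm k : measurable_fun [set: rV] (un k) by have [] := unW k.
have [C C0 CP] := energy_poincare i0.
have unC k : \int[mu]_x (`|un k.+1 x - un k x| `^ p i0)%:E <= (C * (4^-1 ^+ k) `^ p i0)%:E.
  under eq_integral do rewrite distrC.
  apply: (le_trans (CP _ (finite_energyB (unW k) (unW k.+1)))).
  by rewrite EFinM lee_wpmul2l ?lee_fin// une.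
have [u um unu] := ae_cvg_of_geometric_increments (ltW (p1 i0)) C0 unm unC.
have uO : {ae mu, forall x, (~` Omega) x -> u x = 0%R}.
  have : {ae mu, forall x, forall k, (~` Omega) x -> un k x = 0%R}.
    by apply: ae_foralln => k; have [] := unW k.
  move: unu; apply: filterS2 => x unu un0 Ox.
  apply: (cvg_unique _ unu) => //=.
  rewrite (_ : (fun k => un k x) = cst 0%R); first exact: cvg_cst.
  by apply/funext => k; exact: un0.
have ue k : energy (un k - u)%R <= ((4^-1 ^+ k) `^ p i0)%:E.
  apply: (@energy_fatou (fun l => un k - un l)%R _ _ k) => [l|||l kl].
  - exact: measurable_funB.
  - exact: measurable_funB.
  - by move: unu; apply: filterS => x ?; apply: cvgB => //; exact: cvg_cst.
  - exact: une.
exists u; split => //; last by move=> c K; exact: energy_fatou.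
split => //.
have -> : u = (un 0%N - (un 0%N - u))%R by rewrite subKr.
have dm : measurable_fun [set: rV] (un 0%N - u)%R by exact: measurable_funB.
have [_ un0oo _] := unW 0%N.
exact: (energyB_lty p1 d0 (unm 0%N) dm un0oo (le_lt_trans (ue 0%N) (ltry _))).
Qed.

End finite_energy_space.

(** * The linear functional on functions of finite energy *)

Section linear_functional.
Context {R : realType}.
Variables (n : nat) (s p delta : 'I_n -> R) (Omega : set 'rV[R]_n) (M : R).
Hypothesis n0 : (0 < n)%N.
Hypothesis s0 : forall i, 0 < s i.
Hypothesis p1 : forall i, 1 < p i.
Hypothesis d0 : forall i, 0 < delta i.
Hypothesis OM : forall x, Omega x -> `|x| <= M.
Variable q : R.
Hypothesis sg1 : 1 < \sum_(i < n) (s i * p i)^-1.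
Hypothesis qE : \sum_(i < n) (s i)^-1 = q * (\sum_(i < n) (s i * p i)^-1 - 1).
Hypothesis pq : forall i, p i < q.
Local Notation mu := (leb R n).
Local Notation rV := 'rV[R]_n.
Local Notation energy := (energy s p delta).
Local Notation W := (finite_energy s p delta Omega).
Implicit Types (u v w : 'rV[R]_n -> R).

Let p0 i : 0 < p i. Proof. by rewrite (lt_trans _ (p1 i)). Qed.
Let i0 := Ordinal n0.
Let q1 : 1 < q. Proof. exact: lt_trans (p1 i0) (pq i0). Qed.
Let q0 : 0 < q. Proof. exact: lt_trans q1. Qed.

Local Open Scope ereal_scope.

Lemma full_norm_le_energy : exists2 K : R, (0 <= K)%R & forall u, W u ->
  full_norm s p delta u <= K%:E * energy u.
Proof.
pose Ci i := s2val (cid2 (energy_poincare s0 p1 d0 OM i)).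
have Ci0 i : (0 <= Ci i)%R by exact: (s2valP (cid2 (energy_poincare s0 p1 d0 OM i))).
have CiP i u : W u -> \int[mu]_x (`|u x| `^ p i)%:E <= (Ci i)%:E * energy u.
  exact: (s2valP' (cid2 (energy_poincare s0 p1 d0 OM i))).
pose c i := (2 * n%:R `^ p i)%R.
pose d i := (delta i `^ (- (s i * p i)) * 2 `^ (p i + 1))%R.
have c0 i : (0 <= c i)%R by rewrite mulr_ge0 ?powR_ge0.
have dd0 i : (0 <= d i)%R by rewrite mulr_ge0 ?powR_ge0.
have w0 i : (0 <= (energy_weight s p delta i)^-1)%R.
  by rewrite invr_ge0 ltW// energy_weight_gt0.
exists (\sum_(i < n) c i * ((energy_weight s p delta i)^-1 + d i * Ci i))%R.
  by apply: sumr_ge0 => i _; rewrite mulr_ge0// addr_ge0// mulr_ge0.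
move=> u uW; have [um uoo _] := uW.
rewrite -sumEFin ge0_sume_distrl; last first.
  by move=> i _; rewrite lee_fin mulr_ge0// addr_ge0// mulr_ge0.
apply: lee_sum => i _; rewrite [X in X * energy u]EFinM -muleA.
apply: lee_wpmul2l; first by rewrite lee_fin.
have dC0 : (0 <= d i * Ci i)%R by rewrite mulr_ge0.
rewrite EFinD [leRHS]ge0_muleDl ?lee_fin//.
apply: leeD; first exact: seminorm_le_energy.
rewrite [X in X * energy u]EFinM -muleA; apply: lee_wpmul2l; last exact: CiP.
rewrite lee_fin; exact: dd0.
Qed.

Lemma level_set_le_integral u (r : R) : (0 < r)%R -> measurable_fun [set: rV] u ->
  mu [set x | (1 <= `|u x|)%R] <= \int[mu]_x (`|u x| `^ r)%:E.
Proof.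
move=> r0 um.
have mA : measurable [set x : rV | (1 <= `|u x|)%R].
  by apply: measurable_ge_set; exact: (measurableT_comp (@normr_measurable _ _) um).
rewrite -[X in mu X]setIT -(integral_indic mu measurableT mA).
apply: ge0_le_integral => //.
- by apply/measurable_EFinP; exact: measurable_indic.
- by apply/measurable_EFinP; exact: measurable_powR_norm.
move=> x _; rewrite lee_fin indicE; have [|_] := boolP (x \in _); last exact: powR_ge0.
rewrite inE/= => u1; have : (1 `^ r <= `|u x| `^ r)%R.
  by rewrite ge0_ler_powR ?nnegrE ?(ltW r0).
by rewrite powR1.
Qed.

(** [sobolev_bound] treats the set where |u| >= 1, whose measure is bounded by the L^p integral.
    Elsewhere |u|^q is at most |u|^(p_i0), because p_i0 < q. *)
Lemma energy_Lq (m : R) : (0 <= m)%R -> exists2 C : R, (0 <= C)%R &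
  forall u, W u -> energy u <= m%:E -> \int[mu]_x (`|u x| `^ q)%:E <= C%:E.
Proof.
move=> m0; have [K K0 KP] := full_norm_le_energy.
have [C0 C00 C0P] := energy_poincare s0 p1 d0 OM i0.
have Km : (0 <= K * m)%R by rewrite mulr_ge0.
have C0m : (0 <= C0 * m)%R by rewrite mulr_ge0.
have [C CP] := sobolev_bound n0 s0 p1 d0 sg1 q0 qE Km C0m.
exists (`|C| + C0 * m)%R; first by rewrite addr_ge0.
move=> u uW um; have [mu_ uoo _] := uW.
have Lp : \int[mu]_x (`|u x| `^ p i0)%:E <= (C0 * m)%:E.
  by apply: (le_trans (C0P _ uW)); rewrite EFinM lee_wpmul2l ?lee_fin.
set A := [set x | (1 <= `|u x|)%R].
have mA : measurable A.
  by apply: measurable_ge_set; exact: (measurableT_comp (@normr_measurable _ _) mu_).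
have mq r : measurable_fun [set: rV] (fun x => (`|u x| `^ r)%:E).
  by apply/measurable_EFinP; exact: measurable_powR_norm.
have Lq : \int[mu]_(x in A) (`|u x| `^ q)%:E <= C%:E.
  apply: CP => //.
    by apply: (le_trans (KP _ uW)); rewrite EFinM lee_wpmul2l ?lee_fin.
  exact: (le_trans (level_set_le_integral (p0 i0) mu_) Lp).
apply: (@le_trans _ _ (\int[mu]_(x in A) (`|u x| `^ q)%:E + \int[mu]_x (`|u x| `^ p i0)%:E)); last first.
  by rewrite EFinD leeD// (le_trans Lq)// lee_fin ler_norm.
rewrite (integral_mkcond A) -ge0_integralD//; last 2 first.
- by move=> x _; rewrite patchE; case: ifP => // _; rewrite lee_fin powR_ge0.
- exact/(measurable_restrictT _ mA)/measurable_funTS.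
apply: ge0_le_integral => //.
- by apply: emeasurable_funD => //; exact/(measurable_restrictT _ mA)/measurable_funTS.
move=> x _; rewrite patchE; case: ifPn => [_|].
  by rewrite leeDl.
rewrite notin_setE /A/= => /negP; rewrite -ltNge => /ltW u1; rewrite add0e lee_fin.
have [->|ux0] := eqVneq `|u x|%R 0%R; first by rewrite !powR0 ?gt_eqF.
have ux1 : (0 < `|u x| <= 1)%R by rewrite lt0r ux0 normr_ge0/=.
by rewrite (ger_powR ux1)// ltW.
Qed.

Variable g : rV -> R.
Hypothesis gm : measurable_fun [set: rV] g.
Hypothesis gL : \int[mu]_x (`|g x| `^ (q / (q - 1)))%:E < +oo.

Definition work u : \bar R := \int[mu]_x (g x * u x)%:E.

Lemma work_energy_bound (m : R) : (0 <= m)%R -> exists2 C : R, (0 <= C)%R &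
  forall u, W u -> energy u <= m%:E -> \int[mu]_x `|(g x * u x)%:E| <= C%:E.
Proof.
move=> m0; have [C C0 CP] := energy_Lq m0.
have q'0 : (0 < q / (q - 1))%R by rewrite divr_gt0// subr_gt0.
have gi0 : 0 <= \int[mu]_x (`|g x| `^ (q / (q - 1)))%:E by exact: integral_ge0.
have mq r u : measurable_fun [set: rV] u ->
    measurable_fun [set: rV] (fun x => (`|u x| `^ r)%:E).
  by move=> um; apply/measurable_EFinP; exact: measurable_powR_norm.
exists (fine (\int[mu]_x (`|g x| `^ (q / (q - 1)))%:E) + C)%R.
  by rewrite addr_ge0// fine_ge0.
move=> u uW um; have [mu_ uoo _] := uW.
rewrite EFinD fineK ?ge0_fin_numE//.
apply: (@le_trans _ _ (\int[mu]_x ((`|g x| `^ (q / (q - 1)))%:E + (`|u x| `^ q)%:E))); last first.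
  by rewrite ge0_integralD//; [rewrite leeD2l// CP|exact: mq|exact: mq].
apply: ge0_le_integral => //.
- by apply: measurableT_comp => //; apply/measurable_EFinP; exact: measurable_funM.
- by apply: emeasurable_funD; exact: mq.
move=> x _; rewrite /= -EFinD lee_fin normrM.
have := @conjugate_powR _ `|g x|%R `|u x|%R (q / (q - 1))%R q (normr_ge0 _) (normr_ge0 _) q'0 q0.
have qq : ((q / (q - 1))^-1 + q^-1 = 1)%R.
  by rewrite invf_div; field; rewrite ?gt_eqF// subr_gt0.
move=> /(_ qq) /le_trans; apply; apply: lerD.
  by rewrite ler_piMr ?powR_ge0// invf_le1// ler_pdivlMr ?subr_gt0// mul1r lerBlDr lerDl.
by rewrite ler_piMr ?powR_ge0// invf_le1// ltW.
Qed.

Lemma integrable_work u : W u -> mu.-integrable setT (fun x => (g x * u x)%:E).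
Proof.
move=> uW; have [um uoo _] := uW.
have [C _ CP] := work_energy_bound (fine_ge0 (energy_ge0 s p d0 u)).
apply/integrableP; split.
  by apply/measurable_EFinP; exact: measurable_funM.
apply: (le_lt_trans (CP _ uW _)) (ltry _).
by rewrite fineK// ge0_fin_numE// energy_ge0.
Qed.

Lemma work_fin_num u : W u -> work u \is a fin_num.
Proof. by move=> uW; apply: integrable_fin_num => //; exact: integrable_work. Qed.

Lemma workD u v : W u -> W v -> work (u + v)%R = work u + work v.
Proof.
move=> uW vW; rewrite /work.
rewrite -(integralD measurableT (integrable_work uW) (integrable_work vW)).
by apply: eq_integral => x _; rewrite -EFinD mulrDr.
Qed.

Lemma workZ (t : R) u : W u -> work (t *: u)%R = t%:E * work u.
Proof.
move=> uW; rewrite /work -(integralZl measurableT (integrable_work uW)).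
by apply: eq_integral => x _; rewrite -EFinM mulrCA.
Qed.

End linear_functional.

(** * Weak solutions *)

Section weak_solutions.
Context {R : realType}.
Variables (n : nat) (s p delta : 'I_n -> R) (Omega : set 'rV[R]_n) (M : R).
Hypothesis n0 : (0 < n)%N.
Hypothesis s0 : forall i, 0 < s i.
Hypothesis p1 : forall i, 1 < p i.
Hypothesis d0 : forall i, 0 < delta i.
Hypothesis OM : forall x, Omega x -> `|x| <= M.
Variable q : R.
Hypothesis sg1 : 1 < \sum_(i < n) (s i * p i)^-1.
Hypothesis qE : \sum_(i < n) (s i)^-1 = q * (\sum_(i < n) (s i * p i)^-1 - 1).
Hypothesis pq : forall i, p i < q.
Local Notation mu := (leb R n).
Local Notation nu := (leb R n \x @lebesgue_measure R)%E.
Local Notation rV := 'rV[R]_n.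
Local Notation energy := (energy s p delta).
Local Notation pairing := (pairing s p delta).
Local Notation W := (finite_energy s p delta Omega).
Variable g : rV -> R.
Hypothesis gm : measurable_fun [set: rV] g.
Hypothesis gL : (\int[mu]_x (`|g x| `^ (q / (q - 1)))%:E < +oo)%E.
Implicit Types (u v w : rV -> R).

Let p0 i : 0 < p i. Proof. by rewrite (lt_trans _ (p1 i)). Qed.
Let i0 := Ordinal n0.
Let J u : R := fine (energy u).
Let L u : R := fine (work g u).
Let P u v : R := fine (pairing u v).

Let W0 : W 0. Proof. exact: finite_energy0. Qed.
Let WD u v : W u -> W v -> W (u + v). Proof. exact: finite_energyD. Qed.
Let WZ t u : W u -> W (t *: u). Proof. exact: finite_energyZ. Qed.
Let WB u v : W u -> W v -> W (u - v). Proof. exact: finite_energyB. Qed.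
Let Wm u : W u -> measurable_fun [set: rV] u. Proof. by case. Qed.
Let Woo u : W u -> (energy u < +oo)%E. Proof. by case. Qed.

Let JE u : W u -> energy u = (J u)%:E.
Proof. by move=> uW; rewrite fineK// ge0_fin_numE ?Woo// energy_ge0. Qed.

Let LE u : W u -> work g u = (L u)%:E.
Proof. by move=> uW; rewrite fineK// (work_fin_num n0 s0 p1 d0 OM sg1 qE pq gm gL uW). Qed.

Let iP u v : W u -> W v ->
  nu.-integrable setT (EFin \o pairing_density s p delta u v).
Proof.
move=> uW vW.
exact: (integrable_pairing_density p1 d0 (Wm uW) (Wm vW) (Woo uW) (Woo vW)).
Qed.

Let PE u v : W u -> W v -> pairing u v = (P u v)%:E.
Proof.
move=> uW vW; rewrite fineK//.
exact: (integrable_fin_num measurableT (iP uW vW)).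
Qed.

Let LD u v : W u -> W v -> L (u + v) = L u + L v.
Proof.
move=> uW vW; apply: EFin_inj.
rewrite -(LE (WD uW vW)) EFinD -!LE//.
exact: (workD n0 s0 p1 d0 OM sg1 qE pq gm gL uW vW).
Qed.

Let LZ (t : R) u : W u -> L (t *: u) = t * L u.
Proof.
move=> uW; apply: EFin_inj.
rewrite -(LE (WZ t uW)) EFinM -LE//.
exact: (workZ n0 s0 p1 d0 OM sg1 qE pq gm gL t uW).
Qed.

Let PZ (t : R) u v : W u -> W v -> P u (t *: v) = t * P u v.
Proof.
move=> uW vW; apply: EFin_inj.
rewrite -(PE uW (WZ t vW)) EFinM -PE// -(integralZl measurableT (iP uW vW)).
apply: eq_integral => z _; rewrite -EFinM; congr EFin.
rewrite /pairing_density mulr_sumr; apply: eq_bigr => i _.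
by rewrite incrementZ; ring.
Qed.

Let J_ge0 u : W u -> 0 <= J u.
Proof. by move=> _; rewrite fine_ge0// energy_ge0. Qed.

Let J_tangent u v : W u -> W v -> J u + P u (v - u) <= J v.
Proof.
move=> uW vW; have := energy_tangent p1 d0 (Wm uW) (Wm vW) (Woo uW) (Woo vW).
rewrite (JE uW) (JE vW) (PE uW (WB vW uW)).
move: (J u) (J v) (P u (v - u)) => a b c.
by rewrite -EFinD lee_fin.
Qed.

Let Jscale (t c : R) u : 0 <= c -> (forall i, `|t| `^ p i <= c) -> W u ->
  J (t *: u) <= c * J u.
Proof.
move=> c0 tc uW; have := le_energy_scale s d0 c0 tc (Wm uW).
rewrite (JE uW) (JE (WZ t uW)).
move: (J u) (J (t *: u)) => a b.
by rewrite -EFinM lee_fin.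
Qed.

Let Jconvex e : 0 < e -> exists2 C, 0 <= C & forall u v, W u -> W v ->
  J (u - v) <= e * (J u + J v) + C * (J u + J v - 2 * J (2^-1 *: (u + v))).
Proof.
move=> e0; have [C C0 CP] := energy_uniform_convexity s p1 d0 e0.
exists C => // u v uW vW; have := CP u v (Wm uW) (Wm vW).
rewrite (JE uW) (JE vW) (JE (WB uW vW)) (JE (WZ _ (WD uW vW))).
move: (J (u - v)) (J (2^-1 *: (u + v))) (J u) (J v) => a b c d.
rewrite -EFinM -!EFinD -EFinM lee_fin; lra.
Qed.

Let Lbounded : exists C, forall u, W u -> J u <= 1 -> `|L u| <= C.
Proof.
have [C C0 CP] := work_energy_bound n0 s0 p1 d0 OM sg1 qE pq gm gL (@ler01 R).
exists C => u uW uJ; rewrite -lee_fin.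
apply: le_trans (CP u uW _); last by rewrite (JE uW) lee_fin.
rewrite -abse_EFin -(LE uW); apply: le_abse_integral => //.
by apply/measurable_EFinP; apply: measurable_funM => //; exact: Wm.
Qed.

Let eps k : R := (4^-1 ^+ k) `^ p i0.

Let eps_gt0 k : 0 < eps k.
Proof. by rewrite powR_gt0// exprn_gt0// invr_gt0. Qed.

Let eps_cvg0 d : 0 < d -> exists K, forall k, (K <= k)%N -> eps k <= d.
Proof.
move=> dd0.
have : (4^-1 : R) ^+ k @[k --> \oo] --> 0.
  by apply: cvg_expr; rewrite ger0_norm ?invr_ge0// invf_lt1// ltr1n.
move=> /cvgr0_norm_le /(_ _ dd0)[K _ HK]; exists K => k Kk.
have e0 : 0 < (4^-1 : R) ^+ k by rewrite exprn_gt0// invr_gt0.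
apply: le_trans (HK k Kk); rewrite gtr0_norm// ge1r_powR ?(ltW (p1 _))// e0/=.
by rewrite exprn_ile1 ?invr_ge0// invf_le1// ler1n.
Qed.

Let Jcomplete (un : nat -> rV -> R) : (forall k, W (un k)) ->
  (forall k l, (k <= l)%N -> J (un k - un l) <= eps k) ->
  exists u, [/\ W u, forall k, J (un k - u) <= eps k &
    forall c K, (forall l, (K <= l)%N -> J (un l) <= c) -> J u <= c].
Proof.
move=> unW une.
have une' k l : (k <= l)%N -> (energy (un k - un l)%R <= (eps k)%:E)%E.
  by move=> kl; rewrite (JE (WB (unW k) (unW l))) lee_fin une.
have [u [uW ue uc]] := finite_energy_complete s0 p1 d0 OM unW une'.
exists u; split => // [k|c K uK].
  by rewrite -lee_fin -(JE (WB (unW k) uW)); exact: ue.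
rewrite -lee_fin -(JE uW); apply: (uc _ K) => l Kl.
by rewrite (JE (unW l)) lee_fin uK.
Qed.

Lemma minimizer_exists : exists2 u, W u & forall v, W v -> J u - L u <= J v - L v.
Proof.
(* Among the t^(p_i), the largest has the smallest exponent if t <= 1 and the largest exponent if t
   >= 1. *)
have [im imP] : exists im, forall i, p im <= p i.
  by have [im _ imP] := @arg_minP _ _ _ i0 xpredT p isT; exists im => i; exact: imP.
have [iM iMP] : exists iM, forall i, p i <= p iM.
  by have [iM _ iMP] := @arg_maxP _ _ _ i0 xpredT p isT; exists iM => i; exact: iMP.
apply: (@exists_minimizer _ _ W J L W0 WD WZ J_ge0 (p im) (p iM) (p1 im) _ _ Jconvex LD LZ
  Lbounded eps eps_gt0 eps_cvg0 Jcomplete).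
- move=> t u uW t0 t1; apply: Jscale => //; first exact: powR_ge0.
  by move=> i; rewrite gtr0_norm// ger_powR// t0.
- move=> t u uW t1; apply: Jscale => //; first exact: powR_ge0.
  by move=> i; rewrite ger0_norm ?(le_trans _ t1)// ler_powR.
Qed.

(* By convexity at u + t v, t L v <= J (u + t v) - J u <= t P (u + t v) v. *)
Let euler_lagrange_le u v : W u -> (forall v, W v -> J u - L u <= J v - L v) ->
  W v -> L v <= P u v.
Proof.
move=> uW umin vW.
have cv : pairing (u + (m.+1%:R^-1 : R) *: v) v @[m --> \oo] --> pairing u v.
  exact: (pairing_cvg p1 d0 (Wm uW) (Wm vW) (Woo uW) (Woo vW)).
rewrite -lee_fin -(PE uW vW) -(cvg_lim _ cv)//.
apply: lime_ge; first by apply/cvg_ex; exists (pairing u v).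
apply: nearW => m; set t : R := m.+1%:R^-1.
have t0 : 0 < t by rewrite invr_gt0.
have tW := WZ t vW; have utW := WD uW tW.
rewrite (PE utW vW) lee_fin -(ler_pM2l t0).
have := J_tangent utW uW; have := umin _ utW.
have -> : u - (u + t *: v) = (- t) *: v by rewrite opprD addrA subrr sub0r scaleNr.
rewrite (LD uW tW) (LZ _ vW) (PZ _ utW vW).
move: (J (u + t *: v)) (J u) (L u) (L v) (P (u + t *: v) v) => a b c d e.
lra.
Qed.

Lemma euler_lagrange u v : W u -> (forall v, W v -> J u - L u <= J v - L v) ->
  W v -> L v = P u v.
Proof.
move=> uW umin vW; apply/eqP; rewrite eq_le euler_lagrange_le//=.
have := euler_lagrange_le uW umin (WZ (-1) vW).
by rewrite LZ// PZ// !mulN1r lerN2.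
Qed.

(** A critical point of a convex functional is a minimizer. This reduces uniqueness of weak
    solutions to that of minimizers. *)
Lemma weak_solution_minimizer u : W u -> (forall v, W v -> P u v = L v) ->
  forall v, W v -> J u - L u <= J v - L v.
Proof.
move=> uW uP v vW; have := J_tangent uW vW; rewrite (uP _ (WB vW uW)).
rewrite -scaleN1r (LD vW (WZ (-1) uW)) (LZ _ uW).
move: (J u) (J v) (L u) (L v) => a b c d.
lra.
Qed.

Theorem weak_solution_exists_unique : exists u,
  (W u /\ forall v, W v -> pairing u v = work g v) /\
  forall w, (W w /\ forall v, W v -> pairing w v = work g v) ->
    {ae mu, forall x, w x = u x}.
Proof.
have [u uW umin] := minimizer_exists; exists u; split.
  by split=> // v vW; rewrite (PE uW vW) (LE vW) (euler_lagrange uW umin vW).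
move=> w [wW wP].
have wmin : forall v, W v -> J w - L w <= J v - L v.
  apply: (weak_solution_minimizer wW) => v vW; apply: EFin_inj.
  by rewrite -(PE wW vW) -(LE vW) wP.
have Jwu := minimizer_unique WD WZ J_ge0 Jconvex LD LZ wW uW wmin umin.
have [C C0 CP] := energy_poincare s0 p1 d0 OM i0.
have wuW := WB wW uW.
(* The Poincare inequality turns J (w - u) <= 0 into equality almost everywhere. *)
have I0 : (\int[mu]_x `|(`|(w - u) x| `^ p i0)%:E| = 0)%E.
  apply/eqP; rewrite eq_le; apply/andP; split; last exact: integral_ge0.
  under eq_integral do rewrite gee0_abs ?lee_fin ?powR_ge0//.
  apply: (le_trans (CP _ wuW)); rewrite (JE wuW) -EFinM lee_fin.
  by rewrite mulr_ge0_le0.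
have mwu : measurable_fun [set: rV] (fun x => (`|(w - u) x| `^ p i0)%:E).
  by apply/measurable_EFinP; apply: measurable_powR_norm; exact: Wm.
have := iffLR (ae_eq_integral_abs mu measurableT mwu) I0.
apply: filterS => x /(_ I) [] /eqP.
by rewrite powR_eq0 normr_eq0 fctE subr_eq0 => /andP[/eqP].
Qed.

End weak_solutions.

(** * Exponents, and return to the original formulation *)

Section exponent_identities.
Context (R : realType) (n : nat) (s p : 'I_n -> R).
Hypothesis n0 : (0 < n)%N.
Hypothesis s0 : forall i, 0 < s i.
Hypothesis p0 : forall i, 0 < p i.
Hypothesis sp_bar_lt : sp_bar s p < n%:R.
Let i0 := Ordinal n0.

Let sg_gt0 : 0 < \sum_(i < n) (s i * p i)^-1.
Proof.
rewrite (bigD1 i0)//= ltr_pwDl ?invr_gt0 ?mulr_gt0//.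
by apply: sumr_ge0 => i _; rewrite invr_ge0 mulr_ge0// ltW.
Qed.

Let S_gt0 : 0 < \sum_(i < n) (s i)^-1.
Proof.
rewrite (bigD1 i0)//= ltr_pwDl ?invr_gt0//.
by apply: sumr_ge0 => i _; rewrite invr_ge0 ltW.
Qed.

(** With sg this sum, [sp_bar s p] is n / sg. *)
Lemma sum_inv_sp_gt1 : 1 < \sum_(i < n) (s i * p i)^-1.
Proof.
have nR : 0 < n%:R :> R by rewrite ltr0n.
move: sp_bar_lt; rewrite /sp_bar /harmonic_mean invfM invrK.
by rewrite ltr_pdivrMr// ltr_pMr.
Qed.

(** Let S be the sum of the 1 / s_i. Inserting n / sg and n / S for the two harmonic means
    simplifies the critical exponent to S / (sg - 1). *)
Lemma critical_exponentE : \sum_(i < n) (s i)^-1 =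
  critical_exponent s p * (\sum_(i < n) (s i * p i)^-1 - 1).
Proof.
have nR : 0 < n%:R :> R by rewrite ltr0n.
have sg1 := sum_inv_sp_gt1.
rewrite /critical_exponent /sp_bar /harmonic_mean.
move: sg_gt0 S_gt0 sg1; move: (\sum_(i < n) (s i * p i)^-1) (\sum_(i < n) (s i)^-1) n%:R nR.
move=> a b c c0 a0 b0 a1; field.
have ca : 0 < c * a - c by rewrite -[X in _ - X]mulr1 -mulrBr mulr_gt0// subr_gt0.
by rewrite !gt_eqF.
Qed.

End exponent_identities.

Lemma hoelder_conjugate_EFin (R : realType) (q : R) : 1 < q ->
  hoelder_conjugate q%:E = (q / (q - 1))%:E.
Proof.
move=> q1; have q0 : 0 < q by rewrite (lt_trans _ q1).
have q10 : 0 < q - 1 by rewrite subr_gt0.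
symmetry; apply/hoelder_conjugateP; rewrite ?ltNyr// ?eqe ?gt_eqF//.
rewrite !inver !gt_eqF ?divr_gt0// -EFinD; congr EFin.
by field; rewrite !gt_eqF.
Qed.

Lemma work_patch (R : realType) (n : nat) (Omega : set 'rV[R]_n) (f v : 'rV[R]_n -> R) :
  (work (patch (fun=> 0%R) Omega f) v =
   \int[lebesgue_rV R n]_(x in Omega) (f x * v x)%:E)%E.
Proof.
rewrite integral_mkcond; apply: eq_integral => x _; rewrite !patchE.
by case: ifP => //; rewrite mul0r.
Qed.

Theorem proposition3p10 (R : realType) (n : nat) (Omega : set 'rV[R]_n)
    (delta s p : 'I_n -> R) :
  (0 < n)%N ->
  open Omega -> bounded_set Omega ->
  (forall i, 0 < delta i) ->
  (forall i, 0 < s i < 1) ->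
  (forall i, 1 < p i) ->
  sp_bar s p < n%:R ->
  max_exponent p < critical_exponent s p ->
  forall f : 'rV[R]_n -> R,
    Lfun_on Omega (hoelder_conjugate (critical_exponent s p)%:E) f ->
    exists u : 'rV[R]_n -> R,
      weak_solution Omega s p delta f u /\
      forall w : 'rV[R]_n -> R, weak_solution Omega s p delta f w ->
        {ae lebesgue_rV R n, forall x, w x = u x}.
Proof.
move=> n0 _ [M0 [_ OM0]] d0 s01 p1 spn pmax f fL.
have s0 i : 0 < s i by have /andP[] := s01 i.
have p0 i : 0 < p i by rewrite (lt_trans _ (p1 i)).
have sg1 := sum_inv_sp_gt1 n0 s0 p0 spn.
have qE := critical_exponentE n0 s0 p0 spn.
have pq i : p i < critical_exponent s p.
  by apply: le_lt_trans pmax; rewrite /max_exponent; exact: le_bigmax.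
have q1 : 1 < critical_exponent s p by exact: lt_trans (p1 (Ordinal n0)) (pq _).
have OM x : Omega x -> `|x| <= M0 + 1 by move=> Ox; apply: OM0 => //; rewrite ltrDl.
have q'0 : 0 < critical_exponent s p / (critical_exponent s p - 1).
  by rewrite divr_gt0 ?subr_gt0// (lt_trans _ q1).
move: fL; rewrite /Lfun_on/= (hoelder_conjugate_EFin q1).
move=> /(iffLR (Lfun_powRP (lebesgue_rV R n) _ q'0)) [gm gL].
(* Solutions and test functions range over the same space, so space and pairing are replaced
   together; [f] enters through its extension by zero. *)
have weakP u : weak_solution Omega s p delta f u <->
    finite_energy s p delta Omega u /\ forall v, finite_energy s p delta Omega v ->
      pairing s p delta u v = work (patch (fun=> 0%R) Omega f) v.
  have PW := sobolev0P n0 s0 p1 d0 OM.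
  have pE v w : finite_energy s p delta Omega v -> finite_energy s p delta Omega w ->
      laplacian_pairing s p delta v w = pairing s p delta v w.
    by move=> [vm voo _] [wm woo _]; exact: (laplacian_pairingE p1 d0 vm wm voo woo).
  split=> [[/PW uW uP]|[uW uP]]; split.
  - exact: uW.
  - move=> v vW; rewrite -(pE _ _ uW vW) work_patch; apply: uP; exact/PW.
  - exact/PW.
  - by move=> v /PW vW; rewrite (pE _ _ uW vW) uP// work_patch.
have [u [/weakP uW uu]] :=
  weak_solution_exists_unique n0 s0 p1 d0 OM sg1 qE pq gm gL.
by exists u; split => // w /weakP; exact: uu.
Qed.
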